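(* Let $\varepsilon>0$ be a constant, let $c=(1+\varepsilon)n$ and let $p=\frac{\log n+\log\log n+\omega(1)}{n}$. Then a random graph $G\sim \mathcal G_c(n,p)$ contains, with probability $1-o(1)$ as $n\to\infty$, a rainbow Hamilton cycle.
   Context: $\mathcal G_c(n,p)$ denotes the probability space of edge-colored graphs on vertex set $[n]=\{1,\dots,n\}$ obtained by including each pair of vertices as an edge independently with probability $p$, and then assigning to each chosen edge a color from $[c]$ uniformly and independently at random. A subgraph is rainbow if all its edges have distinct colors. Asymptotic notation refers to $n\to\infty$. *)

(* Defs.v *)
From HB Require Import structures.
From mathcomp Require Import all_boot all_order all_algebra all_fingroup.
From mathcomp Require Import all_classical all_reals all_analysis.
Set Implicit Arguments. Unset Strict Implicit. Unset Printing Implicit Defensive.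
Import Order.TTheory GRing.Theory Num.Theory.
Local Open Scope ring_scope.

Definition edge_pred (n : nat) := fun e : 'I_n * 'I_n => (e.1 < e.2)%N.
Definition edge (n : nat) := {e : 'I_n * 'I_n | edge_pred e}.

(* An outcome of G_c(n,p): each potential edge is either absent (None)
   or present with colour k in [c] = 'I_c (Some k). *)
Definition perm_of (T : finType) := {perm T}.

Definition outcome (n c : nat) := {ffun edge n -> option 'I_c}.

Definition ecol (n c : nat) (f : outcome n c) (u v : 'I_n) : option 'I_c :=
  match @insub _ (@edge_pred n) (edge n) (u, v) with
  | Some e => f e
  | None => match @insub _ (@edge_pred n) (edge n) (v, u) with
            | Some e => f e
            | None => None
            end
  end.

Definition has_rainbow_ham (n c : nat) (f : outcome n c) : bool :=
  (3 <= n)%N &&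
  [exists s : perm_of 'I_n,
     [forall i : 'I_n, ecol f (s i) (s (ordS i)) != None] &&
     injectiveb (fun i : 'I_n => ecol f (s i) (s (ordS i)))].

(* Probability of outcome f in G_c(n,p): edges independent with prob. p,
   each present edge coloured uniformly from [c]. *)
Definition Gc_weight (R : realType) (n c : nat) (p : R) (f : outcome n c) : R :=
  \prod_(e : edge n) (if f e is Some _ then p / c%:R else 1 - p).

Definition Gc_prob (R : realType) (n c : nat) (p : R) (A : pred (outcome n c)) : R :=
  \sum_(f : outcome n c | A f) Gc_weight p f.

Definition ncolors (R : realType) (eps : R) (n : nat) : nat :=
  absz (Num.floor ((1 + eps) * n%:R)).

(* Main.v *)
(* By monotonicity p may be taken close to the threshold. Split the colours into [Cb] and [Ce], with about
   eps n / 8 colours each, and [Cm], with more than n colours. Let l be about (ln n) ^ (1/60). A vertex is poor if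
   it sends few [Ce]-coloured edges to a fixed set [Y0] of about n / l ^ 27 vertices, and small if its degree is
   below 7 l ^ 29. Poor vertices are rare enough for no vertex to have many of them within distance two, and
   small vertices are far from the other poor ones.

   Every poor vertex becomes the middle of a path of length two with ports that are not poor; the remaining
   vertices outside [Y0] are merged into few rainbow paths coloured from [Cm], because any two large sets are
   joined by an edge with a colour from any large set of colours. Hall's theorem with demands then selects
   colours for the poor vertices and, for every port, many private colours of [Ce]-coloured edges into [Y0]. The
   outcome is a rainbow graph on these units in which small sets of ports expand, so Posa's rotations
   yield quadratically many boosters: pairs that lengthen a longest path or close it.

   The [Cb]-coloured edges avoiding the poor vertices were not used so far. Conditionally on everything else, any
   given set of at most n / l ^ 25 added edges fails to have a booster with a fresh colour from [Cb] with a
   probability beating the number of such sets. Hence boosters can be added one at a time until a rainbow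
   Hamilton cycle appears. *)
Require Import Defs.
From HB Require Import structures.
From mathcomp Require Import all_boot all_order all_algebra perm boolp zify.
Set Implicit Arguments. Unset Strict Implicit. Unset Printing Implicit Defensive.

(** The obstacle is that at this density the graph cannot be exposed in two independent rounds: a
    vertex of degree two needs both of its edges, whatever their colours, so nothing can be withheld
    uniformly. Hence edges at poor vertices are all revealed. Poverty is defined through [Ce] alone,
    so which edges may be hidden is known without looking at a hidden edge, and the hidden edges
    stay independent given the rest. The base structure must likewise be a function of what is
    revealed; otherwise the boosters would depend on the colours that are to hit them.

    Numerically everything compares powers of [l], with [n * p] of order [l ^ 60]. A vertex is poor
    with probability at most [exp(- l ^ 31)]. As [31 + 29 = 60], having [3 * l ^ 29] poor vertices
    around one vertex costs [exp(- 3 * l ^ 60)], which beats the [n <= exp(2 * l ^ 60)] choices of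
    that vertex. The threshold [7 * l ^ 29] follows: a vertex that is not small keeps [l ^ 29]
    usable neighbours after losing [3 * l ^ 29] of them for each of two reasons. *)

Definition coloured_in c (K : {set 'I_c}) (o : option 'I_c) := if o is Some k then k \in K else false.

(** * Counting coloured edges and hiding a part of an outcome *)

Section Outcomes.
Variables (n c : nat).
Notation out := (outcome n c).
Implicit Types (f g h : out) (K Cb : {set 'I_c}) (M : {set edge n}).

Definition cnt K M f := #|[set e in M | coloured_in K (f e)]|.

Definition subout f g := forall e, f e != None -> g e = f e.

Definition supp h := [set e | h e != None].

Definition strip Cb f : out := [ffun e => if coloured_in Cb (f e) then None else f e].

(** The revealed part of [f]: an edge of [hd f] that is seen as absent may be absent or carry any
    colour of [Cb]. *)
Definition masked Cb (hd : out -> {set edge n}) f : out :=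
  [ffun e => if coloured_in Cb (f e) && (e \in hd f) then None else f e].

(** The failure of one step of the greedy search for boosters: [h] records the boosters added so
    far, [A] the candidates computed from the revealed part, [forb] the colours already spent. There
    are [N0] candidates, but none has a fresh colour. Keeping [h] explicit prepares a union bound
    over [h]. *)
Definition mask_event Cb (hd : out -> {set edge n}) (A : out -> out -> {set edge n}) (forb : out -> out -> {set 'I_c}) (N0 : nat) h f :=
  [&& [forall (e | e \in supp h), [&& f e == h e, coloured_in Cb (h e) & e \in hd f]],
      N0 <= #|A (masked Cb hd f) h| &
      [forall (e | e \in A (masked Cb hd f) h), ~~ coloured_in (Cb :\: forb (masked Cb hd f) h) (f e)]].

End Outcomes.

(** * Rotation-extension for paths of units *)

Lemma sorted_rcons_cat (T : Type) (e : rel T) l x y l2 :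
  sorted e (rcons l x ++ y :: l2) = [&& sorted e (rcons l x), e x y & path e y l2].
Proof.
case: l => [|a l] /=; first by [].
by rewrite cat_path last_rcons /=.
Qed.

Section SuperPath.
Variables (T : finType) (io : T -> T) (Z Y : {set T}).
Hypotheses (ioK : involutive io) (ioZ : forall z, (io z \in Z) = (z \in Z)).
Hypotheses (ioY : {in Y, forall y, io y = y}) (YZ : Y \subset Z).
Implicit Types (h : rel T) (s l : seq T).

(* A unit is a path of the graph, given by its two ports [z] and [io z]; the free vertices [Y] are units
   with one port. A path passing through units is recorded as the sequence of the ports at which it enters
   them, so that consecutive entries [a], [b] are joined by an edge from [io a] to [b]. *)
Definition jn h : rel T := fun a b => h (io a) b.
(** Each unit is entered at most once, so only one of its two ports may occur; a unit with one port
    has [io x = x] and is exempt from the second test. *)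
Definition okp s :=
  [&& uniq s, all (fun x => (io x == x) || (io x \notin s)) s & all (mem Z) s].
Definition spath h s := okp s && sorted (jn h) s.
Definition uin s x := (x \in s) || (io x \in s).
(** Walking backwards enters every unit by its other port. *)
Definition srev s := rev (map io s).

Lemma okpP s : reflect [/\ uniq s, forall x, x \in s -> io x \in s -> io x = x
   & {subset s <= Z}] (okp s).
Proof.
apply: (iffP and3P) => [[us /allP fs /allP Zs]|[us fs Zs]]; split => //.
- by move=> x xs ixs; have := fs x xs; rewrite ixs orbF => /eqP.
- by apply/allP => x xs; case: (boolP (io x \in s)) => [/(fs x xs)->|]; rewrite ?eqxx ?orbT.
- by apply/allP => x /Zs.
Qed.

Lemma io_inj : injective io. Proof. exact: inv_inj. Qed.

Lemma mem_srev s x : (x \in srev s) = (io x \in s).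
Proof. by rewrite mem_rev -{1}(ioK x) mem_map //; exact: io_inj. Qed.

Lemma srevK : involutive srev.
Proof. by move=> s; rewrite /srev map_rev revK mapK. Qed.

Lemma srev_cons x s : srev (x :: s) = rcons (srev s) (io x).
Proof. by rewrite /srev /= rev_cons. Qed.

Lemma size_srev s : size (srev s) = size s.
Proof. by rewrite size_rev size_map. Qed.

Lemma uin_srev s x : uin (srev s) x = uin s x.
Proof. by rewrite /uin !mem_srev ioK orbC. Qed.

Lemma okp_srev s : okp s -> okp (srev s).
Proof.
case/okpP=> us fs Zs; apply/okpP; split.
- by rewrite rev_uniq map_inj_uniq //; exact: io_inj.
- by move=> x; rewrite !mem_srev ioK => xs xs'; apply/esym; rewrite -{1}[x]ioK; apply: fs; rewrite ?ioK.
- by move=> x; rewrite mem_srev => /Zs; rewrite ioZ.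
Qed.

Lemma sorted_srev h s : symmetric h -> sorted (jn h) (srev s) = sorted (jn h) s.
Proof.
move=> hs; rewrite /srev rev_sorted sorted_map; apply: eq_sorted => x y.
by rewrite /= /jn ioK hs.
Qed.

Lemma spath_srev h s : symmetric h -> spath h s -> spath h (srev s).
Proof. by move=> hs /andP[/okp_srev ok so]; rewrite /spath ok sorted_srev. Qed.

Lemma head_srev x s : head x (srev s) = io (last (io x) s).
Proof.
elim/last_ind: s => [|s y _]; first by rewrite /= ioK.
by rewrite last_rcons /srev map_rcons rev_rcons.
Qed.

Lemma last_srev x s : last x (srev s) = io (head (io x) s).
Proof. by rewrite -[s in RHS]srevK head_srev !ioK. Qed.

(** Posa's rotation: the edge from [v] to [y] replaces the path edge that entered [y]. The reversed
    initial part ends with the entry [io v], whose exit port is [v], so the new junction is exactly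
    [h v y]. *)
Lemma spath_rotate h v l1 y l2 : symmetric h -> y \in Y -> h v y ->
  spath h (v :: l1 ++ y :: l2) -> spath h (srev (v :: l1) ++ y :: l2).
Proof.
move=> hs yY hvy; rewrite /spath -cat_cons => /andP[/okpP[us fs Zs] so].
have so1 : sorted (jn h) (v :: l1).
  by move: so; rewrite (lastI v l1) sorted_rcons_cat => /and3P[].
have so2 : path (jn h) y l2.
  by move: so; rewrite (lastI v l1) sorted_rcons_cat => /and3P[].
apply/andP; split; last first.
  by rewrite srev_cons sorted_rcons_cat -srev_cons sorted_srev // so1 /jn ioK hvy.
move: us; rewrite cat_uniq => /and3P[u1 /hasPn d u2].
have ok1 : okp (v :: l1).
  apply/okpP; split => // x xs; last by apply: Zs; rewrite mem_cat xs.
  by move=> ixs; apply: fs; rewrite mem_cat ?xs ?ixs.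
case/okpP: (okp_srev ok1) => ur fr Zr.
apply/okpP; split.
- rewrite cat_uniq ur u2 andbT; apply/hasPn => x xs; apply/negP.
  rewrite /= mem_srev => ixs; have /= := d _ xs; rewrite -(fs x) ?ixs //.
    by rewrite mem_cat xs orbT.
  by rewrite mem_cat ixs.
- move=> x; rewrite !mem_cat !mem_srev ioK => /orP[] xs /orP[] ixs.
  + by apply: fr; rewrite ?mem_srev ?ioK.
  + by move: (d _ ixs); rewrite /= xs.
  + by move: (d _ xs); rewrite /= ixs.
  + by apply: fs; rewrite mem_cat ?xs ?ixs ?orbT.
- by move=> x; rewrite mem_cat => /orP[/Zr|xs] //; apply: Zs; rewrite mem_cat xs orbT.
Qed.

Inductive reach h : seq T -> seq T -> Prop :=
| reach_refl s : reach h s s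
| reach_step s v l1 y l2 : y \in Y -> h v y -> reach h s (v :: l1 ++ y :: l2) ->
    reach h s (srev (v :: l1) ++ y :: l2).

Lemma reach_spath h s s' : symmetric h -> reach h s s' -> spath h s -> spath h s'.
Proof.
move=> hs; elim=> // {}s v l1 y l2 yY hvy _ IH /IH; exact: spath_rotate.
Qed.

Lemma reach_last h s s' x : reach h s s' -> last x s' = last x s.
Proof. by elim=> // {}s v l1 y l2 _ _ _ <-; rewrite last_cat /= last_cat. Qed.

Lemma reach_size h s s' : reach h s s' -> size s' = size s.
Proof. by elim=> // {}s v l1 y l2 _ _ _ <-; rewrite size_cat size_srev /= !size_cat. Qed.

Lemma reach_uin h s s' : reach h s s' -> uin s' =1 uin s.
Proof.
elim=> // {}s v l1 y l2 _ _ _ IH x; rewrite -IH -cat_cons /uin !mem_cat.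
have := uin_srev (v :: l1) x; rewrite /uin.
by do 2 case: (_ \in srev _); do 2 case: (_ \in v :: l1) => //; rewrite /= ?orbT.
Qed.

(* [a] is the vertex next to the free vertex [y] on one side of [y] along the path. *)
Definition sidenb s y a :=
  (exists l1 x l2, s = l1 ++ x :: y :: l2 /\ a = io x) \/
  (exists l1 l2, s = l1 ++ y :: a :: l2).

Lemma sidenb_catr l s y a : sidenb s y a -> sidenb (l ++ s) y a.
Proof.
case=> [[l1 [x [l2 [-> ->]]]]|[l1 [l2 ->]]]; [left|right].
  by exists (l ++ l1), x, l2; rewrite catA.
by exists (l ++ l1), l2; rewrite catA.
Qed.

Lemma sidenb_catl l s y a : sidenb s y a -> sidenb (s ++ l) y a.
Proof.
case=> [[l1 [x [l2 [-> ->]]]]|[l1 [l2 ->]]]; [left|right].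
  by exists l1, x, (l2 ++ l); rewrite -catA.
by exists l1, (l2 ++ l); rewrite -catA.
Qed.

Lemma srev_cat s1 s2 : srev (s1 ++ s2) = srev s2 ++ srev s1.
Proof. by rewrite /srev map_cat rev_cat. Qed.

Lemma sidenb_srev s y a : y \in Y -> sidenb s y a -> sidenb (srev s) y a.
Proof.
move=> yY [[l1 [x [l2 [-> ->]]]]|[l1 [l2 ->]]]; [right|left].
  exists (srev l2), (srev l1).
  by rewrite srev_cat !srev_cons ioY // -!cats1 -!catA.
exists (srev l2), (io a), (srev l1); rewrite ioK; split => //.
by rewrite srev_cat !srev_cons (ioY yY) -!cats1 -!catA.
Qed.

Lemma sidenb_cat s1 s2 y a : sidenb (s1 ++ s2) y a ->
  [\/ sidenb s1 y a, sidenb s2 y a,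
      exists l x l2, [/\ s1 = rcons l x, s2 = y :: l2 & a = io x] |
      exists l l2, s1 = rcons l y /\ s2 = a :: l2].
Proof.
elim: s1 => [|b s1 IH] /=; first by constructor 2.
case: s1 IH => [|c s1] IH.
  case=> [[[|d l1] [x [l2 [/= [-> E] ->]]]]|[[|d l1] [l2 /= [-> E]]]].
  - by constructor 3; exists [::], x, l2.
  - by constructor 2; left; exists l1, x, l2.
  - by constructor 4; exists [::], l2.
  - by constructor 2; right; exists l1, l2.
have lift : sidenb ((c :: s1) ++ s2) y a ->
  [\/ sidenb (b :: c :: s1) y a, sidenb s2 y a,
      exists l x l2, [/\ b :: c :: s1 = rcons l x, s2 = y :: l2 & a = io x] |
      exists l l2, b :: c :: s1 = rcons l y /\ s2 = a :: l2].
  case/IH => [H|H|[l [x [l2 [-> -> ->]]]]|[l [l2 [-> ->]]]].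
  - by constructor 1; exact: (sidenb_catr [:: b]).
  - by constructor 2.
  - by constructor 3; exists (b :: l), x, l2.
  - by constructor 4; exists (b :: l), l2.
case=> [[[|d l1] [x [l2 [/= E E3]]]]|[[|d l1] [l2 /= E]]].
- by case: E => E1 E2 _; constructor 1; left; exists [::], x, s1; rewrite E1 E2 E3.
- by case: E => _ E2; apply: lift; left; exists l1, x, l2; rewrite /= E2.
- by case: E => E1 E2 _; constructor 1; right; exists [::], s1; rewrite /= E1 E2.
- by case: E => _ E2; apply: lift; right; exists l1, l2; rewrite /= E2.
Qed.

Definition haslen h i := exists2 s, spath h s & size s = i.
Definition ham h := exists s, [/\ okp s, cycle (jn h) s & {in Z, forall z, uin s z}].
Definition boost h h' := ham h' \/ exists i, haslen h' i /\ ~ haslen h i.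
Definition outnb h (S : {set T}) := [set y in Y :\: S | [exists z in S, h z y]].
Definition expanding h m :=
  forall S : {set T}, S \subset Z -> 0 < #|S| <= m -> 2 * #|S| < #|outnb h S|.
Definition ends h s := [set v | `[< exists l, reach h s (v :: l) >]].

Lemma endsP h s v : reflect (exists l, reach h s (v :: l)) (v \in ends h s).
Proof. by rewrite inE; apply: asboolP. Qed.

Lemma okp_cons y s : y \in Z -> ~~ uin s y -> okp s -> okp (y :: s).
Proof.
rewrite /uin negb_or => yZ /andP[ys iys] /okpP[us fs Zs]; apply/okpP; split; first by rewrite /= ys.
- move=> x; rewrite !inE => /orP[/eqP->|xs] /orP[/eqP ixy|ixs] //; last exact: fs.
    by rewrite ixs in iys.
  by rewrite -ixy ioK xs in iys.
- by move=> x; rewrite inE => /orP[/eqP-> //|/Zs].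
Qed.

Section Reach.
Variables (h : rel T) (hs : symmetric h).

Lemma ends_next s v l1 y l2 : y \in Y -> h v y -> reach h s (v :: l1 ++ y :: l2) ->
  io (last v l1) \in ends h s.
Proof.
move=> yY hvy r; apply/endsP; have := reach_step yY hvy r.
have : head v (srev (v :: l1)) = io (last v l1) by rewrite head_srev.
case: (srev (v :: l1)) (size_srev (v :: l1)) => //= a l _ -> H.
by exists (l ++ y :: l2).
Qed.

Lemma ends_refl v l : v \in ends h (v :: l).
Proof. by apply/endsP; exists l; constructor. Qed.

(** A rotation breaks one path edge, making one of its endpoints an end, and creates one edge at the
    previous end. If neither [y] nor a neighbour of [y] on [s0] ever becomes an end, no such edge
    contains [y]. *)
Lemma sidenb_reach s0 s y a : y \in Y -> y \notin ends h s0 ->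
  (forall b, b \in ends h s0 -> ~ sidenb s0 y b) ->
  reach h s0 s -> sidenb s y a -> sidenb s0 y a.
Proof.
move=> yY yE nS r; elim: r yE nS a => // {s0}s0 v l1 y' l2 y'Y hv r IH yE nS a.
have side b : sidenb (v :: l1 ++ y' :: l2) y b -> sidenb s0 y b by exact: IH.
have vE : v \in ends h s0 by apply/endsP; exists (l1 ++ y' :: l2).
case/sidenb_cat => [/(sidenb_srev yY)|H|[l [x [l3 [_ [yy' _] _]]]]|[l [l3 [E _]]]].
- by rewrite srevK => /(sidenb_catl (y' :: l2)); rewrite cat_cons; apply: side.
- by apply: side; rewrite -cat_cons; apply: sidenb_catr.
- case: (nS _ (ends_next y'Y hv r)); apply: side; left.
  by exists (belast v l1), (last v l1), l2; rewrite -cat_cons lastI cat_rcons yy'.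
- move: E; rewrite srev_cons => /rcons_inj[_ vy].
  by case/negP: yE; have -> : y = v by rewrite -[v]ioK vy ioY.
Qed.

Lemma reach_haslen s0 v l y : spath h s0 -> reach h s0 (v :: l) -> y \in Y -> h v y ->
  ~~ uin s0 y -> haslen h (size s0).+1.
Proof.
move=> p r yY hvy ny; have /andP[ok so] := reach_spath hs r p.
rewrite -(reach_uin r) in ny; exists (y :: v :: l); last by rewrite /= -(reach_size r).
rewrite /spath okp_cons //=; last by apply: (subsetP YZ).
by rewrite /jn ioY // hs hvy.
Qed.

(** Posa's lemma. Let a free vertex [y] that is never an end be adjacent to an end. It lies on the
    path, which cannot be lengthened, and the rotation at [y] makes one of its neighbours an end;
    that neighbour is already its neighbour on [s0]. So the outer neighbours of the set of ends are
    successors or predecessors of ends on [s0], at most two per end, against expansion. *)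
Lemma posa s0 m : expanding h m -> spath h s0 -> s0 != [::] ->
  ~ haslen h (size s0).+1 -> m < #|ends h s0|.
Proof.
move=> hexp p s0n nlen; rewrite ltnNge; apply/negP => le.
set S := ends h s0 in le *.
have SZ : S \subset Z.
  apply/subsetP => v /endsP[l r]; have /andP[/okpP[_ _ Zs] _] := reach_spath hs r p.
  by apply: Zs; rewrite inE eqxx.
have S0 : 0 < #|S|.
  by rewrite card_gt0; apply/set0Pn; case E: {1}s0 s0n => [|v l] // _; exists v; rewrite /S E; apply: ends_refl.
have := hexp S SZ; rewrite S0 le => /(_ isT); apply/negP; rewrite -leqNgt.
(* A free vertex next to [x] on [s0] comes either right after the unit left through [x], that is
   entered at [io x], or right before the entry [x]. *)
pose nxt x := nth x s0 (index (io x) s0).+1; pose prv x := nth x s0 (index x s0).-1.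
have us : uniq s0 by case/andP: p => /okpP[].
apply: (@leq_trans #|(nxt @: S) :|: (prv @: S)|); last first.
  rewrite mul2n -addnn; apply: leq_trans (leq_card_setU _ _) _.
  by apply: leq_add; exact: leq_imset_card.
apply: subset_leq_card; apply/subsetP => y; rewrite !inE => /andP[/andP[yS yY] /existsP[v /andP[vS hvy]]].
have {}yS : y \notin S by rewrite inE.
have [[w wS sw]|nS] := pselect (exists2 w, w \in S & sidenb s0 y w).
  case: sw => [[l1 [x [l2 [E Ew]]]]|[l1 [l2 E]]]; apply/orP; [left|right].
    apply/imsetP; exists w => //; rewrite /nxt Ew ioK E.
    move: us; rewrite E cat_uniq /= => /and4P[_ /norP[nx _] _ _].
    by rewrite index_cat (negPf nx) /= eqxx addn0 nth_cat ltnNge leqnSn /= subSn // subnn.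
  apply/imsetP; exists w => //; rewrite /prv E.
  move: us; rewrite E cat_uniq /= !inE => /and3P[_ /norP[ny /norP[nw _]] /andP[/norP[yw _] _]].
  rewrite index_cat (negPf nw) /= (negPf yw) eqxx addn1 /=.
  by rewrite nth_cat ltnn subnn.
case/endsP: vS => l r.
have [yin|/(reach_haslen p r yY hvy)//] := boolP (uin s0 y).
move: yin; rewrite -(reach_uin r) /uin ioY // orbb inE => /orP[/eqP yv|yl].
  by case/negP: yS; apply/endsP; exists l; rewrite yv.
case/splitPr: yl r => l1 l2 r.
have wS := ends_next yY hvy r; case: (nS); exists (io (last v l1)) => //.
apply: (sidenb_reach yY yS _ r) => [b bS sb|].
  by apply: nS; exists b.
by left; exists (belast v l1), (last v l1), l2; rewrite -cat_cons lastI cat_rcons.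
Qed.

Lemma card_pairs_ge (S : {set T}) (A : {set T * T}) m :
  (forall v, v \in S -> m <= #|[set w | (v, w) \in A]|) -> #|S| * m <= #|A|.
Proof.
move=> H; rewrite -sum_nat_const.
have -> : #|A| = \sum_v #|[set w | (v, w) \in A]|.
  rewrite (eq_bigr (fun v => \sum_(w | (v, w) \in A) 1)); last first.
    by move=> v _; rewrite -sum1_card; apply: eq_bigl => w; rewrite inE.
  by rewrite pair_big_dep /= -sum1_card; apply: eq_bigl; case.
rewrite [leqRHS](bigID (mem S)) /=; apply: leq_trans (leq_addr _ _).
by apply: leq_sum => v /H.
Qed.

Lemma exists_longest : exists2 s0, spath h s0 & forall s, spath h s -> size s <= size s0.
Proof.
pose P i := `[< haslen h i >].
have ex : exists i, P i by exists 0; apply/asboolP; exists [::].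
have ub i : P i -> i <= #|T|.
  move=> /asboolP[s /andP[/okpP[us _ _] _] <-].
  by rewrite -(card_uniqP us) max_card.
case: (ex_maxnP ex ub) => i /asboolP[s ps <-] mx; exists s => // s' ps'.
by apply: mx; apply/asboolP; exists s'.
Qed.

(** On a longest path, if more than [m] ports are unvisited, joining any of them to any end
    lengthens the path. Otherwise each end [v] is held fixed while the reversed path is rotated,
    giving further ends [w]; the edge between [v] and [w] closes the path to a cycle. If the cycle
    misses a unit, the few unvisited ports expand and have a free neighbour on the cycle, where it
    can be reopened to include one more unit. *)
Lemma boosters m : expanding h m -> Z != set0 ->
  ~ ham h -> exists2 A : {set T * T}, m ^ 2 <= #|A| & forall p, p \in A ->
    [/\ p.1 \in Z, p.2 \in Z, p.1 != p.2 & forall h', symmetric h' -> subrel h h' ->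
      h' p.1 p.2 -> boost h h'].
Proof.
move=> hexp /set0Pn[z0 z0Z] nham.
have [s0 ps0 mx] := exists_longest.
have nlen : ~ haslen h (size s0).+1 by case=> s /mx le E; move: le; rewrite E ltnn.
have s0n : s0 != [::].
  apply/negP => /eqP s00; have := mx [:: z0]; rewrite s00 /spath => H.
  suff : 1 <= 0 by []. apply: H; rewrite /= andbT; apply/okpP.
  by split=> // x; rewrite !inE => /eqP-> // /eqP.
have SZ s v : spath h s -> v \in ends h s -> v \in Z.
  move=> ps /endsP[l r]; have /andP[/okpP[_ _ Zs] _] := reach_spath hs r ps.
  by apply: Zs; rewrite inE eqxx.
have spath_mono h' s : subrel h h' -> spath h s -> spath h' s.
  move=> sub /andP[ok so]; rewrite /spath ok /=; apply: sub_sorted so => x y; exact: sub.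
pose O := [set z in Z | ~~ uin s0 z].
pose S := ends h s0.
have mS : m < #|S| by exact: posa.
have [leO|ltO] := leqP #|O| m; last first.
  exists (setX S O); first by rewrite cardsX -mulnn leq_mul // ltnW.
  case=> v o; rewrite in_setX /= => /andP[vS]; rewrite inE => /andP[oZ no].
  have vZ := SZ _ _ ps0 vS; case/endsP: vS => l r.
  have vin : uin s0 v by rewrite -(reach_uin r) /uin inE eqxx.
  split => //; first by apply: contraNneq no => <-.
  move=> h' hs' sub hvo; right; exists (size s0).+1; split => //.
  have /(spath_mono _ _ sub)/andP[ok so] := reach_spath hs r ps0.
  exists (io o :: v :: l); last by rewrite /= -(reach_size r).
  have {}so : path (jn h') v l by [].
  rewrite /spath /= {1}/jn ioK hs' hvo so !andbT okp_cons ?ioZ //.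
  by rewrite /uin ioK orbC -/(uin _ _) (reach_uin r).
pose good (v w : T) := [/\ v \in Z, w \in Z, v != w &
  exists l, [/\ spath h (w :: l), size (w :: l) = size s0, uin (w :: l) =1 uin s0 & io (last w l) = v]].
exists [set p | `[< good p.1 p.2 >]].
  rewrite -mulnn; apply: leq_trans (card_pairs_ge (S := S) _ (m := m)); first by rewrite leq_mul2r (ltnW mS) orbT.
  move=> v vS; have [l r] := endsP _ _ _ vS.
  have pr := spath_srev hs (reach_spath hs r ps0).
  have sr : size (srev (v :: l)) = size s0 by rewrite size_srev (reach_size r).
  have lt : m < #|ends h (srev (v :: l))|.
    by apply: posa; rewrite ?sr // -size_eq0 sr size_eq0.
  (* The strict inequality in Posa's lemma leaves [m] choices of [w] after excluding [w = v]. *)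
  rewrite (cardsD1 v) in lt; have {}lt : m <= #|ends h (srev (v :: l)) :\ v|.
    by case: (v \in _) lt => //= /ltnW.
  apply: leq_trans lt _; apply: subset_leq_card; apply/subsetP => w; rewrite !in_setD1 => /andP[wv wE].
  rewrite !inE; apply/asboolP; split => /=; [exact: SZ vS|exact: SZ wE|by rewrite eq_sym|].
  case/endsP: wE => l' r'; exists l'; split.
  - exact: reach_spath r' pr.
  - exact: etrans (reach_size r') sr.
  - by move=> x; rewrite (reach_uin r') uin_srev (reach_uin r).
  - have /= := reach_last w r'; rewrite last_srev /= => ->; exact: ioK.
case=> v w; rewrite inE => /asboolP[/= vZ wZ vw [l [pl sl ul lv]]]; split => //.
move=> h' hs' sub hvw.
have cy : cycle (jn h') (w :: l).
  rewrite /= rcons_path /jn lv hvw andbT.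
  by have /andP[_] := spath_mono _ _ sub pl.
have okl : okp (w :: l) by case/andP: pl.
have [O0|Op] := posnP #|O|.
  left; exists (w :: l); split => // z zZ; rewrite ul; apply/negPn/negP => nz.
  by move/cards0_eq/setP/(_ z): O0; rewrite !inE zZ nz.
right; exists (size s0).+1; split => //.
have OZ : O \subset Z by apply/subsetP => x; rewrite inE => /andP[].
have := hexp O OZ; rewrite Op leO => /(_ isT) /(leq_ltn_trans (leq0n _)).
rewrite card_gt0 => /set0Pn[y]; rewrite !inE => /andP[/andP[yO yY] /existsP[o /andP[]]].
rewrite inE => /andP[oZ no] hoy.
have yl : y \in w :: l.
  by move: yO; rewrite (subsetP YZ _ yY) /= negbK -ul /uin ioY // orbb.
case: (rot_to yl) => i s' rE.
have cy' : cycle (jn h') (y :: s') by rewrite -rE rot_cycle.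
have ok' : okp (y :: s').
  case/okpP: okl => us fs Zs; apply/okpP; rewrite -rE; split; first by rewrite rot_uniq.
    by move=> x; rewrite !mem_rot; apply: fs.
  by move=> x; rewrite mem_rot; apply: Zs.
exists (io o :: y :: s'); last by rewrite -sl [RHS]/= -[(size l).+1](size_rot i (w :: l)) rE.
rewrite /spath okp_cons ?ioZ //; last first.
  by rewrite /uin ioK -rE !mem_rot orbC -/(uin _ _) ul.
rewrite /= /jn ioK sub //=.
by move: cy'; rewrite /= rcons_path => /andP[].
Qed.

End Reach.

(** * From a cycle of units back to a cycle of vertices *)

Section Expand.
Variables (h : rel T) (ul : T -> seq T).
Hypotheses (ul_head : {in Z, forall z, head z (ul z) = z /\ ul z != [::]})
  (ul_last : {in Z, forall z, last z (ul z) = io z})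
  (ul_sorted : {in Z, forall z, sorted h (ul z)})
  (ul_uniq : {in Z, forall z, uniq (ul z)})
  (ul_rev : {in Z, forall z, ul (io z) = rev (ul z)})
  (ul_disj : {in Z &, forall z z', z != z' -> z != io z' -> ~~ has (mem (ul z)) (ul z')})
  (ul_cover : forall v, exists2 z, z \in Z & v \in ul z).

Lemma flatten_path z s : {subset z :: s <= Z} -> path (jn h) z s ->
  exists q, [/\ flatten (map ul (z :: s)) = z :: q, path h z q & last z q = io (last z s)].
Proof.
elim: s z => [|y s IH] z sZ /=.
  move=> _; rewrite cats0; have zZ : z \in Z by apply: sZ; rewrite mem_head.
  have [] := ul_head zZ; move: (ul_last zZ) (ul_sorted zZ).
  by case: (ul z) => //= a q E p Ea _; rewrite Ea in E p *; exists q.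
case/andP=> hzy p; have zZ : z \in Z by apply: sZ; rewrite inE eqxx.
case: (IH y) => // [x xs|q [E pq lq]]; first by apply: sZ; rewrite inE xs orbT.
have [] := ul_head zZ; move: (ul_last zZ) (ul_sorted zZ).
case: (ul z) => //= a q' El p' Ea _; rewrite {a}Ea in El p' *.
exists (q' ++ y :: q); split; first by rewrite -E.
  by rewrite cat_path p' El /= pq andbT.
by rewrite last_cat.
Qed.

Lemma ham_expand : ham h -> exists q, [/\ uniq q, cycle h q & forall v, v \in q].
Proof.
case=> s [/okpP[us fs Zs] cy cov]; exists (flatten (map ul s)); split.
- elim: s us fs Zs {cy cov} => //= z s IH /andP[zs us] fs Zs.
  have zZ : z \in Z by apply: Zs; rewrite inE eqxx.
  rewrite cat_uniq ul_uniq // IH //; last 2 first.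
  + by move=> x xs ixs; apply: fs; rewrite inE ?xs ?ixs orbT.
  + by move=> x xs; apply: Zs; rewrite inE xs orbT.
  rewrite andbT; apply/hasPn => v /flattenP[_ /mapP[y ys ->] vy] /=.
  have yZ : y \in Z by apply: Zs; rewrite inE ys orbT.
  have zy : z != y by apply: contraNneq zs => ->.
  have ziy : z != io y.
    apply/eqP => E; move/eqP: zy; apply; rewrite E; apply: fs; rewrite inE ?ys ?orbT //.
    by rewrite -E eqxx.
  by have /hasPn/(_ v vy) := ul_disj zZ yZ zy ziy.
- case: s us fs Zs cy {cov} => // z s us fs Zs; rewrite [cycle _ _]/= rcons_path => /andP[p l].
  have [q [-> pq lq]] := flatten_path Zs p.
  by rewrite /= rcons_path pq lq.
- move=> v; have [z zZ vz] := ul_cover v; apply/flattenP.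
  case/orP: (cov z zZ) => zs; first by exists (ul z) => //; apply: map_f.
  by exists (ul (io z)); [apply: map_f|rewrite ul_rev // mem_rev].
Qed.
End Expand.
End SuperPath.

(** * Hall's theorem with demands *)

Section Hall.
Variables (I C : finType).
Implicit Types (L : I -> {set C}) (A S : {set I}).

Definition nbs L S := \bigcup_(i in S) L i.
Definition hallc L A := [forall S : {set I}, (S \subset A) ==> (#|S| <= #|nbs L S|)].

Lemma hallP L A : reflect (forall S : {set I}, S \subset A -> #|S| <= #|nbs L S|) (hallc L A).
Proof. by apply: (iffP forallP) => H S; [apply/implyP|apply/implyP/H]. Qed.

Definition remc L i0 x := fun i => if i == i0 then L i :\ x else L i.

(* Rado's argument: if deleting [x] and deleting [y] from the list of [i0] both violate the condition,
   submodularity applied to the two violating sets contradicts it for their union and intersection. *)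
Lemma hall_rem L A i0 x y : x != y -> hallc L A ->
  hallc (remc L i0 x) A || hallc (remc L i0 y) A.
Proof.
move=> xy /hallP H; apply/negPn/negP; rewrite negb_or => /andP[].
case/forallPn => S; rewrite negb_imply -ltnNge => /andP[SA Slt].
case/forallPn => T; rewrite negb_imply -ltnNge => /andP[TA Tlt].
set P := nbs _ S in Slt; set Q := nbs _ T in Tlt.
have iS : i0 \in S.
  apply: contraTT Slt => iS; rewrite -leqNgt; apply: leq_trans (H S SA) _.
  apply: subset_leq_card; apply/bigcupsP => i iS'; rewrite /P /nbs.
  by rewrite (bigcup_max i) // /remc; case: eqP iS => // <-; rewrite iS'.
have iT : i0 \in T.
  apply: contraTT Tlt => iT; rewrite -leqNgt; apply: leq_trans (H T TA) _.
  apply: subset_leq_card; apply/bigcupsP => i iT'; rewrite /Q /nbs.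
  by rewrite (bigcup_max i) // /remc; case: eqP iT => // <-; rewrite iT'.
have subP i c : i \in S -> c \in remc L i0 x i -> c \in P by move=> h1 h2; apply/bigcupP; exists i.
have subQ i c : i \in T -> c \in remc L i0 y i -> c \in Q by move=> h1 h2; apply/bigcupP; exists i.
have h1 : #|S :|: T| <= #|P :|: Q|.
  apply: leq_trans (H _ _) _; first by rewrite subUset SA.
  apply: subset_leq_card; apply/bigcupsP => i; rewrite inE => iST; apply/subsetP => c cL; rewrite inE.
  have [ii0|ni] := eqVneq i i0.
    have [cx|ncx] := eqVneq c x.
      by apply/orP; right; apply: (subQ i0) => //; rewrite /remc eqxx !inE cx xy -cx -ii0.
    by apply/orP; left; apply: (subP i0) => //; rewrite /remc eqxx !inE ncx -ii0.
  by case/orP: iST => iST; apply/orP; [left; apply: (subP i)|right; apply: (subQ i)] => //; rewrite /remc (negPf ni).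
have h2 : #|(S :&: T) :\ i0| <= #|P :&: Q|.
  apply: leq_trans (H _ _) _.
    by apply: subset_trans (subD1set _ _) _; apply: subset_trans (subsetIl _ _) SA.
  apply: subset_leq_card; apply/bigcupsP => i; rewrite !inE => /and3P[ni iS' iT']; apply/subsetP => c cL.
  by rewrite inE (subP i) ?(subQ i) // /remc (negPf ni).
have := cardsUI S T; have := cardsUI P Q; have := cardsD1 i0 (S :&: T); rewrite inE iS iT /=.
lia.
Qed.

(** Elements are deleted from lists with more than one element, which keeps Hall's condition for one
    of any two elements by [hall_rem]. Once all lists are singletons, the condition for pairs says
    that they differ. *)
Lemma hall_sdr L A : hallc L A ->
  exists phi : I -> option C, {in A, forall i, exists2 c, c \in L i & phi i = Some c} /\
    {in A &, injective phi}.
Proof.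
have [N] := ubnP (\sum_(i in A) #|L i|); elim: N L => // N IH L leN HL.
have [/existsP[i0 /andP[iA /card_gt1P[x [y [xL yL xy]]]]]|] := boolP [exists i in A, 1 < #|L i|].
  have lt z : z \in L i0 -> \sum_(i in A) #|remc L i0 z i| < \sum_(i in A) #|L i|.
    move=> zL; rewrite (bigD1 i0) //= [ltnRHS](bigD1 i0) //= /remc eqxx.
    rewrite (cardsD1 z (L i0)) zL add1n addSn ltnS leq_add2l.
    by rewrite leq_eqVlt; apply/orP; left; apply/eqP; apply: eq_bigr => i /andP[_ /negPf ->].
  have sub z i : remc L i0 z i \subset L i.
    by rewrite /remc; case: ifP => // _; exact: subD1set.
  have fin z : z \in L i0 -> hallc (remc L i0 z) A -> exists phi : I -> option C,
    {in A, forall i, exists2 c, c \in L i & phi i = Some c} /\ {in A &, injective phi}.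
    move=> zL Hz; case: (IH _ _ Hz); first exact: leq_trans (lt z zL) _.
    move=> phi [h1 h2]; exists phi; split => // i /h1[c cL ->]; exists c => //.
    exact: (subsetP (sub z i)).
  by case/orP: (hall_rem i0 xy HL); exact: fin.
rewrite negb_exists => /forallP one.
have L_ge1 i : i \in A -> exists c, L i = [set c].
  move=> iA; apply/cards1P; rewrite eqn_leq; have := one i; rewrite iA -leqNgt /= => ->.
  by move/hallP: HL => /(_ [set i]); rewrite sub1set iA cards1 /nbs big_set1 => ->.
exists (fun i => [pick c in L i]); split.
  by move=> i iA; case: (L_ge1 i iA) => c ->; exists c; rewrite ?inE //; case: pickP => [d|/(_ c)]; rewrite inE ?eqxx // => /eqP->.
move=> i j iA jA; case: (L_ge1 i iA) (L_ge1 j jA) => c Ec [d Ed] E.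
apply/eqP/negPn/negP => ij; move/hallP: HL => /(_ [set i; j]).
rewrite subUset !sub1set iA jA cards2 ij /nbs bigcup_setU !big_set1 => /(_ isT).
suff -> : L j = L i by rewrite setUid Ec cards1.
move: E; rewrite Ec Ed.
case: pickP => [c'|/(_ c)]; rewrite inE ?eqxx // => /eqP ->.
by case: pickP => [d'|/(_ d)]; rewrite inE ?eqxx // => /eqP -> [->].
Qed.

End Hall.

(** Each vertex is replaced by [d v] copies with the same list, encoded as pairs [(v, i)] with
    [i < d v] in one common finite type. *)
Lemma hall_demand (V C : finType) (A : {set V}) (L : V -> {set C}) (d : V -> nat) :
  (forall S : {set V}, S \subset A -> \sum_(v in S) d v <= #|\bigcup_(v in S) L v|) ->
  exists M : V -> {set C}, [/\ {in A, forall v, M v \subset L v}, {in A, forall v, #|M v| = d v}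
    & {in A &, forall v w, v != w -> [disjoint M v & M w]}].
Proof.
move=> H; pose m := \max_v d v.
have dm v : d v <= m by exact: leq_bigmax.
pose A' := [set i : V * 'I_m | (i.1 \in A) && (i.2 < d i.1)].
pose L' (i : V * 'I_m) := L i.1.
have H' : hallc L' A'.
  apply/hallP => S /subsetP SA; pose S1 := fst @: S.
  have S1A : S1 \subset A.
    by apply/subsetP => v /imsetP[i /SA]; rewrite inE => /andP[iA _] ->.
  apply: leq_trans (leq_trans (H S1 S1A) _).
    rewrite -sum1_card (partition_big fst (mem S1)) /=; last by move=> i iS; apply: imset_f.
    apply: leq_sum => v vS1; rewrite sum1dep_card.
    apply: (@leq_trans #|[set (v, i) | i in [set i : 'I_m | i < d v]]|).
      apply: subset_leq_card; apply/subsetP => -[w i]; rewrite inE /= => /andP[wS /eqP wv].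
      apply/imsetP; exists i; last by rewrite wv.
      by have := SA _ wS; rewrite !inE /= wv => /andP[].
    rewrite card_imset; last by move=> i j [].
    have -> : [set i : 'I_m | i < d v] = [set widen_ord (dm v) j | j in [set: 'I_(d v)]].
      apply/setP => i; rewrite inE; apply/idP/imsetP => [lt|[j _ ->]]; last by case: j.
      by exists (Ordinal lt) => //; exact: val_inj.
    by apply: leq_trans (leq_imset_card _ _) _; rewrite cardsT card_ord.
  apply: subset_leq_card; apply/bigcupsP => v /imsetP[i iS ->].
  exact: (bigcup_sup i).
case: (hall_sdr H') => phi [phiL phiI].
exists (fun v => [set c | [exists i : 'I_m, (i < d v) && (phi (v, i) == Some c)]]); split.
- move=> v vA; apply/subsetP => c; rewrite inE => /existsP[i /andP[lt /eqP E]].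
  have iA : (v, i) \in A' by rewrite inE vA.
  by case: (phiL _ iA) => c' cL; rewrite E => -[->].
- move=> v vA; case: (posnP (d v)) => d0.
    by rewrite d0; apply/eqP; rewrite cards_eq0; apply/eqP/setP => c; rewrite !inE; apply/existsP => -[i] /andP[]; rewrite ltn0.
  have iA (j : 'I_(d v)) : (v, widen_ord (dm v) j) \in A' by rewrite inE vA /= ltn_ord.
  have [c0 _ _] := phiL _ (iA (Ordinal d0)).
  pose g (j : 'I_(d v)) := odflt c0 (phi (v, widen_ord (dm v) j)).
  have gE j : phi (v, widen_ord (dm v) j) = Some (g j).
    by rewrite /g; case: (phiL _ (iA j)) => c _ ->.
  have gI : injective g.
    move=> j j' E; have := phiI _ _ (iA j) (iA j'); rewrite !gE E => /(_ erefl) [].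
    by move=> E'; exact: val_inj.
  rewrite -[RHS]card_ord -(card_imset _ gI); apply: eq_card => c; rewrite inE.
  apply/existsP/imsetP => [[i /andP[lt /eqP E]]|[j _ ->]].
    exists (Ordinal lt) => //; have := gE (Ordinal lt).
    by rewrite (_ : widen_ord _ _ = i) ?E => [[]|]; last exact: val_inj.
  by exists (widen_ord (dm v) j); rewrite gE eqxx /= ltn_ord.
- move=> v w vA wA vw; rewrite -setI_eq0; apply/eqP/setP => c; rewrite !inE; apply/negP.
  case/andP => /existsP[i /andP[li /eqP Ei]] /existsP[j /andP[lj /eqP Ej]].
  have := phiI (v, i) (w, j); rewrite !inE vA wA li lj Ei Ej => /(_ isT isT erefl) [E _].
  by rewrite E eqxx in vw.
Qed.

(** * Edges, stars and degrees *)

Section Edges.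
Variables (n c : nat).
Implicit Types (f : outcome n c) (e : edge n) (u v : 'I_n).

Definition eset e : {set 'I_n} := [set (val e).1; (val e).2].

Lemma edge_lt e : (val e).1 < (val e).2. Proof. exact: (valP e). Qed.

Lemma eset_ex u v : u != v -> exists e, eset e = [set u; v].
Proof.
rewrite neq_ltn => /orP[lt|lt].
  by exists (exist (fun x => edge_pred x) (u, v) lt).
by exists (exist (fun x => edge_pred x) (v, u) lt); rewrite /eset /= setUC.
Qed.

Lemma eset_pairE e u v : eset e = [set u; v] -> val e = (u, v) \/ val e = (v, u).
Proof.
rewrite /eset; have := edge_lt e; case: (val e) => a b /= ab E.
have ha : a \in [set u; v] by rewrite -E !inE eqxx.
have hb : b \in [set u; v] by rewrite -E !inE eqxx orbT.
move: ha hb ab; rewrite !inE => /orP[]/eqP-> /orP[]/eqP->; rewrite ?ltnn //; by [left|right].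
Qed.

Lemma eset_neq e u v : eset e = [set u; v] -> u != v.
Proof. by move=> /eset_pairE[] E; have := edge_lt e; rewrite E /= neq_ltn => ->; rewrite ?orbT. Qed.

Lemma eset_inj : injective eset.
Proof.
move=> e e'; rewrite {2}/eset => /eset_pairE[] E; apply: val_inj; rewrite E; first by case: (val e').
by have := edge_lt e; have := edge_lt e'; rewrite E /= => h /(ltn_trans h); rewrite ltnn.
Qed.

Lemma ecol_edge f e u v : eset e = [set u; v] -> ecol f u v = f e.
Proof.
rewrite /ecol => /eset_pairE[] E.
  by case: insubP => [e' _ E'|]; [congr (f _); apply: val_inj; rewrite E E'|have := valP e; rewrite /= E => ->].
have lt : v < u by have := edge_lt e; rewrite E.
case: insubP => [e' h _|_]; first by move: h; rewrite /edge_pred /= ltnNge ltnW.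
by case: insubP => [e' _ E'|]; [congr (f _); apply: val_inj; rewrite E E'|have := valP e; rewrite /= E => ->].
Qed.

Lemma ecol_diag f u : ecol f u u = None.
Proof. by rewrite /ecol; case: insubP => [e' h _|//]; move: h; rewrite /edge_pred /= ltnn. Qed.

Lemma ecolC f u v : ecol f u v = ecol f v u.
Proof.
have [->//|/eset_ex[e E]] := eqVneq u v.
by rewrite (ecol_edge f E) (@ecol_edge f e v u) // E setUC.
Qed.

Lemma ecol_ex f u v : ecol f u v != None -> exists e, eset e = [set u; v].
Proof. by have [->|/eset_ex//] := eqVneq u v; rewrite ecol_diag. Qed.

Definition star v (Y : {set 'I_n}) := [set e | [exists y in Y, eset e == [set v; y]]].

Lemma starP v (Y : {set 'I_n}) e : reflect (exists2 y, y \in Y & eset e = [set v; y]) (e \in star v Y).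
Proof. by rewrite inE; apply: (iffP existsP) => [[y /andP[yY /eqP E]]|[y yY E]]; exists y => //; rewrite yY E /=. Qed.

Definition other v e := if (val e).1 == v then (val e).2 else (val e).1.

Lemma otherE v y e : eset e = [set v; y] -> other v e = y.
Proof.
move=> E; have ny := eset_neq E; rewrite /other; case: (eset_pairE E) => -> /=; rewrite ?eqxx //.
by rewrite eq_sym (negPf ny).
Qed.

Lemma deg_cnt f (K : {set 'I_c}) v (Y : {set 'I_n}) :
  #|[set y in Y | coloured_in K (ecol f v y)]| = cnt K (star v Y) f.
Proof.
rewrite /cnt -(card_in_imset (f := other v)); last first.
  move=> e e' /setIdP[/starP[y _ E] _] /setIdP[/starP[y' _ E'] _].
  by rewrite (otherE E) (otherE E') => yy; apply: eset_inj; rewrite E E' yy.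
apply: eq_card => y; apply/idP/imsetP => [|[e]].
  case/setIdP => yY; case ec: (ecol f v y) => [k|] //= kK.
  have [|e E] := @ecol_ex f v y; first by rewrite ec.
  exists e; last by rewrite (otherE E).
  by apply/setIdP; rewrite -(ecol_edge f E) ec /=; split => //; apply/starP; exists y.
case/setIdP => /starP[y' yY E] fe ->; rewrite (otherE E) inE yY.
by rewrite (ecol_edge f E).
Qed.

Lemma card_star_le v (Y : {set 'I_n}) : #|star v Y| <= #|Y|.
Proof.
rewrite -(card_in_imset (f := other v)); last first.
  move=> e e' /starP[y _ E] /starP[y' _ E'].
  by rewrite (otherE E) (otherE E') => yy; apply: eset_inj; rewrite E E' yy.
by apply: subset_leq_card; apply/subsetP => y /imsetP[e /starP[y' yY E] ->]; rewrite (otherE E).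
Qed.

Lemma card_star v (Y : {set 'I_n}) : v \notin Y -> #|star v Y| = #|Y|.
Proof.
move=> vY; apply/eqP; rewrite eqn_leq card_star_le /=.
apply: leq_trans (leq_imset_card (other v) _); apply: subset_leq_card; apply/subsetP => y yY.
have [e E] : exists e, eset e = [set v; y] by apply: eset_ex; apply: contraNneq vY => ->.
by apply/imsetP; exists e; [apply/starP; exists y|rewrite (otherE E)].
Qed.

Definition inside (U : {set 'I_n}) := [set e | eset e \subset U].

Lemma card_inside (U : {set 'I_n}) : #|inside U| <= #|U| ^ 2.
Proof.
rewrite -mulnn -cardsX -(card_imset _ val_inj); apply: subset_leq_card; apply/subsetP => -[a b] /imsetP[e].
by rewrite inE /eset subUset !sub1set => /andP[h1 h2] E; rewrite in_setX; move: h1 h2; rewrite -E /= => -> ->.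
Qed.

Lemma card_edge : #|{: edge n}| <= n ^ 2.
Proof.
apply: leq_trans (_ : #|inside setT| <= _); first by apply: subset_leq_card; apply/subsetP => e _; rewrite inE subsetT.
by apply: leq_trans (card_inside _) _; rewrite cardsT card_ord.
Qed.

Definition between (S Y : {set 'I_n}) := \bigcup_(v in S) star v Y.

Lemma betweenP (S Y : {set 'I_n}) e :
  reflect (exists v y, [/\ v \in S, y \in Y & eset e = [set v; y]]) (e \in between S Y).
Proof.
apply: (iffP bigcupP) => [[v vS /starP[y yY E]]|[v [y [vS yY E]]]]; first by exists v, y.
by exists v => //; apply/starP; exists y.
Qed.

Lemma card_between (S Y : {set 'I_n}) : #|between S Y| <= #|S| * #|Y|.
Proof.
rewrite /between -sum_nat_const; elim/big_rec2: _ => [|v m X vS le]; first by rewrite cards0.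
by apply: leq_trans (leq_card_setU _ _) _; apply: leq_add => //; exact: card_star_le.
Qed.

Lemma card_between_disj (S Y : {set 'I_n}) : [disjoint S & Y] -> #|S| * #|Y| <= #|between S Y|.
Proof.
move=> d; rewrite -cardsX; pose g e := if (val e).1 \in S then val e else ((val e).2, (val e).1).
apply: leq_trans (leq_imset_card g _); apply: subset_leq_card; apply/subsetP => -[v y].
rewrite inE /= => /andP[vS yY]; have yS : y \notin S by rewrite (disjointFl d yY).
have [e E] : exists e, eset e = [set v; y] by apply: eset_ex; apply: contraNneq yS => <-.
apply/imsetP; exists e; first by apply/betweenP; exists v, y.
by rewrite /g; case: (eset_pairE E) => -> /=; rewrite ?vS ?(negPf yS).
Qed.

End Edges.

(** * Merging vertices into few rainbow paths *)

Section Merge.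
Variables (n c : nat) (f : outcome n c).
Implicit Types (s P Q : seq 'I_n) (U : seq (seq 'I_n)).

Definition pcols s := if s is x :: l then pairmap (ecol f) x l else [::].

Lemma size_pcols s : size (pcols s) <= size s.
Proof. by case: s => //= x l; rewrite size_pairmap. Qed.

Lemma pcols_cat x P y Q : pcols ((x :: P) ++ y :: Q) = pcols (x :: P) ++ ecol f (last x P) y :: pcols (y :: Q).
Proof. by rewrite /= pairmap_cat. Qed.

Lemma size_flatten_pcols U : size (flatten (map pcols U)) <= size (flatten U).
Proof. by elim: U => //= s U IH; rewrite !size_cat leq_add // size_pcols. Qed.

Definition joined (X : {set 'I_n}) (K : {set 'I_c}) U :=
  [/\ perm_eq (flatten U) (enum X), all (fun s => s != [::]) U,
      uniq (flatten (map pcols U)) & all (coloured_in K) (flatten (map pcols U))].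

Lemma joined_perm X K U U' : perm_eq U U' -> joined X K U -> joined X K U'.
Proof.
move=> pU [h1 h2 h3 h4].
have pC : perm_eq (flatten (map pcols U)) (flatten (map pcols U')).
  exact: perm_flatten (perm_map _ pU).
split; last 3 first.
- by rewrite -(perm_all _ pU).
- by rewrite -(perm_uniq pC).
- by rewrite -(perm_all _ pC).
by rewrite -(permPl (perm_flatten pU)).
Qed.

(** Greedy merging, starting from single vertices. While more than [2 * m] paths remain, take the
    last vertices of [m] of them and the first vertices of the others. At most [n] colours are in
    use, so [q] colours of [K] are left, and an edge in one of them joins two paths. *)
Lemma merge_paths (X : {set 'I_n}) (K : {set 'I_c}) (m q : nat) :
  n + q <= #|K| ->
  (forall (A1 A2 : {set 'I_n}) (K' : {set 'I_c}), m <= #|A1| -> m <= #|A2| -> [disjoint A1 & A2] ->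
     K' \subset K -> q <= #|K'| -> exists a b, [/\ a \in A1, b \in A2 & coloured_in K' (ecol f a b)]) ->
  exists2 U, joined X K U & size U <= 2 * m.
Proof.
move=> Kq link.
have J0 : joined X K [seq [:: x] | x <- enum X].
  have E : flatten [seq [:: x] | x <- enum X] = enum X by elim: (enum X) => //= x s ->.
  have E2 : flatten (map pcols [seq [:: x] | x <- enum X]) = [::] by elim: (enum X).
  by split; rewrite ?E ?E2 //; apply/allP => s /mapP[x _ ->].
move: J0; set U := map _ _; have [N] := ubnP (size U).
elim: N U => // N IH U ltN J; case: (leqP (size U) (2 * m)) => [le|gt]; first by exists U.
case: (J) => pf ne uc ic.
have uf : uniq (flatten U) by rewrite (perm_uniq pf) enum_uniq.
pose hd s := ohead s; pose ls s := ohead (rev s).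
pose U1 := take m U; pose U2 := drop m U.
have EU : U1 ++ U2 = U by exact: cat_take_drop.
pose A1 := [set x | Some x \in map ls U1]; pose A2 := [set x | Some x \in map hd U2].
have ufc : uniq (flatten U1 ++ flatten U2) by rewrite -flatten_cat EU.
have cardA (g : seq 'I_n -> option 'I_n) U' : (forall s x, g s = Some x -> x \in s) ->
   all (fun s => g s != None) U' -> uniq (flatten U') -> size U' <= #|[set x | Some x \in map g U']|.
  move=> gs; elim: U' => //= s U' IH' /andP[gsn /IH' {}IH']; rewrite cat_uniq => /and3P[us /hasPn d u'].
  case E: (g s) gsn => [x|] // _.
  have xn : x \notin [set x | Some x \in map g U'].
    rewrite inE; apply/negP => /mapP[s' s'U] E'.
    have /d : x \in flatten U' by apply/flattenP; exists s' => //; exact: gs (esym E').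
    by rewrite /= (gs _ _ E).
  apply: leq_ltn_trans (IH' u') _; apply: proper_card; apply/properP; split.
    by apply/subsetP => y; rewrite !inE => ->; rewrite orbT.
  by exists x => //; rewrite inE mem_head.
have lsP s x : ls s = Some x -> x \in s.
  by rewrite /ls -mem_rev; case: (rev s) => //= a l [->]; rewrite mem_head.
have hdP s x : hd s = Some x -> x \in s by rewrite /hd; case: s => //= a l [->]; rewrite mem_head.
have lsn s : s != [::] -> ls s != None.
  by rewrite /ls; case/lastP: s => // s x _; rewrite rev_rcons.
have hdn s : s != [::] -> hd s != None by case: s.
have [ne1 ne2] : all (fun s => s != [::]) U1 /\ all (fun s => s != [::]) U2.
  by apply/andP; rewrite -all_cat EU.
have u12 := ufc; rewrite cat_uniq in u12; case/and3P: u12 => u1 /hasPn d12 u2.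
have c1 : m <= #|A1|.
  apply: leq_trans (cardA ls U1 lsP _ u1); last by apply: sub_all ne1 => s; exact: lsn.
  rewrite size_take; case: ltnP => // _; apply: leq_trans (ltnW gt); by rewrite mul2n -addnn leq_addr.
have c2 : m <= #|A2|.
  apply: leq_trans (cardA hd U2 hdP _ u2); last by apply: sub_all ne2 => s; exact: hdn.
  by rewrite size_drop; move: (gt); clear; set u := size U; lia.
have dA : [disjoint A1 & A2].
  rewrite -setI_eq0; apply/eqP/setP => x; rewrite !inE; apply/negP => /andP[/mapP[P PU EP] /mapP[Q QU EQ]].
  have /d12 : x \in flatten U2 by apply/flattenP; exists Q => //; exact: hdP.
  by case/negP; apply/flattenP; exists P => //; exact: lsP.
pose used := [set k | Some k \in flatten (map pcols U)].
have cu : #|used| <= n.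
  apply: (@leq_trans (size (flatten (map pcols U)))).
    rewrite cardE -(size_map Some); apply: uniq_leq_size; first by rewrite map_inj_uniq ?enum_uniq // => ? ? [].
    by move=> o /mapP[k]; rewrite mem_enum inE => h ->.
  apply: leq_trans (size_flatten_pcols U) _; rewrite (perm_size pf) -cardE.
  by rewrite -[leqRHS]card_ord max_card.
case: (link A1 A2 (K :\: used) c1 c2 dA (subsetDl _ _)) => [|a [b [aA bA ab]]].
  rewrite cardsD; apply: (@leq_trans (#|K| - n)); first lia.
  by apply: leq_sub2l; apply: leq_trans (subset_leq_card (subsetIr _ _)) cu.
move: aA bA; rewrite !inE => /mapP[P PU EP] /mapP[Q QU EQ].
have [P' EP'] : exists P', P = rcons P' a.
  by move: EP; rewrite /ls; case/lastP: (P) => // P' x; rewrite rev_rcons /= => -[->]; exists P'.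
have [Q' EQ'] : exists Q', Q = b :: Q' by move: EQ; rewrite /hd; case: (Q) => // y Q' /= [->]; exists Q'.
have pU : perm_eq U (P :: Q :: rem P U1 ++ rem Q U2).
  rewrite -EU; apply: (@perm_trans _ ((P :: rem P U1) ++ (Q :: rem Q U2))).
    by apply: perm_cat; exact: perm_to_rem.
  by rewrite cat_cons perm_cons -cat1s perm_catCA cat1s.
have {J} := joined_perm pU J; set U3 := rem P U1 ++ _ in pU *; case=> h1 h2 h3 h4.
apply: (IH ((P ++ Q) :: U3)).
  by move: ltN; rewrite (perm_size pU) /= ltnS.
have EC : pcols (P ++ Q) = pcols P ++ ecol f a b :: pcols Q.
  by rewrite EP' EQ'; case: P' {EP'} => [|x P'] //; rewrite rcons_cons pcols_cat last_rcons.
have pc : perm_eq (flatten (map pcols ((P ++ Q) :: U3))) (ecol f a b :: flatten (map pcols (P :: Q :: U3))).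
  by rewrite /= EC -catA -[ecol f a b :: pcols Q]cat1s -catA perm_catCA.
have nab : ecol f a b \notin flatten (map pcols (P :: Q :: U3)).
  move: ab; case E: (ecol f a b) => [k|] //=; rewrite !inE => /andP[nk _].
  by apply: contra nk; rewrite (perm_mem (perm_flatten (perm_map pcols pU))).
split.
- by rewrite /= -catA.
- by move: h2 => /= /and3P[h _ ->]; rewrite andbT EP'; case: (P').
- by rewrite (perm_uniq pc) cons_uniq nab h3.
- rewrite (perm_all _ pc) /= -/(map pcols (P :: Q :: U3)).
  apply/andP; split; last exact: h4.
  by move: ab; case: (ecol f a b) => [k|] //=; rewrite inE => /andP[].
Qed.

End Merge.

(** * Units and their ports *)

Section Units.
Variables (T : finType) (h : rel T) (UU : seq (seq T)).
Hypotheses (hs : symmetric h) (uU : uniq (flatten UU)) (neU : {in UU, forall u, u != [::]})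
  (covU : forall v, v \in flatten UU) (soU : {in UU, forall u, sorted h u}).

Definition unit_of v := nth [::] UU (find (fun u => v \in u) UU).
Definition port_set := [set z | (z == head z (unit_of z)) || (z == last z (unit_of z))].
(** Inner vertices of units are left fixed, because the rotation argument needs an involution of the
    whole vertex type. *)
Definition port_swap z := let u := unit_of z in
  if z == head z u then last z u else if z == last z u then head z u else z.
Definition port_path z := let u := unit_of z in if z == head z u then u else rev u.

Lemma unit_ofP v : unit_of v \in UU /\ v \in unit_of v.
Proof.
have H : has (fun u => v \in u) UU.
  by have /flattenP[u uU' vu] := covU v; apply/hasP; exists u.
by split; [apply: mem_nth; rewrite -has_find|exact: (nth_find [::] H)].
Qed.

Lemma unit_ofE u v : u \in UU -> v \in u -> unit_of v = u.
Proof.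
move=> uUU vu; have [u'U vu'] := unit_ofP v; move: (unit_of v) u'U vu' => u' u'U vu'.
elim: UU uU uUU u'U => //= w s IH; rewrite cat_uniq => /and3P[_ /hasPn d us]; rewrite !inE.
case/orP => [/eqP uw|us'] /orP[/eqP u'w|u's']; first by rewrite uw.
- have /d : v \in flatten s by apply/flattenP; exists u'.
  by rewrite /= -uw vu.
- have /d : v \in flatten s by apply/flattenP; exists u.
  by rewrite /= -u'w vu'.
- exact: IH.
Qed.

Lemma unit_uniq u : u \in UU -> uniq u.
Proof.
move: uU; elim: UU => //= w s IH; rewrite cat_uniq inE => /and3P[uw _ us] /orP[/eqP->//|]; exact: IH.
Qed.

Lemma unit_cons v : exists x l, [/\ unit_of v = x :: l, x :: l \in UU & v \in x :: l].
Proof.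
have [uUU vu] := unit_ofP v; have := neU uUU.
by case: (unit_of v) uUU vu => // x l h1 h2 _; exists x, l.
Qed.

Lemma headlast (x : T) (l : seq T) : uniq (x :: l) -> (last x l == x) = (l == [::]).
Proof.
case/lastP: l => [|l y]; first by rewrite eqxx.
by rewrite last_rcons /= mem_rcons inE negb_or => /andP[/andP[/negPf xy _] _]; rewrite eq_sym xy; case: l.
Qed.

Lemma port_swapP v : v \in port_set -> exists x l, [/\ unit_of v = x :: l, x :: l \in UU &
  (v = x /\ port_swap v = last x l) \/ (v = last x l /\ port_swap v = x)].
Proof.
have [x [l [E uUU vu]]] := unit_cons v; rewrite inE E /= => /orP[/eqP vx|/eqP vl]; exists x, l; split => //.
  by left; rewrite /port_swap E /= vx eqxx.
right; rewrite /port_swap E /= -vl eqxx; split => //; case: eqP => // vx.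
Qed.

Lemma port_swapK : involutive port_swap.
Proof.
move=> v; case vZ: (v \in port_set); last first.
  suff E : port_swap v = v by rewrite !E.
  by move: vZ; rewrite inE /port_swap => /norP[/negPf -> /negPf ->].
have [x [l [E uUU [[-> ->]|[-> ->]]]]] := port_swapP vZ.
  have := headlast (unit_uniq uUU); rewrite /port_swap (unit_ofE uUU (mem_last _ _)) /= eqxx.
  by case: eqP => [->|].
by rewrite /port_swap (unit_ofE uUU (mem_head _ _)) /= eqxx.
Qed.

Lemma port_swap_unit v : v \in port_set -> unit_of (port_swap v) = unit_of v.
Proof.
by move=> vZ; have [x [l [E uUU [[_ ->]|[_ ->]]]]] := port_swapP vZ; rewrite E; apply: unit_ofE => //;
  rewrite ?mem_last ?mem_head.
Qed.

Lemma port_swap_set v : (port_swap v \in port_set) = (v \in port_set).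
Proof.
have H w : w \in port_set -> port_swap w \in port_set.
  move=> wZ; have [x [l [E uUU [[_ Es]|[_ Es]]]]] := port_swapP wZ; rewrite inE port_swap_unit // E Es /= eqxx ?orbT //.
by apply/idP/idP; [rewrite -{2}[v]port_swapK; exact: H|exact: H].
Qed.

Lemma port_free y : [:: y] \in UU -> y \in port_set /\ port_swap y = y.
Proof. by move=> yU; rewrite inE /port_swap (unit_ofE yU (mem_head _ _)) /= eqxx. Qed.

Lemma port_setP z : z \in port_set -> exists2 u, u \in UU & (u != [::]) && ((z == head z u) || (z == last z u)).
Proof.
have [x [l [E uUU _]]] := unit_cons z.
by rewrite inE E => H; exists (x :: l).
Qed.

Lemma port_path_head : {in port_set, forall z, head z (port_path z) = z /\ port_path z != [::]}.
Proof.
move=> z /[dup] zZ; rewrite inE /port_path; have [x [l [-> _ _]]] := unit_cons z; rewrite /=.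
case: eqP => [-> //|_] /= /eqP zl; split; last by rewrite -size_eq0 size_rev.
by rewrite lastI rev_rcons /= -zl.
Qed.

Lemma port_path_last : {in port_set, forall z, last z (port_path z) = port_swap z}.
Proof.
move=> z; rewrite inE /port_path /port_swap; have [x [l [-> _ _]]] := unit_cons z; rewrite /=.
case: eqP => [-> //|_] /= /eqP zl; rewrite -zl eqxx.
by rewrite rev_cons last_rcons.
Qed.

Lemma port_path_sorted : {in port_set, forall z, sorted h (port_path z)}.
Proof.
move=> z _; have [uUU _] := unit_ofP z; rewrite /port_path; case: ifP => _; first exact: soU.
rewrite rev_sorted (eq_sorted (e' := h)) //; exact: soU.
Qed.

Lemma port_path_uniq : {in port_set, forall z, uniq (port_path z)}.
Proof.
by move=> z _; have [uUU _] := unit_ofP z; rewrite /port_path; case: ifP => _; rewrite ?rev_uniq; exact: unit_uniq.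
Qed.

Lemma port_path_rev : {in port_set, forall z, port_path (port_swap z) = rev (port_path z)}.
Proof.
move=> z zZ; rewrite /port_path port_swap_unit //.
have [x [l [E uUU H]]] := port_swapP zZ; rewrite E /=.
have := headlast (unit_uniq uUU).
case: H => -[-> ->]; rewrite ?eqxx; case: (last x l =P x) => [_ /esym/eqP -> //|_ _]; by rewrite ?revK.
Qed.

Lemma mem_port_path z v : (v \in port_path z) = (v \in unit_of z).
Proof. by rewrite /port_path; case: ifP => _ //; rewrite mem_rev. Qed.

Lemma port_path_disj : {in port_set &, forall z z', z != z' -> z != port_swap z' ->
  ~~ has (mem (port_path z)) (port_path z')}.
Proof.
move=> z z' zZ z'Z n1 n2; apply/hasPn => v; rewrite mem_port_path /= => vz'; apply/negP; rewrite mem_port_path => vz.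
have [uUU _] := unit_ofP z; have [u'UU _] := unit_ofP z'.
have Eu : unit_of z = unit_of z' by rewrite -(unit_ofE uUU vz) -(unit_ofE u'UU vz').
have [x [l [E _ H]]] := port_swapP zZ; have [x' [l' [E' _ H']]] := port_swapP z'Z.
have [Ex El] : x = x' /\ l = l' by move: Eu; rewrite E E' => -[].
subst x' l'; case/eqP: n1; case: H H' n2 => -[-> _] [[-> ->]|[-> ->]] //; by rewrite eqxx.
Qed.

Lemma port_path_cover v : exists2 z, z \in port_set & v \in port_path z.
Proof.
have [x [l [E uUU vu]]] := unit_cons v; exists x.
  by rewrite inE (unit_ofE uUU (mem_head _ _)) /= eqxx.
by rewrite mem_port_path (unit_ofE uUU (mem_head _ _)).
Qed.

End Units.

(** * The expanding rainbow structure *)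

Definition adj n c (f : outcome n c) : rel 'I_n := fun x y => ecol f x y != None.
Definition adjE n (E : {set edge n}) : rel 'I_n := fun u v => [exists e in E, eset e == [set u; v]].

Lemma adj_ecol n c (f : outcome n c) x y : adj f x y = (ecol f x y != None).
Proof. by []. Qed.

Lemma adjC n c (f : outcome n c) : symmetric (adj f).
Proof. by move=> x y; rewrite /adj ecolC. Qed.

Lemma adjEC n (E : {set edge n}) : symmetric (adjE E).
Proof. by move=> x y; apply: eq_existsb => e; rewrite finset.setUC. Qed.

Section Weak.
Variables (n c : nat) (Y0 : {set 'I_n}) (Ce : {set 'I_c}) (d0 : nat).
Definition poor_set (f : outcome n c) : {set 'I_n} := [set v | cnt Ce (star v Y0) f < d0].
(** Only these edges may be hidden: the path through a poor vertex may need any edge there, in any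
    colour. *)
Definition away_edges (f : outcome n c) : {set edge n} := [set e | [disjoint eset e & poor_set f]].
Definition small_set (th0 : nat) (f : outcome n c) : {set 'I_n} := [set v | cnt [set: 'I_c] (star v [set: 'I_n]) f < th0].
End Weak.

(* [bE] is a rainbow set of edges, [bZ] the ports of the units, [bY] the free vertices, [bio] exchanges the
   two ports of a unit and [bul z] lists the vertices of the unit of [z], starting from [z]. *)
Record base n := Base { bE : {set edge n}; bZ : {set 'I_n}; bY : {set 'I_n};
  bio : 'I_n -> 'I_n; bul : 'I_n -> seq 'I_n }.

(** For the poor set [B], [base_ZB] ensures that an edge between two ports is one that may be
    hidden, and [base_ff] that most of [Cb] is still fresh when boosters are sought. The rotations
    consume [base_exp]. *)
Record isbase n c (Cb : {set 'I_c}) (B : {set 'I_n}) (sg zz ff : nat) (g : outcome n c) (b : base n) : Prop :=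
 IsBase {
  base_ioK : involutive (bio b);
  base_ioZ : forall z, (bio b z \in bZ b) = (z \in bZ b);
  base_ioY : {in bY b, forall y, bio b y = y};
  base_YZ : bY b \subset bZ b;
  base_head : {in bZ b, forall z, head z (bul b z) = z /\ bul b z != [::]};
  base_last : {in bZ b, forall z, last z (bul b z) = bio b z};
  base_sorted : {in bZ b, forall z, sorted (adjE (bE b)) (bul b z)};
  base_uniq : {in bZ b, forall z, uniq (bul b z)};
  base_rev : {in bZ b, forall z, bul b (bio b z) = rev (bul b z)};
  base_disj : {in bZ b &, forall z z', z != z' -> z != bio b z' -> ~~ has (mem (bul b z)) (bul b z')};
  base_cover : forall v, exists2 z, z \in bZ b & v \in bul b z;
  base_pres : {in bE b, forall e, g e != None};
  base_inj : {in bE b &, injective g};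
  base_exp : expanding (bZ b) (bY b) (adjE (bE b)) sg;
  base_ZB : [disjoint bZ b & B];
  base_zz : #|bZ b| <= zz;
  base_ff : #|[set k in Cb | [exists e in bE b, g e == Some k]]| <= ff
 }.

Definition ppairs (T : Type) (s : seq T) := if s is x :: l then pairmap pair x l else [::].

Lemma pcols_ppairs n c (f : outcome n c) s : pcols f s = [seq ecol f p.1 p.2 | p <- ppairs s].
Proof. by case: s => //= x l; elim: l x => //= y l IH x; rewrite IH. Qed.

Lemma sorted_ppairs (T : Type) (r : rel T) (s : seq T) :
  sorted r s = all (fun p => r p.1 p.2) (ppairs s).
Proof. by case: s => //= x l; elim: l x => //= y l IH x; rewrite IH. Qed.

Lemma uniq_flatten_map (S T : eqType) (g : S -> seq T) (s : seq S) : uniq s ->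
  {in s, forall b, uniq (g b)} -> {in s &, forall b b', b != b' -> ~~ has (mem (g b)) (g b')} ->
  uniq (flatten (map g s)).
Proof.
elim: s => //= b s IH /andP[bs us] ug dg; rewrite cat_uniq ug ?mem_head //= IH //; last 2 first.
- by move=> b' b's; apply: ug; rewrite inE b's orbT.
- by move=> b1 b2 h1 h2; apply: dg; rewrite inE ?h1 ?h2 orbT.
rewrite andbT; apply/hasPn => v /flattenP[_ /mapP[b' b's ->] vb'] /=.
have := dg b b' (mem_head _ _); rewrite inE b's orbT => /(_ isT).
have -> : b != b' by apply: contraNneq bs => ->.
by move=> /(_ isT)/hasPn/(_ v vb').
Qed.

Lemma card_take (T : finType) (A : {set T}) m : m <= #|A| -> #|[set x in take m (enum A)]| = m.
Proof.
move=> le; rewrite cardsE (card_uniqP _) ?take_uniq ?enum_uniq //.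
by rewrite size_takel // -cardE.
Qed.

Lemma take_sub (T : finType) (A : {set T}) m : [set x in take m (enum A)] \subset A.
Proof. by apply/subsetP => x; rewrite inE => /mem_take; rewrite mem_enum. Qed.

Lemma disjP (T : finType) (A B : {set T}) : reflect (forall x, x \in A -> x \notin B) [disjoint A & B].
Proof. by rewrite disjoint_subset; apply: (iffP subsetP) => H x /H. Qed.

Lemma card_bigcup_disj (I T : finType) (S : {set I}) (M : I -> {set T}) D :
  {in S, forall i, #|M i| = D} -> {in S &, forall i j, i != j -> [disjoint M i & M j]} ->
  #|\bigcup_(i in S) M i| = #|S| * D.
Proof.
move=> MD Md; pose M' i := if i \in S then M i else set0.
have -> : \bigcup_(i in S) M i = \bigcup_i M' i by rewrite big_mkcond.
rewrite -sum1_card partition_disjoint_bigcup; last first.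
  move=> i j ij; rewrite /M'; case: ifPn => iS; last by rewrite -setI_eq0 set0I.
  by case: ifPn => jS; [exact: Md|rewrite -setI_eq0 setI0].
rewrite -sum_nat_const [RHS]big_mkcond; apply: eq_bigr => i _; rewrite sum1_card /M'.
by case: ifPn => [/MD //|_]; rewrite cards0.
Qed.

Lemma uniq_map_inj (S T : eqType) (g : S -> T) (s : seq S) : uniq (map g s) -> {in s &, injective g}.
Proof.
elim: s => //= a s IH /andP[na us] x y; rewrite !inE => /orP[/eqP->|xs] /orP[/eqP->|ys] // E.
- by rewrite E map_f in na.
- by rewrite -E map_f in na.
- exact: IH us _ _ xs ys E.
Qed.

Section Structure.
Variables (n c : nat) (f : outcome n c) (Y0 : {set 'I_n}) (Cm Ce Cb : {set 'I_c}).
Variables (d0 k th0 th1 D m q sg s6 s7 mm6 mm7 bb : nat).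
Variables (B SM : {set 'I_n}).
Hypotheses (BE : forall v, (v \in B) = (cnt Ce (star v Y0) f < d0))
  (SME : forall v, (v \in SM) = (cnt setT (star v setT) f < th0)).
Notation adj := (adj f).
Hypotheses (dis_me : [disjoint Cm & Ce]) (dis_mb : [disjoint Cm & Cb]) (dis_eb : [disjoint Ce & Cb]).
Hypotheses (th0d0 : th0 <= d0) (th01 : th1 + 2 * k <= th0) (th1_2 : 2 <= th1).
Hypothesis card_B : #|B| <= bb.
Hypothesis H1 : forall z, #|[set x in B | adj z x]| <= k.
Hypothesis H2 : forall z, #|[set x | [&& adj z x, x \notin B & [exists b in B, (b != z) && adj x b]]]| <= k.
Hypothesis H4 : forall v b, v \in SM -> b \in B -> b != v ->
  ~~ adj v b /\ forall x, adj v x -> ~~ adj x b.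
Hypothesis H5 : forall v, 2 <= cnt [set: 'I_c] (star v [set: 'I_n]) f.
Definition touches (S : {set 'I_n}) (e : edge n) := ~~ [disjoint eset e & S].
Hypothesis H12 : forall e1 e2, touches SM e1 -> touches SM e2 -> f e1 != None -> f e1 = f e2 -> e1 = e2.
(** Colour [k0] is lost at [z]: an edge at [z] has it, but so does another edge that touches a small
    vertex, for which the colour is reserved. *)
Definition shared z k0 := [exists x, [exists e,
  [&& touches SM e, eset e != [set z; x], f e == Some k0 & ecol f z x == Some k0]]].
Hypothesis H3 : forall z k1 k2, shared z k1 -> shared z k2 -> k1 = k2.
(** [H6] and [H7] serve to verify Hall's condition: a violating set would send too many edges in too
    few colours. The factors [5] and [2 * D + 1] are twice the demands [2] and [D], plus one colour
    per vertex lost to small vertices. *)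
Hypothesis H6 : forall (S : {set 'I_n}) (K : {set 'I_c}), 0 < #|S| <= s6 -> #|K| <= 5 * #|S| ->
  4 * cnt K (between S setT) f < mm6 * #|S|.
Hypothesis mm6P : mm6 <= 2 * th1.
Hypothesis s6P : bb <= s6.
Hypothesis H7 : forall (S : {set 'I_n}) (K : {set 'I_c}), 0 < #|S| <= s7 -> #|K| <= (2 * D + 1) * #|S| ->
  4 * cnt K (between S Y0) f < mm7 * #|S|.
Hypothesis mm7P : mm7 <= 2 * (d0 - 2 * k).
Hypothesis H8 : forall U : {set 'I_n}, 0 < #|U| <= 3 * sg -> 3 * cnt setT (inside U) f < D * #|U|.
Hypothesis H9 : forall (A1 A2 : {set 'I_n}) (K : {set 'I_c}), m <= #|A1| -> m <= #|A2| -> [disjoint A1 & A2] ->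
     K \subset Cm -> q <= #|K| -> exists a b, [/\ a \in A1, b \in A2 & coloured_in K (ecol f a b)].
Hypothesis card_Cm : n + q + th1 * bb <= #|Cm|.
Hypothesis s7P : #|Y0| + th1 * bb + 4 * m <= s7.

Lemma adjP x y : reflect (exists k, ecol f x y = Some k) (adj x y).
Proof.
apply: (iffP idP) => [|[j E]]; last by rewrite adj_ecol E.
by rewrite adj_ecol; case: (ecol f x y) => [j|] // _; exists j.
Qed.

Lemma SM_B : SM \subset B.
Proof.
apply/subsetP => v; rewrite SME BE => lt; apply: leq_trans th0d0; apply: leq_ltn_trans lt.
rewrite -!deg_cnt; apply: subset_leq_card; apply/subsetP => y; rewrite !inE => /andP[_].
by case: ecol => [j|] //=; rewrite inE.
Qed.

Lemma degE v : cnt [set: 'I_c] (star v [set: 'I_n]) f = #|[set y | adj v y]|.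
Proof. by rewrite -deg_cnt; apply: eq_card => y; rewrite !inE adj_ecol; case: ecol => [j|] //=; rewrite inE. Qed.

(* The neighbours of [b] outside [B] that see no other vertex of [B]: any two of them turn [b] into the
   middle of a unit with ports outside [B]. *)
Definition private b := [set x | [&& adj b x, x \notin B & [forall b' in B, (b' != b) ==> ~~ adj x b']]].

Lemma privateP b x : reflect [/\ adj b x, x \notin B & forall b', b' \in B -> adj x b' -> b' = b] (x \in private b).
Proof.
rewrite inE; apply: (iffP and3P) => -[h1 h2 h3]; split => //.
  move=> b' b'B xb'; apply/eqP; apply: contraTT xb' => nb; have /forallP/(_ b') := h3.
  by rewrite b'B nb.
by apply/forallP => b'; apply/implyP => b'B; apply/implyP => nb; apply: contraNN nb => /(h3 _ b'B)->.
Qed.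

Definition csize b := if b \in SM then 2 else th1.

(** A small vertex is far from all other poor vertices, so all its neighbours, at least two, are
    private. Any other vertex has degree at least [th0] and loses at most [k] neighbours that are
    poor and [k] that see another poor vertex. *)
Lemma card_private b : b \in B -> csize b <= #|private b|.
Proof.
move=> bB; rewrite /csize; case: ifPn => bS.
  apply: leq_trans (H5 b) _; rewrite degE; apply: subset_leq_card; apply/subsetP => x; rewrite inE => bx.
  apply/privateP; split=> //.
    apply/negP => xB; have xb : x != b by apply: contraTneq bx => ->; rewrite adj_ecol ecol_diag.
    by have [] := H4 bS xB xb; rewrite bx.
  move=> b' b'B xb'; apply/eqP; apply: contraTT xb' => nb.
  by have [_ ->] := H4 bS b'B nb.
have : th0 <= #|[set y | adj b y]| by rewrite -degE leqNgt -SME.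
set N := [set y | adj b y] => le0; pose T1 := [set x in B | adj b x].
pose T2 := [set x | [&& adj b x, x \notin B & [exists b' in B, (b' != b) && adj x b']]].
have sub : N \subset private b :|: (T1 :|: T2).
  apply/subsetP => x; rewrite !inE => bx; rewrite bx /=; case xB: (x \in B) => //=; rewrite ?orbT //= orbC -implyNb.
  apply/implyP; rewrite negb_exists => /forallP h; apply/forallP => b'; have := h b'.
  by rewrite negb_and negb_and -!implybE => ->.
have l1 := leq_trans (subset_leq_card sub) (leq_card_setU _ _).
have l2 := (leq_card_setU T1 T2).1.
have l3 : #|T1| <= k := H1 b.
have l4 : #|T2| <= k := H2 b.
have ar a t u t1 t2 x y z : a <= t + u -> u <= t1 + t2 -> t1 <= x -> t2 <= x -> y <= a -> z + 2 * x <= y -> z <= t.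
  by clear; lia.
exact: ar l1 l2 l3 l4 le0 th01.
Qed.

(** Restricting to [csize b] private neighbours bounds in advance the number of colours that the
    units of poor vertices may use. *)
Definition cand b := [set x in take (csize b) (enum (private b))].

Lemma cand_tg b : cand b \subset private b. Proof. exact: take_sub. Qed.
Lemma card_cand b : b \in B -> #|cand b| = csize b. Proof. by move=> bB; exact/card_take/card_private. Qed.

Definition Xall := \bigcup_(b in B) cand b.
Definition Yf := [set y in Y0 | (y \notin B) && [forall b in B, ~~ adj y b]].

Lemma Xall_B x : x \in Xall -> x \notin B.
Proof. by case/bigcupP => b bB /(subsetP (cand_tg b))/privateP[]. Qed.

Lemma Yf_B y : y \in Yf -> y \notin B. Proof. by rewrite inE => /and3P[]. Qed.

Lemma Xall_Yf x : x \in Xall -> x \notin Yf.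
Proof.
case/bigcupP => b bB /(subsetP (cand_tg b))/privateP[bx _ _]; apply/negP; rewrite inE => /and3P[_ _ /forallP/(_ b)].
by rewrite bB adjC bx.
Qed.

Lemma csize_le b : csize b <= th1.
Proof. by rewrite /csize; case: ifP. Qed.

Lemma card_Xall : #|Xall| <= th1 * bb.
Proof.
apply: (@leq_trans (\sum_(b in B) th1)); last by rewrite sum_nat_const mulnC leq_mul2l card_B orbT.
rewrite /Xall; elim/big_rec2: _ => [|b X j bB le]; first by rewrite cards0.
apply: leq_trans (leq_card_setU _ _) _; apply: leq_add => //.
by rewrite card_cand // csize_le.
Qed.

(** All colours that may occur in units of poor vertices. They are withdrawn from [Cm] because
    merging must precede the choice of colours: the ends of the merged paths are among the ports to
    which Hall's theorem assigns colours. *)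
Definition ccol := \bigcup_(b in B) [set k0 | [exists x in cand b, ecol f b x == Some k0]].

Lemma card_img (S : {set 'I_n}) b : #|[set k0 | [exists x in S, ecol f b x == Some k0]]| <= #|S|.
Proof.
rewrite -(card_imset _ (@Some_inj _)); apply: leq_trans (leq_imset_card (ecol f b) S).
apply: subset_leq_card; apply/subsetP => o /imsetP[k0]; rewrite inE => /existsP[x /andP[xS /eqP E]] ->.
by rewrite -E; apply: imset_f.
Qed.

Lemma card_ccol : #|ccol| <= th1 * bb.
Proof.
apply: (@leq_trans (\sum_(b in B) th1)); last by rewrite sum_nat_const mulnC leq_mul2l card_B orbT.
rewrite /ccol; elim/big_rec2: _ => [|b X j bB le]; first by rewrite cards0.
apply: leq_trans (leq_card_setU _ _) _; apply: leq_add => //.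
by apply: leq_trans (card_img _ _) _; rewrite card_cand // csize_le.
Qed.

Definition X0 := ~: (Yf :|: B :|: Xall).

Lemma merged : exists2 U, joined f X0 (Cm :\: ccol) U & size U <= 2 * m.
Proof.
apply: (@merge_paths _ _ _ _ _ _ q).
  rewrite cardsD; have := card_ccol; have := subset_leq_card (subsetIr Cm ccol).
  by move: card_Cm; move: #|Cm| #|Cm :&: _| #|ccol|; clear; lia.
move=> A1 A2 K h1 h2 h3 h4; apply: H9 => //; exact: subset_trans h4 (subsetDl _ _).
Qed.

Definition scol := [set k0 | [exists e, touches SM e && (f e == Some k0)]].

Definition lcol v := if v \in B then [set k0 | [exists x in cand v, ecol f v x == Some k0]] :\: scol
  else [set k0 in Ce | [exists y in Yf, ecol f v y == Some k0]] :\: scol.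

(* Every poor vertex that is not small needs two colours for its unit, every port needs [D] colours of edges
   to free vertices in order to expand. Colours of edges at small vertices ([scol]) are reserved. *)
Definition dem v := if v \in B then 2 else D.

Lemma shared1 v : #|[set k0 | shared v k0]| <= 1.
Proof.
rewrite leqNgt; apply/negP => /card_gt1P[k1 [k2 [h1 h2 /eqP]]]; rewrite !inE in h1 h2; apply.
exact: H3 h1 h2.
Qed.

Definition shset (S : {set 'I_n}) := \bigcup_(v in S) [set k0 | shared v k0].

Lemma card_shset S : #|shset S| <= #|S|.
Proof.
rewrite -[leqRHS]sum1_card /shset; elim/big_rec2: _ => [|v X j vS le]; first by rewrite cards0.
by apply: leq_trans (leq_card_setU _ _) _; apply: leq_add => //; exact: shared1.
Qed.

Lemma shared_scol v x k0 : v \notin SM -> x \notin SM -> ecol f v x = Some k0 -> k0 \in scol -> shared v k0.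
Proof.
move=> vS xS E; rewrite inE => /existsP[e /andP[te fe]]; apply/existsP; exists x; apply/existsP; exists e.
rewrite te fe E eqxx /= andbT; apply: contraNneq te => ->; rewrite -setI_eq0; apply/eqP/setP => w; rewrite !inE.
by apply/negP => /andP[/orP[]/eqP->]; rewrite ?(negPf vS) ?(negPf xS).
Qed.

(** An edge with both ends in [S'] may be counted from either end, hence the factor [2]. *)
Lemma count_pairs (S' Y : {set 'I_n}) (T : 'I_n -> {set 'I_n}) (K : {set 'I_c}) t :
  {in S', forall v, t <= #|T v|} ->
  (forall v w, v \in S' -> w \in T v -> w \in Y /\ coloured_in K (ecol f v w)) ->
  #|S'| * t <= 2 * cnt K (between S' Y) f.
Proof.
move=> Tt TK; pose E' := [set e in between S' Y | coloured_in K (f e)].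
apply: (@leq_trans #|[set p : 'I_n * 'I_n | (p.1 \in S') && (p.2 \in T p.1)]|).
  apply: card_pairs_ge => v vS; apply: leq_trans (Tt v vS) _.
  by apply: subset_leq_card; apply/subsetP => w wT; rewrite !inE /= vS wT.
pose sw (p : 'I_n * 'I_n) := (p.2, p.1).
apply: (@leq_trans #|[set val e | e in E'] :|: [set sw (val e) | e in E']|); last first.
  rewrite mul2n -addnn; apply: leq_trans (leq_card_setU _ _) _.
  by apply: leq_add; exact: leq_imset_card.
apply: subset_leq_card; apply/subsetP => -[v w]; rewrite inE /= => /andP[vS wT].
have [wY K'] := TK _ _ vS wT.
have [|e E] := @ecol_ex _ _ f v w; first by case: (ecol f v w) K'.
have eE : e \in E'.
  by apply/setIdP; rewrite -(ecol_edge f E); split => //; apply/betweenP; exists v, w.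
rewrite inE; apply/orP; case: (eset_pairE E) => Ev; [left|right]; apply/imsetP; exists e; rewrite ?Ev //.
Qed.

(** The poor vertices in [S], and likewise the ports in [S], see together more than twice as many
    colours as they demand. The larger of the two demands thus already provides enough colours for
    both, and the overlap of the two kinds of lists need not be controlled. If one kind saw too few
    colours, its edges would all use these or colours lost to small vertices, against [H6] or
    [H7]. *)
Lemma hall_colours (S Z : {set 'I_n}) : S \subset (B :\: SM) :|: Z -> [disjoint Z & B] -> #|Z| <= s7 ->
  \sum_(v in S) dem v <= #|\bigcup_(v in S) lcol v|.
Proof.
move=> /subsetP SS dZ Z7; pose S1 := S :&: B; pose S2 := S :\: B.
have sumE : \sum_(v in S) dem v = 2 * #|S1| + D * #|S2|.
  rewrite (bigID (mem B)) /=; congr (_ + _).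
    rewrite (eq_bigr (fun=> 2)); last by move=> v /andP[_ vB]; rewrite /dem vB.
    by rewrite sum_nat_const mulnC; congr (_ * _); apply: eq_card => v; rewrite !inE.
  rewrite (eq_bigr (fun=> D)); last by move=> v /andP[_ vB]; rewrite /dem (negPf vB).
  by rewrite sum_nat_const mulnC; congr (_ * _); apply: eq_card => v; rewrite !inE andbC.
have S1B v : v \in S1 -> [/\ v \in S, v \in B & v \notin SM].
  rewrite inE => /andP[vS vB]; split => //; have := SS _ vS; rewrite !inE vB andbT => /orP[//|vZ].
  by rewrite (disjointFr dZ vZ) in vB.
have S2Z v : v \in S2 -> [/\ v \in S, v \notin B & v \in Z].
  by rewrite inE => /andP[vB vS]; split => //; have := SS _ vS; rewrite !inE (negPf vB) andbF.
have notSM v : v \notin B -> v \notin SM by apply: contraNN; exact: (subsetP SM_B).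
pose L (S' : {set 'I_n}) := \bigcup_(v in S') lcol v.
have Lsub (S' : {set 'I_n}) : S' \subset S -> #|L S'| <= #|\bigcup_(v in S) lcol v|.
  move=> /subsetP sub; apply: subset_leq_card; apply/bigcupsP => v vS'.
  by apply: (bigcup_sup v); rewrite // sub.
have b1 : 0 < #|S1| -> 4 * #|S1| < #|L S1|.
  move=> S1p; rewrite ltnNge; apply/negP => le.
  pose K := L S1 :|: shset S1.
  have cK : #|K| <= 5 * #|S1|.
    apply: leq_trans (leq_card_setU _ _) _; apply: leq_trans (leq_add le (card_shset S1)) _.
    by rewrite -{2}[#|S1|]mul1n -mulnDl.
  have S16 : 0 < #|S1| <= s6.
    rewrite S1p /=; apply: leq_trans s6P; apply: leq_trans card_B; exact/subset_leq_card/subsetIr.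
  have := H6 S16 cK; apply/negP; rewrite -leqNgt.
  apply: (@leq_trans (2 * (#|S1| * th1))); first by rewrite mulnCA mulnC leq_mul.
  rewrite (_ : 4 = 2 * 2) // -mulnA leq_mul2l /=; apply: (@count_pairs _ _ cand).
    by move=> v /S1B[_ vB vS]; rewrite card_cand // /csize (negPf vS).
  move=> v x vS1 xc; have [vS vB vSM] := S1B _ vS1; split; first by rewrite inE.
  have /privateP[vx xB _] := subsetP (cand_tg v) _ xc; have /adjP[k0 E] := vx; rewrite E /= inE.
  case k0s: (k0 \in scol); apply/orP; [right|left]; apply/bigcupP; exists v => //.
    by rewrite inE; apply: (shared_scol vSM _ E) => //; exact: notSM.
  by rewrite /lcol vB in_setD k0s in_set; apply/existsP; exists x; rewrite xc E eqxx.
have b2 : 0 < #|S2| -> 2 * D * #|S2| < #|L S2|.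
  move=> S2p; rewrite ltnNge; apply/negP => le.
  pose K := L S2 :|: shset S2.
  have cK : #|K| <= (2 * D + 1) * #|S2|.
    apply: leq_trans (leq_card_setU _ _) _; apply: leq_trans (leq_add le (card_shset S2)) _.
    by rewrite mulnDl mul1n.
  have S27 : 0 < #|S2| <= s7.
    rewrite S2p /=; apply: leq_trans Z7; apply: subset_leq_card; apply/subsetP => v.
    by case/S2Z.
  have := H7 S27 cK; apply/negP; rewrite -leqNgt.
  apply: (@leq_trans (2 * (#|S2| * (d0 - 2 * k)))); first by rewrite mulnCA mulnC leq_mul.
  rewrite (_ : 4 = 2 * 2) // -mulnA leq_mul2l /=.
  (* A vertex that is not poor has at least [d0] edges coloured from [Ce] into [Y0], and at most
     [2 * k] of them end outside [Yf]. *)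
  apply: (@count_pairs _ _ (fun z => [set y in Yf | coloured_in Ce (ecol f z y)])).
    move=> z /S2Z[_ zB _]; have := zB; rewrite BE -leqNgt -deg_cnt => dz.
    set N := [set y in Y0 | _] in dz; pose T1 := [set x in B | adj z x].
    pose T2 := [set x | [&& adj z x, x \notin B & [exists b' in B, (b' != z) && adj x b']]].
    have sub : N \subset [set y in Yf | coloured_in Ce (ecol f z y)] :|: (T1 :|: T2).
      apply/subsetP => x; rewrite !inE => /andP[-> zx] /=.
      have -> : adj z x by rewrite adj_ecol; case: (ecol f z x) zx.
      rewrite zx andbT; case xB: (x \in B) => //=; rewrite -implyNb; apply/implyP.
      rewrite negb_forall => /existsP[b]; rewrite negb_imply negbK => /andP[bB xb].
      by apply/existsP; exists b; rewrite bB xb andbT /=; apply: contraNneq zB => <-.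
    have l1 := leq_trans (subset_leq_card sub) (leq_card_setU _ _).
    have l2 := (leq_card_setU T1 T2).1.
    have l3 : #|T1| <= k := H1 z.
    have l4 : #|T2| <= k := H2 z.
    have ar a t u t1 t2 x y : a <= t + u -> u <= t1 + t2 -> t1 <= x -> t2 <= x -> y <= a -> y - 2 * x <= t.
      by clear; lia.
    exact: ar l1 l2 l3 l4 dz.
  move=> z y zS2; rewrite inE => /andP[yY zy]; have [_ zB _] := S2Z _ zS2.
  split; first by move: yY; rewrite inE => /andP[].
  case E: (ecol f z y) zy => [k0|] //= k0C; rewrite inE.
  case k0s: (k0 \in scol); apply/orP; [right|left]; apply/bigcupP; exists z => //.
    by rewrite inE; apply: (shared_scol _ _ E) => //; apply: notSM => //; exact: Yf_B.
  by rewrite /lcol (negPf zB) in_setD k0s in_set k0C; apply/existsP; exists y; rewrite yY E eqxx.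
rewrite sumE; have := Lsub S1 (subsetIl _ _); have := Lsub S2 (subsetDl _ _).
case: (posnP #|S1|) => [-> | /b1]; case: (posnP #|S2|) => [->|/b2].
- by rewrite !muln0.
- by rewrite muln0; move: #|S2| #|L S2| #|\bigcup_(v in S) lcol v|; clear; nia.
- by rewrite muln0; move: #|S1| #|L S1| #|\bigcup_(v in S) lcol v|; clear; nia.
move: #|S1| #|L S1| #|S2| #|L S2| #|\bigcup_(v in S) lcol v|; clear; nia.
Qed.

Variable hd : outcome n c -> {set edge n}.
Hypothesis hdE : forall e, (e \in hd f) = [disjoint eset e & B].

Definition uends (u : seq 'I_n) := if u is a :: l then [:: a; last a l] else [::].

Lemma size_uends (U : seq (seq 'I_n)) : size (flatten (map uends U)) <= 2 * size U.
Proof. by elim: U => //= u U IH; rewrite size_cat mulnS leq_add //; case: u. Qed.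

(** Merged paths are coloured from [Cm] without [ccol], units of poor vertices from [ccol], edges
    from ports to free vertices from [Ce]. The remaining clashes, within and between the last two
    kinds, are excluded by the disjointness of the sets [M v], by [H12] for two small vertices, and
    by reserving [scol]. *)
Lemma exists_base : exists b, isbase Cb B sg s7 (th1 * bb) (masked Cb hd f) b.
Proof.
have [U [pf ne uc ic] sU] := merged.
have uf : uniq (flatten U) by rewrite (perm_uniq pf) enum_uniq.
have memU x : (x \in flatten U) = (x \in X0) by rewrite (perm_mem pf) mem_enum.
pose EU := [set x in flatten (map uends U)].
have EUX x : x \in EU -> x \in X0.
  rewrite inE -memU => /flattenP[_ /mapP[u uU ->] xu]; apply/flattenP; exists u => //.
  by move: xu; case: u {uU} => //= a l; rewrite !inE => /orP[/eqP->|/eqP->]; rewrite ?eqxx // -in_cons mem_last.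
have X0N x : x \in X0 -> [/\ x \notin Yf, x \notin B & x \notin Xall].
  by rewrite !in_setC !in_setU => /norP[/norP[]].
pose Zs := Yf :|: Xall :|: EU.
have ZsN z : z \in Zs -> z \notin B.
  by rewrite !in_setU => /orP[/orP[/Yf_B|/Xall_B]|/EUX/X0N[]].
have dZ : [disjoint Zs & B] by apply/disjP => z /ZsN.
have Z7 : #|Zs| <= s7.
  apply: leq_trans s7P; apply: leq_trans (leq_card_setU _ _) _; apply: leq_add.
    apply: leq_trans (leq_card_setU _ _) _; apply: leq_add; last exact: card_Xall.
    by apply: subset_leq_card; apply/subsetP => y; rewrite inE => /andP[].
  rewrite cardsE; apply: leq_trans (card_size _) _; apply: leq_trans (size_uends U) _.
  by rewrite (_ : 4 = 2 * 2) // -mulnA leq_mul2l.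
have [M [Msub Mcard Mdis]] := hall_demand (fun S sS => hall_colours sS dZ Z7).
have MB b : b \in B -> b \notin SM -> b \in B :\: SM :|: Zs by rewrite !inE => -> ->.
have MZ z : z \in Zs -> z \in B :\: SM :|: Zs by move=> zZ; rewrite inE zZ orbT.
have Mscol v k0 : v \in B :\: SM :|: Zs -> k0 \in M v -> k0 \notin scol.
  move=> vA /(subsetP (Msub _ vA)); rewrite /lcol.
  by case: ifP => _; rewrite in_setD => /andP[].
(* The two neighbours that become the ports around [b]. For a small [b] any two candidates do, as
   its edges have different colours by [H12]; otherwise the two colours in [M b] determine them. *)
pose cherry b (p : 'I_n * 'I_n) := b \in B -> [/\ p.1 \in cand b, p.2 \in cand b, p.1 != p.2,
   ecol f b p.1 <> ecol f b p.2 & b \notin SM ->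
   exists k1 k2, [/\ k1 \in M b, k2 \in M b, ecol f b p.1 = Some k1 & ecol f b p.2 = Some k2]].
have candadj b x : b \in B -> x \in cand b -> adj b x.
  by move=> bB /(subsetP (cand_tg b))/privateP[].
have /choice[ch chP] : forall b, exists p, cherry b p.
  move=> b; case bB: (b \in B); last by exists (b, b); rewrite /cherry bB.
  case bS: (b \in SM).
    have /card_gt1P[x [y [xc yc xy]]] : 1 < #|cand b| by rewrite card_cand // /csize bS.
    have bS' : b \notin SM -> False by rewrite bS.
    exists (x, y) => _; split=> //; try by move/bS'.
    change (ecol f b x <> ecol f b y).
    have [e E] : exists e, eset e = [set b; x] by apply: ecol_ex; exact: candadj xc.
    have [e' E'] : exists e, eset e = [set b; y] by apply: ecol_ex; exact: candadj yc.
    have te w e0 : eset e0 = [set b; w] -> touches SM e0.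
      by move=> E0; rewrite /touches E0; apply/negP => /disjP/(_ b); rewrite !inE eqxx bS => /(_ isT).
    rewrite (ecol_edge f E) (ecol_edge f E') => /H12 edge_expect.
    have ee : e = e'.
      by apply: edge_expect; [exact: te E|exact: te E'|rewrite -(ecol_edge f E); exact: candadj].
    have : x \in [set b; y] by rewrite -E' -ee E !inE eqxx orbT.
    rewrite !inE (negPf xy) orbF => /eqP xb; have := candadj _ _ bB xc.
    by rewrite xb adj_ecol ecol_diag.
  have bA := MB _ bB (negbT bS).
  have /card_gt1P[k1 [k2 [k1M k2M k12]]] : 1 < #|M b| by rewrite Mcard // /dem bB.
  have /(subsetP (Msub _ bA)) := k1M; have /(subsetP (Msub _ bA)) := k2M.
  rewrite /lcol bB !in_setD => /andP[_]; rewrite in_set => /existsP[y /andP[yc /eqP ky]].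
  case/andP => _; rewrite in_set => /existsP[x /andP[xc /eqP kx]].
  exists (x, y) => _; split => //.
  - by apply: contraNneq k12 => /= xy; move: kx; rewrite xy ky => -[->].
  - by rewrite [ecol _ _ _]kx [ecol _ _ _]ky => -[] /eqP; apply/negP.
  - by exists k1, k2.
have /choice[yy yyP] : forall zk : 'I_n * 'I_c, exists y, zk.1 \in Zs -> zk.2 \in M zk.1 ->
    [/\ y \in Yf, ecol f zk.1 y = Some zk.2, zk.2 \in Ce & zk.2 \notin scol].
  move=> [z k0]; case zZ: (z \in Zs); last by exists z; rewrite /= ?zZ.
  case kM: (k0 \in M z); last by exists z; rewrite /= ?kM.
  have := subsetP (Msub _ (MZ _ zZ)) _ kM; rewrite /lcol (negPf (ZsN _ zZ)) in_setD => /andP[ks].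
  by rewrite in_set => /andP[kC /existsP[y /andP[yY /eqP E]]]; exists y.
(* The edges of the structure as ordered pairs, in three kinds: along merged paths, at poor
   vertices, from ports to free vertices. Being rainbow then means that the colour is injective on
   [PL]. *)
pose PL (p : 'I_n * 'I_n) := [\/ p \in flatten (map (@ppairs 'I_n) U),
  exists2 b, b \in B & p = (b, (ch b).1) \/ p = (b, (ch b).2) |
  exists z k0, [/\ z \in Zs, k0 \in M z & p = (z, yy (z, k0))]].
have colU : flatten (map (pcols f) U) = [seq ecol f p.1 p.2 | p <- flatten (map (@ppairs 'I_n) U)].
  by rewrite map_flatten -map_comp; congr flatten; apply: eq_map => u; rewrite pcols_ppairs.
have c1 p : p \in flatten (map (@ppairs 'I_n) U) -> exists k0, [/\ ecol f p.1 p.2 = Some k0, k0 \in Cm & k0 \notin ccol].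
  move=> pU; move: ic; rewrite colU all_map => /allP/(_ _ pU) /=.
  by case: ecol => [k0|] //=; rewrite in_setD => /andP[h1 h2]; exists k0.
have c2 b x : b \in B -> x = (ch b).1 \/ x = (ch b).2 -> exists k0, [/\ ecol f b x = Some k0, k0 \in ccol,
    (b \in SM -> k0 \in scol) & (b \notin SM -> k0 \in M b)].
  move=> bB xE; have [h1 h2 _ _ h3] := chP _ bB.
  have xc : x \in cand b by case: xE => ->.
  have /adjP[k0 E] := candadj _ _ bB xc; exists k0; split => //.
  - by apply/bigcupP; exists b => //; rewrite inE; apply/existsP; exists x; rewrite xc E eqxx.
  - move=> bS; rewrite inE; have [|e edge_expect] := @ecol_ex _ _ f b x; first by rewrite E.
    apply/existsP; exists e; rewrite -(ecol_edge f edge_expect) E eqxx andbT /touches edge_expect.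
    by apply/negP => /disjP/(_ b); rewrite !inE eqxx bS => /(_ isT).
  - case/h3 => k1 [k2 [m1 m2 E1 E2]]; move: E; case: xE => ->; first by rewrite E1 => -[<-].
    by rewrite E2 => -[<-].
have c3 z k0 : z \in Zs -> k0 \in M z -> [/\ yy (z, k0) \in Yf, ecol f z (yy (z, k0)) = Some k0, k0 \in Ce & k0 \notin scol].
  exact: (yyP (z, k0)).
have PLsome p : PL p -> ecol f p.1 p.2 != None.
  case=> [/c1[k0 [-> _ _]]|[b bB H]|[z [k0 [zZ kM ->]]]] //.
    by have [k0 [E _ _ _]] : exists k0, [/\ ecol f p.1 p.2 = Some k0, k0 \in ccol,
      (b \in SM -> k0 \in scol) & (b \notin SM -> k0 \in M b)]; [case: H => -> /=; apply: c2 => //; [left|right]|rewrite E].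
  by have [_ -> _ _] := c3 _ _ zZ kM.
have disMZ b z k0 : b \in B -> b \notin SM -> z \in Zs -> k0 \in M b -> k0 \in M z -> False.
  move=> bB bS zZ kb kz; have bz : b != z by apply: contraTneq bB => ->; exact: ZsN.
  by have /disjP/(_ _ kb) := Mdis _ _ (MB _ bB bS) (MZ _ zZ) bz; rewrite kz.
have bch b p : b \in B -> p = (b, (ch b).1) \/ p = (b, (ch b).2) -> p.1 = b /\ (p.2 = (ch b).1 \/ p.2 = (ch b).2).
  by move=> _ [->|->]; split => //; [left|right].
have PLinj p p' : PL p -> PL p' -> ecol f p.1 p.2 = ecol f p'.1 p'.2 -> p = p'.
  move=> [h|[b bB H]|[z [k0 [zZ kM ->]]]] [h'|[b' b'B H']|[z' [k0' [z'Z k'M ->]]]] /=.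
  - by move: uc; rewrite colU => /uniq_map_inj; apply.
  - have [k0 [-> _ nk]] := c1 _ h; have [E1 E2] := bch _ _ b'B H'; rewrite E1.
    by have [k0' [-> kc _ _]] := c2 _ _ b'B E2 => -[E]; rewrite E kc in nk.
  - have [k0 [-> kC _]] := c1 _ h; have [_ -> k'C _] := c3 _ _ z'Z k'M => -[E].
    by have /disjP/(_ _ kC) := dis_me; rewrite E k'C.
  - have [k0 [-> _ nk]] := c1 _ h'; have [E1 E2] := bch _ _ bB H; rewrite E1.
    by have [k0' [-> kc _ _]] := c2 _ _ bB E2 => -[E]; rewrite -E kc in nk.
  - have [E1 E2] := bch _ _ bB H; have [E1' E2'] := bch _ _ b'B H'.
    have := c2 _ _ bB E2; have := c2 _ _ b'B E2'; rewrite E1 E1' => -[k1 [Ek1 _ s1 m1]] [k2 [Ek2 _ s2 m2]].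
    rewrite Ek1 Ek2 => -[kk]; rewrite kk in Ek2 s2 m2.
    have bb' : b = b'.
      case bS: (b \in SM); case b'S: (b' \in SM).
      + have [|e edge_expect] := @ecol_ex _ _ f b p.2; first by rewrite Ek2.
        have [|e' Ee'] := @ecol_ex _ _ f b' p'.2; first by rewrite Ek1.
        have te w b0 e0 : b0 \in SM -> eset e0 = [set b0; w] -> touches SM e0.
          by move=> b0S E0; rewrite /touches E0; apply/negP => /disjP/(_ b0); rewrite !inE eqxx b0S => /(_ isT).
        have ee : e = e'.
          apply: H12; [exact: te bS edge_expect|exact: te b'S Ee'|by rewrite -(ecol_edge f edge_expect) Ek2|].
          by rewrite -(ecol_edge f edge_expect) -(ecol_edge f Ee') Ek2.
        have : b \in [set b'; p'.2] by rewrite -Ee' -ee edge_expect !inE eqxx.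
        rewrite !inE => /orP[/eqP//|/eqP bx]; have [i1 i2 _ _ _] := chP _ b'B.
        have : b \in Xall by apply/bigcupP; exists b' => //; rewrite bx; case: E2' => ->.
        by move/Xall_B; rewrite bB.
      + by have := Mscol _ _ (MB _ b'B (negbT b'S)) (m1 (negbT b'S)); rewrite s2 ?bS.
      + by have := Mscol _ _ (MB _ bB (negbT bS)) (m2 (negbT bS)); rewrite s1 ?b'S.
      + apply/eqP/negPn/negP => bn; have := Mdis _ _ (MB _ bB (negbT bS)) (MB _ b'B (negbT b'S)) bn.
        by move/disjP/(_ k1); rewrite m1 ?b'S // m2 ?bS // => /(_ isT).
    have [_ _ _ nE _] := chP _ b'B.
    move: H H' Ek1 Ek2; rewrite bb' => -[->|->] [->|->] //= Ek1 Ek2; by case: nE; rewrite Ek1 Ek2.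
  - have [E1 E2] := bch _ _ bB H; have [_ -> _ ns] := c3 _ _ z'Z k'M; rewrite E1.
    have [k1 [-> _ s1 m1]] := c2 _ _ bB E2 => -[E]; rewrite E in s1 m1.
    case bS: (b \in SM); first by rewrite s1 in ns.
    by case: (disMZ b z' k0' bB (negbT bS) z'Z); rewrite ?m1 ?bS.
  - have [k1 [-> kC _]] := c1 _ h'; have [_ -> kC' _] := c3 _ _ zZ kM => -[E].
    by have /disjP/(_ _ kC) := dis_me; rewrite -E kC'.
  - have [E1 E2] := bch _ _ b'B H'; have [_ -> _ ns] := c3 _ _ zZ kM; rewrite E1.
    have [k1 [-> _ s1 m1]] := c2 _ _ b'B E2 => -[E]; rewrite -E in s1 m1.
    case bS: (b' \in SM); first by rewrite s1 in ns.
    by case: (disMZ b' z k0 b'B (negbT bS) zZ); rewrite ?m1 ?bS.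
  - have [_ -> _ _] := c3 _ _ zZ kM; have [_ -> _ _] := c3 _ _ z'Z k'M => -[E]; rewrite -E in k'M *.
    suff -> : z = z' by [].
    apply/eqP/negPn/negP => zz; have := Mdis _ _ (MZ _ zZ) (MZ _ z'Z) zz.
    by move/disjP/(_ _ kM); rewrite k'M.
pose E0 := [set e : edge n | `[< exists2 p, PL p & eset e = [set p.1; p.2] >]].
have E0P e : reflect (exists2 p, PL p & eset e = [set p.1; p.2]) (e \in E0) by rewrite inE; exact: asboolP.
have PLadj p : PL p -> adjE E0 p.1 p.2.
  move=> h; have [e edge_expect] := ecol_ex (PLsome _ h); apply/existsP; exists e; rewrite edge_expect eqxx andbT.
  by apply/E0P; exists p.
have E0inj : {in E0 &, injective f}.
  move=> e e' /E0P[p h edge_expect] /E0P[p' h' Ee'].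
  by rewrite -(ecol_edge f edge_expect) -(ecol_edge f Ee') => /(PLinj _ _ h h') pp; apply: eset_inj; rewrite edge_expect Ee' pp.
(* No edge of the structure is hidden: edges at poor vertices never are, and the other two kinds
   have colours outside [Cb]. *)
have E0mask e : e \in E0 -> masked Cb hd f e = f e.
  case/E0P => p h edge_expect; rewrite ffunE hdE -(ecol_edge f edge_expect).
  case: h => [/c1[k0 [-> kC _]]|[b bB H]|[z [k0 [zZ kM Ep]]]].
  - by rewrite /= (disjointFr dis_mb kC).
  - have [E1 _] := bch _ _ bB H; rewrite edge_expect E1; case: disjP => [/(_ b)|_]; last by rewrite andbF.
    by rewrite !inE eqxx bB => /(_ isT).
  - by rewrite Ep /=; have [_ -> kC _] := c3 _ _ zZ kM; rewrite /= (disjointFr dis_eb kC).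
pose chosen := [set x | [exists b in B, (x == (ch b).1) || (x == (ch b).2)]].
have chosenP x : x \in chosen -> exists2 b, b \in B & x \in cand b.
  rewrite inE => /existsP[b /andP[bB xE]]; exists b => //; have [h1 h2 _ _ _] := chP _ bB.
  by case/orP: xE => /eqP->.
have chosenX x : x \in chosen -> x \in Xall by case/chosenP => b bB xb; apply/bigcupP; exists b.
(* Candidates that were not chosen become units of a single vertex, but only [Yf] supplies the
   pivots [bY] of rotations. *)
pose Rest := Yf :|: (Xall :\: chosen).
pose chu b := [:: (ch b).1; b; (ch b).2].
pose UU := U ++ ([seq chu b | b <- enum B] ++ [seq [:: x] | x <- enum Rest]).
have flR : flatten [seq [:: x] | x <- enum Rest] = enum Rest by elim: (enum Rest) => //= x s ->.
have memch x : x \in flatten [seq chu b | b <- enum B] -> x \in B \/ x \in chosen.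
  case/flattenP => u /mapP[b]; rewrite mem_enum => bB ->; rewrite /chu !in_cons in_nil orbF => /or3P[/eqP->|/eqP->|/eqP->].
  - by right; rewrite in_set; apply/existsP; exists b; rewrite bB eqxx.
  - by left.
  - by right; rewrite in_set; apply/existsP; exists b; rewrite bB eqxx orbT.
have uUU : uniq (flatten UU).
  rewrite !flatten_cat flR !cat_uniq uf enum_uniq /= andbT.
  apply/and3P; split.
  - apply/hasPn => x; rewrite mem_cat mem_enum => hx /=; rewrite memU; apply/negP => /X0N[n1 n2 n3].
    case/orP: hx; last by rewrite in_setU in_setD (negPf n1) (negPf n3) andbF.
    by case/memch => [|/chosenX]; rewrite ?(negPf n2) ?(negPf n3).
  - apply: uniq_flatten_map; first exact: enum_uniq.
      move=> b; rewrite mem_enum => bB; have [h1 h2 h3 _ _] := chP _ bB.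
      have nb x : x \in cand b -> x != b by move/(subsetP (cand_tg b))/privateP => [_ xB _]; apply: contraNneq xB => ->.
      by rewrite /= !inE negb_or nb //= h3 eq_sym nb.
    move=> b b'; rewrite !mem_enum => bB b'B bb'; apply/hasPn => x; rewrite /chu => xb'; apply/negP => /= xb.
    have mem b0 x0 : b0 \in B -> x0 \in [:: (ch b0).1; b0; (ch b0).2] -> x0 = b0 \/ x0 \in private b0.
      move=> b0B; have [h1 h2 _ _ _] := chP _ b0B; rewrite !in_cons in_nil orbF => /or3P[]/eqP->;
      [right; exact: (subsetP (cand_tg b0) _ h1)|by left|right; exact: (subsetP (cand_tg b0) _ h2)].
    case: (mem _ _ bB xb) (mem _ _ b'B xb') => [->|/privateP[bx xB xu]] [xb''|/privateP[b'x x'B x'u]].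
    + by rewrite xb'' eqxx in bb'.
    + by rewrite bB in x'B.
    + by rewrite xb'' b'B in xB.
    + by have := xu b' b'B; rewrite adjC b'x => /(_ isT) E; rewrite E eqxx in bb'.
  - apply/hasPn => x; rewrite mem_enum => xR; apply/negP => /= /memch[xB|xc].
      by move: xR; rewrite in_setU in_setD => /orP[/Yf_B|/andP[_ /Xall_B]]; rewrite xB.
    by move: xR; rewrite in_setU in_setD xc /= orbF => xY; have := Xall_Yf (chosenX _ xc); rewrite xY.
have neUU : {in UU, forall u, u != [::]}.
  move=> u; rewrite !mem_cat => /or3P[|/mapP[b _ ->]|/mapP[x _ ->]] //.
  exact: (allP ne).
have chosenP' b : b \in B -> (ch b).1 \in chosen /\ (ch b).2 \in chosen.
  by move=> bB; rewrite !in_set; split; apply/existsP; exists b; rewrite bB eqxx ?orbT.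
have covUU v : v \in flatten UU.
  rewrite !flatten_cat flR !mem_cat mem_enum memU.
  case vB: (v \in B).
    apply/orP; right; apply/orP; left; apply/flattenP; exists (chu v); last by rewrite /chu !inE eqxx orbT.
    by apply: map_f; rewrite mem_enum.
  case vc: (v \in chosen).
    apply/orP; right; apply/orP; left; have := vc; rewrite in_set => /existsP[b /andP[bB vE]].
    apply/flattenP; exists (chu b); first by apply: map_f; rewrite mem_enum.
    by case/orP: vE => /eqP->; rewrite /chu !inE eqxx ?orbT.
  rewrite [in X in _ || X]in_setU in_setD vc /= [v \in X0]in_setC !in_setU vB orbF.
  by case: (v \in Yf) => //=; case: (v \in Xall); rewrite ?orbT.
have soUU : {in UU, forall u, sorted (adjE E0) u}.
  move=> u; rewrite !mem_cat => /or3P[uU|/mapP[b bB ->]|/mapP[x _ ->]] //.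
    rewrite sorted_ppairs; apply/allP => p pu; apply: PLadj; constructor 1.
    by apply/flattenP; exists (ppairs u) => //; exact: map_f.
  rewrite mem_enum in bB; rewrite /= andbT adjEC.
  rewrite (PLadj (b, (ch b).1)) ?(PLadj (b, (ch b).2)) //; constructor 2; exists b => //; by [left|right].
have portZ z : z \in port_set UU -> z \in Zs.
  case/(port_setP neUU covUU) => u uIn /andP[un zu].
  have XallZ x : x \in Xall -> x \in Zs by move=> xX; rewrite in_setU in_setU xX orbT.
  move: uIn; rewrite !mem_cat => /or3P[uU|/mapP[b bB Eu]|/mapP[x xR Eu]].
  - rewrite in_setU; apply/orP; right; rewrite in_set; apply/flattenP; exists (uends u); first exact: map_f.
    by move: zu un; case: (u) => //= a l /orP[]/eqP->; rewrite !inE eqxx ?orbT.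
  - rewrite mem_enum in bB; have [q1 q2] := chosenP' _ bB.
    by move: zu; rewrite Eu /= => /orP[]/eqP->; apply/XallZ/chosenX.
  - move: xR zu; rewrite mem_enum Eu /= orbb in_setU in_setD => xR /eqP->.
    case/orP: xR => [xY|/andP[_ /XallZ //]]; by rewrite in_setU in_setU xY.
have YU y : y \in Yf -> [:: y] \in UU.
  by move=> yY; rewrite !mem_cat (map_f (fun x => [:: x])) ?orbT // mem_enum in_setU yY.
have mono_cnt S' K : S' != set0 -> S' \subset Zs -> K = \bigcup_(z in S') M z -> #|K| = #|S'| * D.
  move=> _ /subsetP SZ ->; apply: card_bigcup_disj.
    by move=> z /SZ zZ; rewrite Mcard ?MZ // /dem (negPf (ZsN _ zZ)).
  by move=> z z' /SZ zZ /SZ z'Z; apply: Mdis; exact: MZ.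
exists (Base E0 (port_set UU) Yf (port_swap UU) (port_path UU)); split => /=.
- exact: (port_swapK uUU neUU covUU).
- exact: (port_swap_set uUU neUU covUU).
- by move=> y yY; have [] := port_free uUU covUU (YU _ yY).
- by apply/subsetP => y yY; have [] := port_free uUU covUU (YU _ yY).
- exact: (port_path_head neUU covUU).
- exact: (port_path_last neUU covUU).
- exact: (port_path_sorted (@adjEC _ _) covUU soUU).
- exact: (port_path_uniq uUU covUU).
- exact: (port_path_rev uUU neUU covUU).
- exact: (port_path_disj uUU neUU covUU).
- exact: (port_path_cover uUU neUU covUU).
- by move=> e eE; rewrite E0mask //; case/E0P: eE => p h edge_expect; rewrite -(ecol_edge f edge_expect); exact: PLsome.
- by move=> e e' eE e'E; rewrite !E0mask //; exact: E0inj.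
(* If [S] had few outer neighbours [N], then [S :|: N], of at most [3 * #|S|] vertices, would
   contain an edge in each of the [D * #|S|] distinct colours assigned to [S], more than [H8]
   allows. *)
- move=> S SP /andP[S0 Ssg]; rewrite ltnNge; apply/negP => le.
  have SZ : S \subset Zs by apply/subsetP => z /(subsetP SP); exact: portZ.
  set N := outnb _ _ _ in le; pose V := S :|: N.
  have cV : #|V| <= 3 * #|S|.
    by apply: leq_trans (leq_card_setU _ _) _; rewrite (mulnDl 1 2) mul1n leq_add2l.
  have V0 : 0 < #|V| <= 3 * sg.
    rewrite (leq_trans cV) ?leq_mul2l // andbT; apply: leq_trans S0 _.
    exact/subset_leq_card/subsetUl.
  have := H8 V0; apply/negP; rewrite -leqNgt.
  apply: (@leq_trans (D * (3 * #|S|))); first by rewrite leq_mul2l cV orbT.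
  rewrite mulnCA leq_mul2l /= mulnC -(@mono_cnt S _ _ SZ erefl) -?card_gt0 //.
  pose E' := [set e in inside V | coloured_in setT (f e)].
  rewrite -(card_imset _ (@Some_inj _)); apply: (@leq_trans #|[set f e | e in E']|); last exact: leq_imset_card.
  apply: subset_leq_card; apply/subsetP => _ /imsetP[k0 /bigcupP[z zS kM] ->].
  have zZ := subsetP SZ _ zS; have [yY Ey _ _] := c3 _ _ zZ kM.
  have [|e edge_expect] := @ecol_ex _ _ f z (yy (z, k0)); first by rewrite Ey.
  have fe : f e = Some k0 by rewrite -(ecol_edge f edge_expect).
  apply/imsetP; exists e => //; apply/setIdP; split; last by rewrite fe /= in_setT.
  rewrite in_set edge_expect subUset !sub1set in_setU zS /= in_setU; case yS: (_ \in S) => //=.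
  rewrite in_set in_setD yS yY /=; apply/existsP; exists z; rewrite zS.
  by apply: (PLadj (z, yy (z, k0))); constructor 3; exists z, k0.
- by apply/disjP => z /portZ/ZsN.
- by apply: leq_trans Z7; apply: subset_leq_card; apply/subsetP => z; exact: portZ.
- apply: leq_trans card_ccol; apply: subset_leq_card; apply/subsetP => k0; rewrite in_set => /andP[kC /existsP[e /andP[eE /eqP]]].
  rewrite E0mask //; case/E0P: eE => p h edge_expect; rewrite -(ecol_edge f edge_expect).
  case: h => [/c1[k1 [-> k1C _]]|[b bB H]|[z [k1 [zZ kM ->]]]].
  - by move=> [E]; have := disjointFr dis_mb k1C; rewrite E kC.
  - have [E1 E2] := bch _ _ bB H; rewrite E1.
    by have [k1 [-> kc _ _]] := c2 _ _ bB E2 => -[<-].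
  - by have [_ -> k1C _] := c3 _ _ zZ kM => -[E]; have := disjointFr dis_eb k1C; rewrite E kC.
Qed.
End Structure.

(** * Closing the path with boosters *)

Lemma cycle_nth (T : eqType) (r : rel T) (x0 : T) (q : seq T) i : cycle r q -> i < size q ->
  r (nth x0 q i) (nth x0 q (i.+1 %% size q)).
Proof.
case: q => // x p /(pathP x0) H lt; have /= := H i; rewrite size_rcons => /(_ lt).
rewrite -rcons_cons nth_rcons lt nth_rcons.
move: lt; rewrite /= ltnS leq_eqVlt => /orP[/eqP->|lt].
  by rewrite ltnn eqxx modnn.
by rewrite lt modn_small.
Qed.

Lemma rainbow_ham_cycle n c (f : outcome n c) (E : {set edge n}) (q : seq 'I_n) : 3 <= n ->
  {in E, forall e, f e != None} -> {in E &, injective f} ->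
  uniq q -> cycle (adjE E) q -> (forall v, v \in q) -> has_rainbow_ham f.
Proof.
move=> n3 Epres Einj uq cq vq; have sq : size q = n.
  by rewrite -(card_uniqP uq) -[RHS]card_ord; apply: eq_card => v; rewrite vq.
rewrite /has_rainbow_ham n3 /=; have v0 : 'I_n := Ordinal (leq_trans (isT : 0 < 3) n3).
have sinj : injective (fun i : 'I_n => nth v0 q i).
  by move=> i j /eqP; rewrite nth_uniq ?sq // => /eqP ij; apply: val_inj.
pose s := perm sinj; have sE (i : 'I_n) : s i = nth v0 q i by rewrite permE.
have adjs (i : 'I_n) : adjE E (s i) (s (ordS i)).
  by rewrite !sE; have := @cycle_nth _ _ v0 q i cq; rewrite sq => /(_ (ltn_ord i)).
apply/existsP; exists s; apply/andP; split.
  apply/forallP => i; case/existsP: (adjs i) => e /andP[eE /eqP edge_expect].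
  by rewrite (ecol_edge f edge_expect) Epres.
apply/injectiveP => i j; case/existsP: (adjs i) => e /andP[eE /eqP edge_expect].
case/existsP: (adjs j) => e' /andP[e'E /eqP Ee'].
rewrite (ecol_edge f edge_expect) (ecol_edge f Ee') => /(Einj _ _ eE e'E) ee; rewrite {}ee Ee' in edge_expect.
have hi : s i \in [set s j; s (ordS j)] by rewrite edge_expect !inE eqxx.
have hj : s j \in [set s i; s (ordS i)] by rewrite -edge_expect !inE eqxx.
move: hi hj; rewrite !inE => /orP[/eqP/perm_inj//|/eqP/perm_inj ij] /orP[/eqP/perm_inj//|/eqP/perm_inj ji].
(* What remains is one edge traversed in both directions: [i] and [j] are each the cyclic successor
   of the other, impossible for [3 <= n]. *)
move/(congr1 val): (ij); move/(congr1 val): (ji) => /= ji' ij'.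
exfalso; move: ji' ij' n3 (ltn_ord i) (ltn_ord j).
move: (nat_of_ord i) (nat_of_ord j) => a b; clear.
case: (ltnP a.+1 n) => [l1|l1]; case: (ltnP b.+1 n) => [l2|l2]; rewrite ?(modn_small l1) ?(modn_small l2); [lia| | |].
- move=> e1 e2 n3 an bn; have bE : b.+1 = n by lia.
  by move: e2; rewrite bE modnn; lia.
- move=> e1 e2 n3 an bn; have aE : a.+1 = n by lia.
  by move: e1; rewrite aE modnn; lia.
- move=> e1 e2 n3 an bn; have aE : a.+1 = n by lia.
  by move: e1; rewrite aE modnn; lia.
Qed.

Section Loop.
Variables (n c : nat) (Y0 : {set 'I_n}) (Ce Cb : {set 'I_c}) (d0 sg zz ff N0 ee : nat).
Notation out := (outcome n c).
Notation B := (@poor_set n c Y0 Ce d0).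
Notation hd := (@away_edges n c Y0 Ce d0).

(** A choice that depends on the revealed outcome [g] only, so that the boosters are determined
    before any hidden edge is inspected. The empty base is a default for outcomes that admit
    none. *)
Definition base_of (g : out) : base n :=
  match pselect (exists b, isbase Cb (B g) sg zz ff g b) with
  | left h => projT1 (cid h)
  | right _ => Base finset.set0 finset.set0 finset.set0 id (fun=> [::])
  end.

Definition curE (g h : out) := bE (base_of g) :|: supp h.

(** Restricted to edges whose true state is still open: they may be hidden, are seen as absent in
    [g], and are not recorded in [h]. *)
Definition boost_set (g h : out) : {set edge n} :=
  [set e | [&& e \in hd g, g e == None, h e == None &
     `[< boost (bio (base_of g)) (bZ (base_of g)) (adjE (curE g h)) (adjE (e |: curE g h)) >]]].

Definition forb_col (g h : out) : {set 'I_c} :=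
  [set k in Cb | [exists e in bE (base_of g), g e == Some k] || [exists e, h e == Some k]].

Hypothesis dis_eb : [disjoint Ce & Cb].

(** Poverty counts edges coloured from [Ce], while masking removes edges coloured from [Cb]. Hence
    the poor set can be read off the revealed outcome. *)
Lemma poor_set_masked f : B (masked Cb hd f) = B f.
Proof.
apply/setP => v; rewrite !inE; congr (_ < _); rewrite /cnt; apply: eq_card => e; rewrite !inE; congr (_ && _).
rewrite ffunE; case: ifP => // /andP[h _]; move: h; case: (f e) => [k|] //= kC.
by rewrite (disjointFl dis_eb kC).
Qed.

Lemma away_edges_masked f : hd (masked Cb hd f) = hd f.
Proof. by apply/setP => e; rewrite [LHS]in_set [RHS]in_set poor_set_masked. Qed.

Lemma poor_set_strip f : B f = B (strip Cb f).
Proof.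
apply/setP => v; rewrite !inE; congr (_ < _); rewrite /cnt; apply: eq_card => e; rewrite !inE; congr (_ && _).
rewrite ffunE; case: (f e) => [k|] //=; case: ifP => // kC.
by rewrite (disjointFl dis_eb kC).
Qed.

Lemma away_edges_strip f : hd f = hd (strip Cb f).
Proof. by apply/setP => e; rewrite [LHS]in_set [RHS]in_set -poor_set_strip. Qed.

(** All attained lengths are counted, so that any new length is progress. *)
Definition mlen (b : base n) (E : {set edge n}) :=
  #|[set i : 'I_n.+1 | `[< haslen (bio b) (bZ b) (adjE E) i >]]|.

Lemma haslen_mono (b : base n) (E E' : {set edge n}) i : E \subset E' ->
  haslen (bio b) (bZ b) (adjE E) i -> haslen (bio b) (bZ b) (adjE E') i.
Proof.
move=> /subsetP sub [s /andP[ok so] si]; exists s => //; rewrite /spath ok /=.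
apply: sub_sorted so => x y /existsP[e /andP[eE edge_expect]]; apply/existsP; exists e.
by rewrite sub.
Qed.

Lemma haslen_le (b : base n) (E : {set edge n}) i : haslen (bio b) (bZ b) (adjE E) i -> i <= #|bZ b|.
Proof.
case=> s /andP[/okpP[us _ Zs] _] <-; rewrite -(card_uniqP us).
by apply: subset_leq_card; apply/subsetP => x; exact: Zs.
Qed.

Lemma mlen_le (b : base n) E : mlen b E <= #|bZ b|.+1.
Proof.
rewrite /mlen -[leqRHS]card_ord.
pose g (i : 'I_n.+1) : 'I_(#|bZ b|.+1) := inord i.
rewrite -(card_in_imset (f := g)) ?max_card // => i j; rewrite !inE => /asboolP/haslen_le hi /asboolP/haslen_le hj.
by move/(congr1 val); rewrite /= !inordK // => ij; apply: val_inj.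
Qed.

Lemma mlen_gt0 (b : base n) E : 0 < mlen b E.
Proof. by apply/card_gt0P; exists ord0; rewrite inE; apply/asboolP; exists [::]. Qed.

Lemma mlen_lt (b : base n) (E E' : {set edge n}) i : E \subset E' -> haslen (bio b) (bZ b) (adjE E') i ->
  ~ haslen (bio b) (bZ b) (adjE E) i -> mlen b E < mlen b E'.
Proof.
move=> sub h' h; apply: proper_card; apply/properP; split.
  by apply/subsetP => j; rewrite !inE => /asboolP hj; apply/asboolP; exact: haslen_mono hj.
have lt : i < n.+1.
  by rewrite ltnS; apply: leq_trans (haslen_le h') _; rewrite -[leqRHS]card_ord max_card.
by exists (Ordinal lt); rewrite inE; [apply/asboolP|apply/asboolPn].
Qed.

Lemma base_finish f (b : base n) (E : {set edge n}) : 3 <= n -> isbase Cb (B f) sg zz ff (masked Cb hd f) b ->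
  bE b \subset E -> {in E, forall e, f e != None} -> {in E &, injective f} ->
  ham (bio b) (bZ b) (adjE E) -> has_rainbow_ham f.
Proof.
move=> n3 ib /subsetP sub Ep Ei hm.
have [q [uq cq vq]] : exists q, [/\ uniq q, cycle (adjE E) q & forall v, v \in q].
  refine (ham_expand (ul := bul b) (base_head ib) (base_last ib) _ (base_uniq ib) (base_rev ib)
    (base_disj ib) (base_cover ib) hm).
  - move=> z zZ; apply: sub_sorted (base_sorted ib zZ) => x y /existsP[e /andP[eE edge_expect]].
    by apply/existsP; exists e; rewrite sub.
exact: rainbow_ham_cycle Ep Ei uq cq vq.
Qed.

(* The edges added so far form [h]; each booster from [boost_set] whose colour is not in [forb_col] increases
   the number of attained lengths [mlen], which is at most [#|bZ b|.+1]. *)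
Lemma boost_loop f : 3 <= n -> (exists b, isbase Cb (B f) sg zz ff (masked Cb hd f) b) ->
  cnt finset.setT finset.setT f <= ee -> 2 * (N0 + ee + zz.+1) <= sg ^ 2 -> 0 < sg ->
  (forall h, {in supp h, forall e, [/\ f e = h e, coloured_in Cb (h e) & e \in hd f]} -> #|supp h| <= zz.+1 ->
     N0 <= #|boost_set (masked Cb hd f) h| ->
     exists2 e, e \in boost_set (masked Cb hd f) h & coloured_in (Cb :\: forb_col (masked Cb hd f) h) (f e)) ->
  has_rainbow_ham f.
Proof.
move=> n3 exb cE cN sg0 Hb; set g := masked Cb hd f in exb Hb.
have ib : isbase Cb (B f) sg zz ff g (base_of g).
  rewrite /base_of; case: pselect => [h|[]]; first by case: (cid h) => b /=; rewrite poor_set_masked.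
  by rewrite poor_set_masked.
have hdg : hd g = hd f by exact: away_edges_masked.
set b := base_of g in ib.
have gE e : e \in bE b -> g e = f e.
  by move=> eE; have := base_pres ib eE; rewrite /g ffunE; case: ifP.
(* The last clause keeps [#|supp h|] at most [zz + 1], the range in which boosters with fresh
   colours are guaranteed. *)
pose val_h (h : out) := {in supp h, forall e, [/\ f e = h e, coloured_in Cb (h e) & e \in hd f]} /\
  {in curE g h &, injective f} /\ #|supp h| < mlen b (curE g h).
have Ep h : val_h h -> {in curE g h, forall e, f e != None}.
  move=> [vh _] e; rewrite inE => /orP[eE|eh]; first by rewrite -gE //; exact: base_pres ib _ eE.
  by case: (vh _ eh) => -> _ _; move: eh; rewrite inE.
have sub0 h : bE b \subset curE g h by exact: subsetUl.
have v0 : val_h [ffun=> None].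
  have s0 : supp [ffun=> None : option 'I_c] = set0 :> {set edge n} by apply/setP => e; rewrite !inE ffunE.
  split; first by move=> e; rewrite s0 inE.
  split; last by rewrite s0 cards0 mlen_gt0.
  rewrite /curE s0 setU0 => e e' eE e'E; rewrite -!gE //; exact: (base_inj ib).
move: v0; move: [ffun=> None] => h vh.
have [N] := ubnP (zz.+1 - mlen b (curE g h)); elim: N h vh => // N IH h vh leN.
have [hm|nhm] := pselect (ham (bio b) (bZ b) (adjE (curE g h))).
  by apply: (base_finish n3 ib) hm; [exact: sub0|exact: Ep|case: vh => _ []].
have mle : mlen b (curE g h) <= zz.+1 by apply: leq_trans (mlen_le _ _) _; rewrite ltnS (base_zz ib).
have hle : #|supp h| <= zz.+1 by case: vh => _ [_ lt]; exact: leq_trans (ltnW lt) mle.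
have hexp : expanding (bZ b) (bY b) (adjE (curE g h)) sg.
  move=> S SZ Sc; apply: leq_trans (base_exp ib SZ Sc) _; apply: subset_leq_card; apply/subsetP => y.
  rewrite !inE => /andP[-> /existsP[z /andP[zS /existsP[e /andP[eE edge_expect]]]]] /=.
  by apply/existsP; exists z; rewrite zS; apply/existsP; exists e; rewrite (subsetP (sub0 h)).
have Zn : bZ b != set0.
  by have [z zZ _] := base_cover ib (Ordinal (leq_trans (isT : 0 < 3) n3)); apply/set0Pn; exists z.
have [A cA HA] := boosters (base_ioK ib) (base_ioZ ib) (base_ioY ib) (base_YZ ib) (@adjEC _ (curE g h)) hexp Zn nhm.
pose EA := [set e : edge n | [exists p in A, eset e == [set p.1; p.2]]].
have cEA : #|A| <= 2 * #|EA|.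
  pose sw (p : 'I_n * 'I_n) := (p.2, p.1).
  apply: (@leq_trans #|[set val e | e in EA] :|: [set sw (val e) | e in EA]|); last first.
    rewrite mul2n -addnn; apply: leq_trans (leq_card_setU _ _) _.
    by apply: leq_add; exact: leq_imset_card.
  apply: subset_leq_card; apply/subsetP => -[v w] pA; have [_ _ /eset_ex[e E] _] := HA _ pA.
  have eEA : e \in EA by rewrite inE; apply/existsP; exists (v, w); rewrite pA E /=.
  by rewrite inE; apply/orP; case: (eset_pairE E) => Ev; [left|right]; apply/imsetP; exists e; rewrite ?Ev.
have subEA : EA \subset boost_set g h :|: ([set e in setT | coloured_in setT (f e)] :|: supp h).
  apply/subsetP => e; rewrite in_set => /existsP[p /andP[pA /eqP E]].
  have [p1 p2 p12 Hp] := HA _ pA.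
  rewrite in_setU in_setU; case hn: (h e == None); last by rewrite orbC [e \in supp h]in_set hn orbT.
  case fn: (f e == None); last by rewrite [e \in [set _ in _ | _]]in_set in_setT; case: (f e) fn => [k|] //=; rewrite in_setT /= orbT.
  apply/orP; left; rewrite in_set hn hdg; apply/and4P; split => //.
  - rewrite in_set E; apply/disjP => v; rewrite in_set2 => /orP[]/eqP->.
      by have /disjP/(_ _ p1) := base_ZB ib.
    by have /disjP/(_ _ p2) := base_ZB ib.
  - by rewrite /g ffunE (eqP fn).
  - apply/asboolP; apply: Hp; first exact: adjEC.
      by move=> x y /existsP[e' /andP[e'E Ee']]; apply/existsP; exists e'; rewrite inE e'E orbT.
    by apply/existsP; exists e; rewrite !inE eqxx E eqxx.
(* Counting unordered pairs leaves at least [sg ^ 2 / 2] boosting edges; at most [ee] of them are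
   present in [f] and at most [zz + 1] belong to [h]. *)
have cb : N0 <= #|boost_set g h|.
  have l1 := leq_trans (subset_leq_card subEA) (leq_card_setU _ _).
  have l2 := (leq_card_setU [set e in [set: edge n] | coloured_in [set: 'I_c] (f e)] (supp h)).1.
  have l3 : #|[set e in [set: edge n] | coloured_in [set: 'I_c] (f e)]| <= ee := cE.
  have ar ea u a bs x y z2 sq N1 : sq <= a -> a <= 2 * ea -> ea <= bs + u -> u <= x + y -> x <= ee -> y <= z2 ->
    2 * (N1 + ee + z2) <= sq -> N1 <= bs by clear; lia.
  exact: ar cA cEA l1 l2 l3 hle cN.
have [e eA fe] := Hb h (proj1 vh) hle cb.
have := eA; rewrite in_set hdg => /and4P[ehd ge he /asboolP bst].
case E: (f e) fe => [k0|] //=; rewrite in_setD => /andP[nforb kC].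
pose h' : out := [ffun e' => if e' == e then f e else h e'].
have sh' : supp h' = e |: supp h.
  by apply/setP => e'; rewrite !inE ffunE; case: (e' =P e) => [->|_] //; rewrite E.
have cE' : curE g h' = e |: curE g h by rewrite /curE sh' setUCA.
have eNE : forall e', e' \in curE g h -> f e' <> Some k0.
  move=> e' e'E Ee'; case/negP: nforb; rewrite in_set kC /=; apply/orP.
  move: e'E; rewrite in_setU => /orP[e'E|e'h]; [left|right]; apply/existsP; exists e'.
    by rewrite e'E gE // Ee' eqxx.
  by case: (proj1 vh _ e'h) => <- _ _; rewrite Ee'.
have inj' : {in curE g h' &, injective f}.
  move=> e1 e2; rewrite cE' !in_setU1 => /orP[/eqP->|h1] /orP[/eqP->|h2] //.
  - by rewrite E => /esym/eNE; case.
  - by rewrite E => /eNE; case.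
  - by case: vh => _ [vi _]; exact: vi.
have vv' : {in supp h', forall e, [/\ f e = h' e, coloured_in Cb (h' e) & e \in hd f]}.
  move=> e'; rewrite sh' in_setU1 ffunE; case: (e' =P e) => [->|_] /=; first by rewrite E.
  exact: (proj1 vh).
case: bst => [hm|[i [hi nhi]]].
  apply: (base_finish n3 ib) hm; first by apply: subset_trans (sub0 h) _; exact: subsetUr.
    move=> e'; rewrite in_setU1 => /orP[/eqP->|]; first by rewrite E.
    exact: Ep.
  by rewrite -cE'.
have lt : mlen b (curE g h) < mlen b (curE g h').
  by rewrite cE'; apply: mlen_lt hi nhi; exact: subsetUr.
apply: (IH h').
  split => //; split => //; apply: leq_ltn_trans lt; rewrite sh'.
  apply: leq_trans (proj2 (proj2 vh)); rewrite cardsU1.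
  by case: (e \in supp h); rewrite /= ?add0n ?add1n ?leqnSn.
apply: leq_trans (_ : zz.+1 - mlen b (curE g h) <= _); last by rewrite -ltnS.
have mle' : mlen b (curE g h') <= zz.+1 by apply: leq_trans (mlen_le _ _) _; rewrite ltnS (base_zz ib).
by apply: ltn_sub2l => //; exact: leq_trans lt mle'.
Qed.

End Loop.

(** * Patterns around poor and small vertices *)

Section Cfg.
Variables (n c : nat) (Y0 : {set 'I_n}) (Ce : {set 'I_c}) (d0 th0 k : nat).
Notation out := (outcome n c).
Notation B := (poor_set Y0 Ce d0).
Notation SM := (small_set th0).

(* The poor vertices [pR] and the small vertices [pS], all in the small set [pW], together with the edges
   [pM] inside [pW], the edge [e] satisfying [pQ e]. *)
Record pattern := Pattern { pW : {set 'I_n}; pR : {set 'I_n}; pS : {set 'I_n}; pM : {set edge n};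
  pQ : edge n -> pred (option 'I_c) }.

(** A tuple of vertices may contain repetitions: only the numbers of distinct edges, poor vertices
    and small vertices enter the probability, and these are prescribed here. *)
Definition pattern_ok (mm r s : nat) (t : pattern) :=
  [&& pR t \subset pW t, pS t \subset pW t, [disjoint pR t & pS t], pM t \subset inside (pW t),
      #|pM t| == mm, #|pR t| == r & #|pS t| == s].

Definition pattern_in (f : out) (t : pattern) :=
  [&& [forall (e | e \in pM t), pQ t e (f e)], pR t \subset B f & pS t \subset SM f].

Definition pattern_event (T : finType) (pt : T -> pattern) mm r s (f : out) :=
  [exists t : T, pattern_ok mm r s (pt t) && pattern_in f (pt t)].

Definition edges_joining (v x : 'I_n) : {set edge n} := [set e | eset e == [set v; x]].
Definition present (o : option 'I_c) := o != None.

Lemma edges_joining_set e v x : eset e = [set v; x] -> edges_joining v x = [set e].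
Proof.
move=> E; apply/setP => e'; rewrite !inE; apply/eqP/eqP => [E'|->//].
by apply: eset_inj; rewrite E E'.
Qed.

Definition ffun_image (b : {ffun 'I_k -> 'I_n}) : {set 'I_n} := [set b i | i : 'I_k].

Definition star_pattern (t : 'I_n * {ffun 'I_k -> 'I_n}) :=
  Pattern (t.1 |: ffun_image t.2) (ffun_image t.2) set0 (star t.1 (ffun_image t.2)) (fun=> present).

Definition matched (x b : {ffun 'I_k -> 'I_n}) : {set edge n} := [set e | [exists i, eset e == [set x i; b i]]].

Definition spider_pattern (t : 'I_n * {ffun 'I_k -> 'I_n} * {ffun 'I_k -> 'I_n}) :=
  Pattern (t.1.1 |: (ffun_image t.1.2 :|: ffun_image t.2)) (ffun_image t.2) set0
    (star t.1.1 (ffun_image t.1.2) :|: matched t.1.2 t.2) (fun=> present).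

Definition small_poor_edge (t : 'I_n * 'I_n) :=
  Pattern [set t.1; t.2] [set t.2] [set t.1] (edges_joining t.1 t.2) (fun=> present).

Definition small_poor_path (t : 'I_n * 'I_n * 'I_n) :=
  Pattern [set t.1.1; t.1.2; t.2] [set t.2] [set t.1.1] (edges_joining t.1.1 t.1.2 :|: edges_joining t.1.2 t.2) (fun=> present).

Definition col (k0 : 'I_c) (o : option 'I_c) := o == Some k0.

Definition repeat_at_one (t : 'I_n * 'I_n * 'I_n * 'I_c) :=
  let: (v, x1, x2, k0) := t in
  Pattern [set v; x1; x2] set0 [set v] (edges_joining v x1 :|: edges_joining v x2) (fun=> col k0).

Definition repeat_at_two (t : 'I_n * 'I_n * 'I_n * 'I_n * 'I_c) :=
  let: (v1, x1, v2, x2, k0) := t in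
  Pattern [set v1; x1; v2; x2] set0 [set v1; v2] (edges_joining v1 x1 :|: edges_joining v2 x2) (fun=> col k0).

(** A vertex [z] with two colours, each repeated on an edge at a small vertex. The first two edges
    must have colour [k1], the others [k2]. *)
Definition share_at_two (t : 'I_n * 'I_n * 'I_n * 'I_n * 'I_n * 'I_n * 'I_n * 'I_c * 'I_c) :=
  let: (z, x1, x2, v1, w1, v2, w2, k1, k2) := t in
  Pattern [set z; x1; x2; v1; w1; v2; w2] set0 [set v1; v2]
    ((edges_joining z x1 :|: edges_joining v1 w1) :|: (edges_joining z x2 :|: edges_joining v2 w2))
    (fun e => if e \in edges_joining z x1 :|: edges_joining v1 w1 then col k1 else col k2).

Definition share_at_one (t : 'I_n * 'I_n * 'I_n * 'I_n * 'I_n * 'I_n * 'I_c * 'I_c) :=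
  let: (z, x1, x2, v, w1, w2, k1, k2) := t in share_at_two (z, x1, x2, v, w1, v, w2, k1, k2).

Variable f : out.

Lemma disj0 (A : {set 'I_n}) : [disjoint A & set0] = true.
Proof. by rewrite -setI_eq0 setI0 eqxx. Qed.

Lemma ffun_inj_ex (A : {set 'I_n}) : k <= #|A| ->
  exists b : {ffun 'I_k -> 'I_n}, injective b /\ ffun_image b \subset A.
Proof.
move=> le; exists [ffun i => enum_val (widen_ord le i)]; split.
  by move=> i j; rewrite !ffunE => /enum_val_inj /(congr1 val) /= ij; apply: val_inj.
by apply/subsetP => x /imsetP[i _ ->]; rewrite ffunE; exact: enum_valP.
Qed.

Lemma card_ffun_image (b : {ffun 'I_k -> 'I_n}) : injective b -> #|ffun_image b| = k.
Proof. by move=> bi; rewrite card_imset // card_ord. Qed.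

Lemma few_poor_neighbours z : ~~ pattern_event star_pattern k k 0 f -> #|[set x in B f | adj f z x]| <= k.
Proof.
move=> nA; rewrite leqNgt; apply/negP => /ltnW /ffun_inj_ex[b [bi /subsetP bA]].
case/negP: nA; apply/existsP; exists (z, b).
have zb : z \notin ffun_image b.
  by apply/negP => /bA; rewrite inE => /andP[_]; rewrite /adj ecol_diag.
apply/andP; split.
  rewrite /pattern_ok /= subsetUr sub0set disj0 card_star // card_ffun_image // cards0 !eqxx !andbT.
  apply/subsetP => e /starP[y yb E]; rewrite inE E subUset !sub1set !inE eqxx /=.
  by rewrite yb orbT.
rewrite /pattern_in /= sub0set andbT; apply/andP; split.
  apply/forallP => e; apply/implyP => /starP[y /bA yA E]; rewrite /present -(ecol_edge f E).
  by move: yA; rewrite inE => /andP[].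
by apply/subsetP => y /bA; rewrite inE => /andP[].
Qed.

Lemma card_matched (x b : {ffun 'I_k -> 'I_n}) : injective x -> injective b ->
  (forall i j, x i != b j) -> #|matched x b| = k.
Proof.
move=> xi bi xb; have ex i : exists e, eset e == [set x i; b i].
  by have [e E] := eset_ex (xb i i); exists e; rewrite E.
pose g i := xchoose (ex i); have gE i : eset (g i) = [set x i; b i] by apply/eqP; exact: (xchooseP (ex i)).
have gi : injective g.
  move=> i j gij; have : x i \in [set x j; b j] by rewrite -gE -gij gE !inE eqxx.
  by rewrite !inE (negPf (xb _ _)) orbF => /eqP/xi.
rewrite -[RHS]card_ord -(card_imset _ gi); apply: eq_card => e; rewrite inE.
apply/existsP/imsetP => [[i /eqP E]|[i _ ->]]; last by exists i; rewrite gE.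
by exists i => //; apply: eset_inj; rewrite gE E.
Qed.

(** Many such neighbours might hang on few poor vertices. However, [k + 1] of them, with one poor
    vertex each, span together with [z] at least [2 * (k + 1)] edges on [k + 2] vertices and the
    poor ones. Sparsity of small sets forces at least [k] different poor vertices, which yields a
    spider. *)
Lemma few_poor_second_neighbours z : ~~ pattern_event spider_pattern (2 * k) k 0 f ->
  (forall U : {set 'I_n}, 0 < #|U| <= 2 * k + 3 -> cnt setT (inside U) f <= #|U|) ->
  #|[set x | [&& adj f z x, x \notin B f & [exists b in B f, (b != z) && adj f x b]]]| <= k.
Proof.
move=> nA sp; rewrite leqNgt; apply/negP; set X := [set x | _] => lt.
pose Xs := [set x in take k.+1 (enum X)].
have cX : #|Xs| = k.+1 by exact: card_take.
have XsX x : x \in Xs -> [/\ adj f z x, x \notin B f & exists2 b, b \in B f & (b != z) && adj f x b].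
  move/(subsetP (take_sub _ _)); rewrite inE => /and3P[h1 h2 /existsP[b /andP[h3 h4]]]; split => //.
  by exists b.
pose bx x := odflt z [pick b in B f | (b != z) && adj f x b].
have bxP x : x \in Xs -> [/\ bx x \in B f, bx x != z & adj f x (bx x)].
  case/XsX => _ _ [b bB h]; rewrite /bx; case: pickP => [b' /andP[h1 /andP[h2 h3]]|/(_ b)] //=.
  by rewrite bB h.
pose Bs := bx @: Xs; pose U := z |: (Xs :|: Bs).
have zX : z \notin Xs by apply/negP => /XsX[]; rewrite /adj ecol_diag.
have zB : z \notin Bs by apply/negP => /imsetP[x /bxP[_ h _] E]; rewrite -E eqxx in h.
have XB x : x \in Xs -> x \notin Bs.
  by move=> /XsX[_ nB _]; apply/negP => /imsetP[y /bxP[h _ _] E]; rewrite E h in nB.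
have U0 : 0 < #|U| <= 2 * k + 3.
  rewrite cardsU1 inE negb_or zX zB /= add1n /=.
  have l1 := (leq_card_setU Xs Bs).1; have l2 : #|Bs| <= #|Xs| by exact: leq_imset_card.
  have ar a b s x : s <= a + b -> b <= a -> a = x.+1 -> s < 2 * x + 3 by clear; lia.
  exact: ar l1 l2 cX.
have cU : #|U| <= k.+2 + #|Bs|.
  by rewrite cardsU1 inE negb_or zX zB add1n addSn ltnS -cX; exact: (leq_card_setU Xs Bs).1.
have e1P x : x \in Xs -> exists e, eset e == [set z; x].
  by case/XsX => /ecol_ex[e E] _ _; exists e; rewrite E.
have e2P x : x \in Xs -> exists e, eset e == [set x; bx x].
  by case/bxP => _ _ /ecol_ex[e E]; exists e; rewrite E.
have h1 : #|Xs| + #|Xs| <= cnt setT (inside U) f.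
  pose M1 := star z Xs; pose M2 := [set e | [exists x in Xs, eset e == [set x; bx x]]].
  have c1 : #|M1| = #|Xs| by exact: card_star.
  have c2 : #|Xs| <= #|M2|.
    apply: (@leq_trans #|[set eset e | e in M2]|); last exact: leq_imset_card.
    pose g x := [set x; bx x].
    rewrite -(card_in_imset (f := g)); last first.
      move=> x y xX yX /= E; have : x \in g y by rewrite -E !inE eqxx.
      rewrite !inE => /orP[/eqP//|/eqP xb]; have := XB _ xX.
      by rewrite xb imset_f.
    apply: subset_leq_card; apply/subsetP => _ /imsetP[x xX ->].
    have [e /eqP E] := e2P _ xX; apply/imsetP; exists e => //.
    by rewrite inE; apply/existsP; exists x; rewrite xX E /=.
  have dM : [disjoint M1 & M2].
    apply/disjP => e /starP[y yX E]; rewrite inE; apply/existsP => -[x /andP[xX /eqP E']].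
    have : z \in [set x; bx x] by rewrite -E' E !inE eqxx.
    rewrite !inE => /orP[/eqP zx|/eqP zb]; first by rewrite zx xX in zX.
    by case/negP: zB; rewrite zb imset_f.
  rewrite -{1}c1; apply: leq_trans (leq_add (leqnn _) c2) _.
  have /eqP <- : #|M1 :|: M2| == #|M1| + #|M2| by rewrite (leq_card_setU M1 M2).2.
  apply: subset_leq_card; apply/subsetP => e; rewrite inE => /orP[/starP[x xX E]|].
    apply/setIdP; split; last by rewrite -(ecol_edge f E); have [h _ _] := XsX _ xX; move: h; rewrite /adj; case: (ecol f z x) => [j|] //=; rewrite inE.
    by rewrite inE E subUset !sub1set !in_setU1 eqxx !in_setU xX orbT.
  rewrite inE => /existsP[x /andP[xX /eqP E]]; apply/setIdP; split.
    by rewrite inE E subUset !sub1set !in_setU1 !in_setU xX imset_f // !orbT.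
  by rewrite -(ecol_edge f E); have [_ _ h] := bxP _ xX; move: h; rewrite /adj; case: (ecol f x _) => [j|] //=; rewrite inE.
have cB : k <= #|Bs|.
  have := leq_trans h1 (sp U U0) => h2; move: (leq_trans h2 cU); rewrite cX.
  by rewrite addnS -addSn leq_add2l.
have [b [bi /subsetP bB]] := ffun_inj_ex cB.
have bpre i : exists x, (x \in Xs) && (bx x == b i).
  have /imsetP[x xX E] : b i \in Bs by apply: bB; apply: imset_f.
  by exists x; rewrite xX E eqxx.
pose x := [ffun i => xchoose (bpre i)].
have xP i : x i \in Xs /\ bx (x i) = b i by rewrite ffunE; have /andP[h /eqP] := xchooseP (bpre i).
have xi : injective x by move=> i j xij; apply: bi; rewrite -(xP i).2 -(xP j).2 xij.
have imX w : w \in ffun_image x -> w \in Xs by case/imsetP => i _ ->; exact: (xP i).1.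
have nxb i j : x i != b j.
  by apply: contraNneq (XB _ (xP i).1) => ->; rewrite -(xP j).2 imset_f //; exact: (xP j).1.
case/negP: nA; apply/existsP; exists (z, x, b); apply/andP; split.
  rewrite /pattern_ok /= sub0set disj0 card_ffun_image // cards0 !eqxx !andbT /=.
  have -> : ffun_image b \subset z |: (ffun_image x :|: ffun_image b) by apply/subsetP => w wb; rewrite !in_setU wb !orbT.
  rewrite /=; apply/andP; split.
    apply/subsetP => e; rewrite in_setU => /orP[/starP[y yx E]|].
      by rewrite inE E subUset !sub1set !in_setU1 eqxx !in_setU yx orbT.
    rewrite inE => /existsP[i /eqP E].
    by rewrite inE E subUset !sub1set !in_setU1 !in_setU !imset_f ?inE // !orbT.
  have -> : #|star z (ffun_image x) :|: matched x b| = #|star z (ffun_image x)| + #|matched x b|.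
    apply/eqP; rewrite (leq_card_setU _ _).2; apply/disjP => e /starP[y yx E]; rewrite inE.
    apply/existsP => -[i /eqP E']; have : z \in [set x i; b i] by rewrite -E' E !inE eqxx.
    rewrite !inE => /orP[/eqP zx|/eqP zb]; first by rewrite zx (xP i).1 in zX.
    by case/negP: zB; rewrite zb -(xP i).2 imset_f //; exact: (xP i).1.
  rewrite card_matched // card_star ?card_ffun_image // ?addnn ?mul2n //.
  by apply: contraNN zX; exact: imX.
rewrite /pattern_in /= sub0set andbT; apply/andP; split; last first.
  by apply/subsetP => _ /imsetP[i _ ->]; rewrite -(xP i).2; have [] := bxP _ (xP i).1.
apply/forallP => e; apply/implyP; rewrite in_setU => /orP[/starP[y /imX yX E]|].
  by rewrite /present -(ecol_edge f E); have [] := XsX _ yX.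
rewrite inE => /existsP[i /eqP E]; rewrite /present -(ecol_edge f E) -(xP i).2.
by have [] := bxP _ (xP i).1.
Qed.

Lemma touches_ex (S : {set 'I_n}) e : touches S e -> exists v x, [/\ v \in S, v != x & eset e = [set v; x]].
Proof.
case/pred0Pn => v /andP[ve vS].
have : eset e = eset e by []; rewrite {2}/eset => E; have ne := eset_neq E.
move: ve; rewrite E !inE => /orP[]/eqP ev; subst v.
  by exists (val e).1, (val e).2.
by exists (val e).2, (val e).1; rewrite eq_sym ne setUC.
Qed.

Lemma small_far_from_poor : ~~ pattern_event small_poor_edge 1 1 1 f -> ~~ pattern_event small_poor_path 2 1 1 f ->
  forall v b, v \in SM f -> b \in B f -> b != v -> ~~ adj f v b /\ forall x, adj f v x -> ~~ adj f x b.
Proof.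
move=> na nb v b vS bB bv; split.
  apply: contra na => vb; have [e E] := ecol_ex vb; apply/existsP; exists (v, b); apply/andP; split.
    rewrite /pattern_ok /= (edges_joining_set E) !sub1set !cards1 !in_set2 !eqxx orbT !andbT /=.
    by rewrite disjoints1 in_set1 bv inE E subxx.
  rewrite /pattern_in /= !sub1set vS bB !andbT; apply/forallP => e'; apply/implyP; rewrite (edges_joining_set E) in_set1 => /eqP->.
  by rewrite /present -(ecol_edge f E).
move=> x vx; apply: contra nb => xb; have [e E] := ecol_ex vx; have [e' E'] := ecol_ex xb.
have ee : e != e'.
  apply: contraNneq bv => ee; have : b \in [set v; x] by rewrite -E ee E' !inE eqxx orbT.
  by rewrite !inE => /orP[//|/eqP bx]; have := eset_neq E'; rewrite bx eqxx.
apply/existsP; exists (v, x, b); apply/andP; split.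
  rewrite /pattern_ok /= (edges_joining_set E) (edges_joining_set E') !sub1set !cards1 cards2 ee !in_setU !in_set1 !eqxx ?orbT !andbT /=.
  rewrite disjoints1 in_set1 bv /= subUset !sub1set !inE E E' !subUset !sub1set !in_setU !in_set1 !eqxx ?orbT //.
rewrite /pattern_in /= !sub1set vS bB !andbT; apply/forallP => e0; apply/implyP.
rewrite (edges_joining_set E) (edges_joining_set E') !in_setU !in_set1 => /orP[]/eqP->.
  by rewrite /present -(ecol_edge f E).
by rewrite /present -(ecol_edge f E').
Qed.

(** Two different edges of one colour that touch small vertices do so at a common small vertex or at
    two different ones, which gives the two patterns. *)
Lemma small_colours_distinct : ~~ pattern_event repeat_at_one 2 0 1 f -> ~~ pattern_event repeat_at_two 2 0 2 f ->
  forall e1 e2, touches (SM f) e1 -> touches (SM f) e2 -> f e1 != None -> f e1 = f e2 -> e1 = e2.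
Proof.
move=> na nb e1 e2 /touches_ex[v1 [x1 [v1S n1 E1]]] /touches_ex[v2 [x2 [v2S n2 E2]]].
case F1: (f e1) => [k0|//] _ F2; symmetry in F2.
apply/eqP/negPn/negP => ne.
have QQ : [forall (e | e \in [set e1] :|: [set e2]), col k0 (f e)].
  by apply/forallP => e; apply/implyP; rewrite !in_setU !in_set1 => /orP[]/eqP->; rewrite /col ?F1 ?F2.
have [vv|vv] := eqVneq v1 v2.
  case/negP: na; subst v2; apply/existsP; exists (v1, x1, x2, k0); apply/andP; split.
    rewrite /pattern_ok /= (edges_joining_set E1) (edges_joining_set E2) sub0set !sub1set cards1 cards0 cards2 ne !eqxx !andbT.
    by rewrite disjoint_sym disj0 subUset !sub1set !inE E1 E2 !subUset !sub1set !in_setU !in_set1 !eqxx ?orbT.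
  by rewrite /pattern_in /= sub0set sub1set v1S (edges_joining_set E1) (edges_joining_set E2) QQ.
case/negP: nb; apply/existsP; exists (v1, x1, v2, x2, k0); apply/andP; split.
  rewrite /pattern_ok /= (edges_joining_set E1) (edges_joining_set E2) sub0set subUset !sub1set cards0 !cards2 ne vv !eqxx !andbT.
  by rewrite disjoint_sym disj0 subUset !sub1set !inE E1 E2 !subUset !sub1set !in_setU !in_set1 !eqxx ?orbT.
by rewrite /pattern_in /= sub0set subUset !sub1set v1S v2S (edges_joining_set E1) (edges_joining_set E2) QQ.
Qed.

Lemma small_colours_shared : ~~ pattern_event share_at_one 4 0 1 f -> ~~ pattern_event share_at_two 4 0 2 f ->
  forall z k1 k2, shared f (SM f) z k1 -> shared f (SM f) z k2 -> k1 = k2.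
Proof.
move=> na nb z k1 k2 /existsP[x1 /existsP[e1 /and4P[t1 n1 /eqP F1 /eqP G1]]].
move=> /existsP[x2 /existsP[e2 /and4P[t2 n2 /eqP F2 /eqP G2]]]; apply/eqP/negPn/negP => kk.
have [v1 [w1 [v1S m1 E1]]] := touches_ex t1; have [v2 [w2 [v2S m2 E2]]] := touches_ex t2.
have [|d1 D1] := @ecol_ex _ _ f z x1; first by rewrite G1.
have [|d2 D2] := @ecol_ex _ _ f z x2; first by rewrite G2.
have Fd1 : f d1 = Some k1 by rewrite -(ecol_edge f D1).
have Fd2 : f d2 = Some k2 by rewrite -(ecol_edge f D2).
have a1 : d1 != e1 by apply: contraNneq n1 => <-; rewrite D1.
have a2 : d2 != e2 by apply: contraNneq n2 => <-; rewrite D2.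
have diffc e e' : f e = Some k1 -> f e' = Some k2 -> (e == e') = false.
  by move=> h h'; apply/eqP => E; case: (Some k1 =P Some k2) => [[]|[]]; [apply/eqP|rewrite -h -h' E].
have c4 : #|[set d1; e1] :|: [set d2; e2]| = 4.
  have := (leq_card_setU [set d1; e1] [set d2; e2]).2; rewrite !cards2 a1 a2 => /esym h; apply/eqP; rewrite -h.
  by apply/disjP => e; rewrite !in_set2 => /orP[]/eqP->; rewrite !diffc.
have QQ : [forall (e | e \in [set d1; e1] :|: [set d2; e2]),
    (if e \in [set d1; e1] then col k1 else col k2) (f e)].
  apply/forallP => e; apply/implyP; rewrite in_setU; case: ifP => [|_] /=.
    by rewrite in_set2 => /orP[]/eqP->; rewrite /col ?F1 ?Fd1.
  by rewrite in_set2 => /orP[]/eqP->; rewrite /col ?F2 ?Fd2.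
have sub v' w' : eset e2 = [set v'; w'] ->
    [set d1; e1] :|: [set d2; e2] \subset inside [set z; x1; x2; v1; w1; v'; w'].
  move=> E2'; rewrite !subUset !sub1set !inE D1 D2 E1 E2' !subUset !sub1set !in_setU !in_set1 !eqxx ?orbT //.
have [vv|vv] := eqVneq v1 v2.
  case/negP: na; subst v2; apply/existsP; exists (z, x1, x2, v1, w1, w2, k1, k2); apply/andP; split.
    rewrite /pattern_ok /= (edges_joining_set E1) (edges_joining_set E2) (edges_joining_set D1) (edges_joining_set D2) setUid c4 sub0set !sub1set cards0 cards1 !eqxx !andbT.
    by rewrite disjoint_sym disj0 sub // !in_setU !in_set1 !eqxx ?orbT.
  by rewrite /pattern_in /= sub0set setUid sub1set v1S (edges_joining_set E1) (edges_joining_set E2) (edges_joining_set D1) (edges_joining_set D2) QQ.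
case/negP: nb; apply/existsP; exists (z, x1, x2, v1, w1, v2, w2, k1, k2); apply/andP; split.
  rewrite /pattern_ok /= (edges_joining_set E1) (edges_joining_set E2) (edges_joining_set D1) (edges_joining_set D2) c4 sub0set subUset !sub1set cards0 cards2 vv !eqxx !andbT.
  by rewrite disjoint_sym disj0 sub // !in_setU !in_set1 !eqxx ?orbT.
by rewrite /pattern_in /= sub0set subUset !sub1set v1S v2S (edges_joining_set E1) (edges_joining_set E2) (edges_joining_set D1) (edges_joining_set D2) QQ.
Qed.

End Cfg.

(** * Typical outcomes *)

Section Events.
Variables (n c : nat).
Notation out := (outcome n c).

Definition colour_dense (Yh : {set 'I_n}) (j mu smax : nat) : pred out :=
  fun f => [exists S : {set 'I_n}, [exists K : {set 'I_c},
    [&& (0 < #|S| <= smax), (#|K| <= j * #|S|) & (mu * #|S| <= cnt K (between S Yh) f)]]].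

Definition crowded (m : nat -> nat) umax : pred out := fun f =>
  [exists U : {set 'I_n}, (0 < #|U| <= umax) && (m #|U| <= cnt setT (inside U) f)].

Definition unlinked (m q : nat) : pred out := fun f =>
  [exists A1 : {set 'I_n}, [exists A2 : {set 'I_n}, [exists K : {set 'I_c},
    [&& (m <= #|A1|), (m <= #|A2|), [disjoint A1 & A2], (q <= #|K|) & cnt K (between A1 A2) f == 0]]]].

End Events.

(** * Outcomes outside all bad events have a rainbow Hamilton cycle *)

Section Good.
Variables (n c : nat) (Y0 : {set 'I_n}) (Cm Ce Cb : {set 'I_c}).
Variables (d0 k th0 th1 Dd m q sg s6 s7 mu6 mu7 bb N0 ee : nat).
Notation out := (outcome n c).
Hypotheses (n3 : 3 <= n) (dis_me : [disjoint Cm & Ce]) (dis_mb : [disjoint Cm & Cb]) (dis_eb : [disjoint Ce & Cb]).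
Hypotheses (th0d0 : th0 <= d0) (th01 : th1 + 2 * k <= th0) (th1_2 : 2 <= th1).
Hypotheses (mu6P : 2 * mu6 <= th1) (s6P : bb <= s6) (mu7P : 2 * mu7 <= d0 - 2 * k).
Hypothesis card_Cm : n + q + th1 * bb <= #|Cm|.
Hypothesis s7P : #|Y0| + th1 * bb + 4 * m <= s7.
Hypotheses (sg0 : 0 < sg) (sgP : 2 * (N0 + ee + s7.+1) <= sg ^ 2).

Definition low_degree (f : out) := [exists v, cnt setT (star v setT) f <= 1].
Definition unboosted (f : out) := [exists h : out, (#|supp h| <= s7.+1) &&
  mask_event Cb (away_edges Y0 Ce d0) (boost_set Y0 Ce Cb d0 sg s7 (th1 * bb))
    (forb_col Y0 Ce Cb d0 sg s7 (th1 * bb)) N0 h f].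

Definition bad_events : seq (pred out) :=
  [:: fun f => bb < #|poor_set Y0 Ce d0 f|;
      pattern_event Y0 Ce d0 th0 (@star_pattern n c k) k k 0;
      pattern_event Y0 Ce d0 th0 (@spider_pattern n c k) (2 * k) k 0;
      crowded S (2 * k + 3);
      pattern_event Y0 Ce d0 th0 (@small_poor_edge n c) 1 1 1;
      pattern_event Y0 Ce d0 th0 (@small_poor_path n c) 2 1 1;
      low_degree;
      pattern_event Y0 Ce d0 th0 (@repeat_at_one n c) 2 0 1;
      pattern_event Y0 Ce d0 th0 (@repeat_at_two n c) 2 0 2;
      pattern_event Y0 Ce d0 th0 (@share_at_one n c) 4 0 1;
      pattern_event Y0 Ce d0 th0 (@share_at_two n c) 4 0 2;
      colour_dense setT 5 mu6 s6;
      colour_dense Y0 (6 * Dd + 1) mu7 s7;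
      crowded (fun u => Dd * u) (3 * sg);
      unlinked m q;
      fun f => ee <= cnt setT setT f;
      unboosted].

Lemma good_rainbow_ham f : ~~ has (fun A : pred out => A f) bad_events -> has_rainbow_ham f.
Proof.
rewrite /bad_events /= !negb_or => /and5P[b1 b2 b3 b4 /and5P[b5 b6 b7 b8 /and5P[b9 b10 b11 b12 /and5P[b13 b14 b15 b16 /andP[b17 _]]]]].
have base : exists b, isbase Cb (poor_set Y0 Ce d0 f) sg s7 (th1 * bb) (masked Cb (away_edges Y0 Ce d0) f) b.
  (* The values [3 * Dd], [4 * mu6] and [4 * mu7] cancel the factors [3] and [4] in front of the
     counts in the hypotheses of the construction. *)
  apply: (@exists_base n c f Y0 Cm Ce Cb d0 k th0 th1 (3 * Dd) m q sg s6 s7 (4 * mu6) (4 * mu7) bb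
     (poor_set Y0 Ce d0 f) (small_set th0 f)) => //.
  - by move=> v; rewrite inE.
  - by move=> v; rewrite inE.
  - by rewrite leqNgt.
  - by move=> z; exact: few_poor_neighbours b2.
  - move=> z; apply: few_poor_second_neighbours b3 _ => U U0; rewrite leqNgt; apply: contra b4 => h.
    by apply/existsP; exists U; rewrite U0.
  - exact: small_far_from_poor b5 b6.
  - move=> v; rewrite ltnNge; apply: contra b7 => h; by apply/existsP; exists v.
  - exact: small_colours_distinct b8 b9.
  - exact: small_colours_shared b10 b11.
  - move=> S K S0 K0; rewrite -mulnA ltn_pmul2l // ltnNge; apply: contra b12 => h.
    by apply/existsP; exists S; apply/existsP; exists K; rewrite S0 K0.
  - by move: mu6P; clear; lia.
  - move=> S K S0 K0; rewrite -mulnA ltn_pmul2l // ltnNge; apply: contra b13 => h.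
    apply/existsP; exists S; apply/existsP; exists K; rewrite S0 h andbT.
    by move: K0; rewrite mulnA.
  - by move: mu7P; clear; lia.
  - move=> U U0; rewrite -mulnA ltn_pmul2l // ltnNge; apply: contra b14 => h.
    by apply/existsP; exists U; rewrite U0.
  - move=> A1 A2 K h1 h2 d12 KC hK.
    have : cnt K (between A1 A2) f != 0.
      apply: contra b15 => h; apply/existsP; exists A1; apply/existsP; exists A2; apply/existsP; exists K.
      by rewrite h1 h2 d12 hK h.
    rewrite -lt0n => /card_gt0P[e]; rewrite inE => /andP[/betweenP[a [b [aA bA E]]] eK].
    by exists a, b; rewrite (ecol_edge f E).
  - by move=> e; rewrite inE.
have L := @boost_loop n c Y0 Ce Cb d0 sg s7 (th1 * bb) N0 ee dis_eb f n3 base. apply: L => //.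
  by apply: ltnW; rewrite ltnNge.
move=> h hh sh N0h; move: b17; rewrite /unboosted negb_exists => /forallP/(_ h).
rewrite sh /= /mask_event N0h /= negb_and.
have -> /= : [forall (e | e \in supp h), [&& f e == h e, coloured_in Cb (h e) & e \in away_edges Y0 Ce d0 f]].
  by apply/forallP => e; apply/implyP => /hh[-> -> ->]; rewrite eqxx.
rewrite negb_forall => /existsP[e]; rewrite negb_imply negbK => /andP[h1 h2].
by exists e.
Qed.

End Good.

From mathcomp Require Import all_classical all_reals all_analysis.
From mathcomp Require Import lra ring.
Import Order.TTheory GRing.Theory Num.Theory.
Import numFieldNormedType.Exports.
Local Open Scope ring_scope.

(** * Powers and exponentials *)

Section Num.
Variables (R : realType) (L : R).
Hypothesis L3 : 1000 <= L.

Lemma L_gt0 : 0 < L. Proof. by move: L3; lra. Qed.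
Lemma L_ge1 : 1 <= L. Proof. by move: L3; lra. Qed.
Lemma Lp_gt0 a : 0 < L ^+ a. Proof. by rewrite exprn_gt0 // L_gt0. Qed.
Lemma Lp_ge1 a : 1 <= L ^+ a. Proof. by rewrite exprn_ege1 // L_ge1. Qed.

(** All later estimates rest on this: a larger exponent of [L] absorbs any constant up to [1000]. *)
Lemma Lp_lt a b : (a < b)%N -> 1000 * L ^+ a <= L ^+ b.
Proof.
move=> ab; apply: (@le_trans _ _ (L ^+ a.+1)); last by rewrite ler_weXn2l // L_ge1.
by rewrite exprS ler_wpM2r // ltW // Lp_gt0.
Qed.

Lemma expRhalf_le2 : expR (2^-1) <= 2 :> R.
Proof.
rewrite -[leLHS]invrK -[leRHS]invrK lef_pV2 ?posrE ?invr_gt0 ?expR_gt0 // -expRN.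
by apply: le_trans (expR_ge1Dx _); lra.
Qed.

Lemma expR1_le4 : expR 1 <= 4 :> R.
Proof.
have h := expRhalf_le2; have e0 := expR_gt0 (2^-1 : R).
have -> : expR 1 = expR (2^-1) * expR (2^-1) :> R by rewrite -expRD; congr expR; lra.
by apply: (@le_trans _ _ (2 * 2)); [apply: ler_pM => //; exact: ltW|lra].
Qed.

Lemma Lp_exp a : L ^+ a <= expR (a%:R * L).
Proof.
rewrite mulrC expRM_natr lerXn2r ?nnegrE ?expR_ge0 ?(ltW L_gt0) //.
by apply: le_trans (expR_ge1Dx L); rewrite lerDr.
Qed.

End Num.

(** * Expectations over independent edges *)

Section Prob.
Variables (R : realType) (n c : nat) (p : R).
Hypotheses (p01 : 0 <= p <= 1) (c0 : (0 < c)%N).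
Notation out := (outcome n c).
Implicit Types (f : out) (A B : pred out) (K : {set 'I_c}) (M : {set edge n}).

Definition edge_weight (o : option 'I_c) : R := if o is Some _ then p / c%:R else 1 - p.
Definition edge_expect (phi : option 'I_c -> R) := \sum_o edge_weight o * phi o.
Definition expect (X : out -> R) := \sum_f Gc_weight p f * X f.
Notation P := (@Gc_prob R n c p).

Lemma wt_ge0 o : 0 <= edge_weight o.
Proof. by case/andP: p01 => p0 p1; case: o => [k|] /=; rewrite ?subr_ge0 ?divr_ge0. Qed.

Lemma weight_ge0 f : 0 <= Gc_weight p f.
Proof. by apply: prodr_ge0 => e _; have := wt_ge0 (f e); case: (f e). Qed.

Lemma expect_prod (phi : edge n -> option 'I_c -> R) :
  expect (fun f => \prod_e phi e (f e)) = \prod_e edge_expect (phi e).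
Proof.
rewrite /expect /edge_expect bigA_distr_bigA /=; apply: eq_bigr => f _.
by rewrite /Gc_weight -big_split /=; apply: eq_bigr => e _; case: (f e).
Qed.

Lemma edge_expect_split phi : edge_expect phi = (1 - p) * phi None + p / c%:R * \sum_k phi (Some k).
Proof.
rewrite /edge_expect (bigD1 None) //=; congr (_ + _).
rewrite mulr_sumr (reindex_omap Some (fun o => o)) /=; last by case.
by apply: eq_big => [k|k _] //; rewrite eqxx.
Qed.

Lemma card_ind K : \sum_(k : 'I_c) (k \in K)%:R = #|K|%:R :> R.
Proof. by rewrite -sum1_card natr_sum [RHS]big_mkcond; apply: eq_bigr => k _; case: (k \in K). Qed.

Lemma edge_expect_col K x : edge_expect (fun o => if coloured_in K o then x else 1) = 1 + p * #|K|%:R / c%:R * (x - 1).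
Proof.
have cn : c%:R != 0 :> R by rewrite pnatr_eq0 -lt0n.
rewrite edge_expect_split /= mulr1 (eq_bigr (fun k => 1 + (k \in K)%:R * (x - 1))); last first.
  by move=> k _; case: (k \in K); rewrite ?mul1r ?mul0r ?addr0 // addrC subrK.
rewrite big_split /= -mulr_suml card_ind sumr_const card_ord.
by field.
Qed.

Lemma edge_expect1 : edge_expect (fun=> 1) = 1.
Proof.
have := edge_expect_col finset.set0 1; rewrite subrr mulr0 addr0 => E; rewrite -[RHS]E.
by apply: eq_bigr => o _; rewrite if_same.
Qed.

Lemma edge_expect_present : edge_expect (fun o => (o != None)%:R) = p.
Proof.
have cn : c%:R != 0 :> R by rewrite pnatr_eq0 -lt0n.
by rewrite edge_expect_split /= mulr0 add0r sumr_const card_ord -mulrA mulVf ?mulr1.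
Qed.

Lemma edge_expect_some k : edge_expect (fun o => (o == Some k)%:R) = p / c%:R.
Proof.
rewrite edge_expect_split /= mulr0 add0r (bigD1 k) //= eqxx big1 ?addr0 ?mulr1 // => j /negPf jk.
by rewrite (_ : Some j == Some k = (j == k)) // jk.
Qed.

Lemma prob_expect A : P A = expect (fun f => (A f)%:R).
Proof. by rewrite /Gc_prob big_mkcond; apply: eq_bigr => f _; case: (A f); rewrite ?mulr1 ?mulr0. Qed.

Lemma expect_le X X' : (forall f, X f <= X' f) -> expect X <= expect X'.
Proof. by move=> H; apply: ler_sum => f _; apply: ler_wpM2l => //; exact: weight_ge0. Qed.

Lemma expect_scale a X : expect (fun f => a * X f) = a * expect X.
Proof. by rewrite mulr_sumr; apply: eq_bigr => f _; rewrite mulrCA. Qed.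

Lemma prob_le A B : (forall f, A f -> B f) -> P A <= P B.
Proof.
move=> H; rewrite !prob_expect; apply: expect_le => f; have := H f.
by case: (A f) => [/(_ isT)->|_] //; case: (B f).
Qed.

Lemma prob_total : P predT = 1.
Proof.
by rewrite prob_expect; have := expect_prod (fun _ _ => 1); rewrite (eq_bigr _ (fun _ _ => edge_expect1)) big1 // => <-.
Qed.

Lemma prob_compl A : P (fun f => ~~ A f) = 1 - P A.
Proof.
apply/eqP; rewrite -prob_total eq_sym subr_eq; apply/eqP.
by rewrite /Gc_prob (bigID A) /= addrC.
Qed.

Lemma prob_union (I : finType) (Q : pred I) A (B : I -> pred out) :
  (forall f, A f -> exists2 i, Q i & B i f) -> P A <= \sum_(i | Q i) P (B i).
Proof.
move=> H; under eq_bigr do rewrite prob_expect.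
rewrite prob_expect exchange_big /=; apply: ler_sum => f _.
rewrite -mulr_sumr; apply: ler_wpM2l; first exact: weight_ge0.
case Af: (A f); last by apply: sumr_ge0.
case: (H _ Af) => i Qi Bi; rewrite (bigD1 i) //= Bi lerDl.
exact: sumr_ge0.
Qed.

Lemma prob_union_le (I : finType) (Q : pred I) A (B : I -> pred out) b :
  (forall f, A f -> exists2 i, Q i & B i f) -> (forall i, Q i -> P (B i) <= b) ->
  P A <= #|Q|%:R * b.
Proof.
move=> H1 H2; apply: le_trans (prob_union H1) _.
by apply: le_trans (ler_sum _ H2) _; rewrite sumr_const mulr_natl.
Qed.

Lemma prob_or A B : P (fun f => A f || B f) <= P A + P B.
Proof.
rewrite !prob_expect /expect -big_split /=; apply: ler_sum => f _; rewrite -mulrDr.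
apply: ler_wpM2l; first exact: weight_ge0.
by rewrite -natrD ler_nat; case: (A f); case: (B f).
Qed.

Lemma pow_cnt (x : R) K M f :
  x ^+ cnt K M f = \prod_e (if (e \in M) && coloured_in K (f e) then x else 1).
Proof.
rewrite -big_mkcond /= prodr_const /cnt; congr (_ ^+ _).
by apply: eq_card => e; rewrite !inE.
Qed.

Lemma edge_expect_ge0 phi : (forall o, 0 <= phi o) -> 0 <= edge_expect phi.
Proof. by move=> H; apply: sumr_ge0 => o _; rewrite mulr_ge0 // wt_ge0. Qed.

(* Markov's inequality for the product of the exponential moments [x i ^+ cnt (Ki i) (st i) f]. *)
Lemma moment_bound (I : finType) M (Q : edge n -> pred (option 'I_c)) (st : I -> {set edge n})
    (Ki : I -> {set 'I_c}) (m : I -> nat) (x : I -> R) :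
  (forall i, 0 < x i) ->
  (forall i e, e \in st i -> e \notin M) ->
  (forall i j e, e \in st i -> e \in st j -> i = j) ->
  P (fun f => [forall (e | e \in M), Q e (f e)] &&
              [forall i, (x i <= 1) && (cnt (Ki i) (st i) f <= m i)%N || (1 <= x i) && (m i <= cnt (Ki i) (st i) f)%N]) <=
  (\prod_(e in M) edge_expect (fun o => (Q e o)%:R)) *
  \prod_i (expR (p * #|Ki i|%:R / c%:R * (x i - 1) * #|st i|%:R) / x i ^+ m i).
Proof.
move=> x0 dM dst.
(* The integrand is a product of functions of single edges, so its expectation factorises. As the
   sets [st i] are disjoint from each other and from [M], at most one factor is nontrivial at each
   edge. *)
pose phi e o : R := (if e \in M then (Q e o)%:R else 1) *
   \prod_i (if (e \in st i) && coloured_in (Ki i) o then x i else 1).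
pose a : R := \prod_i (x i ^+ m i).
have a0 : 0 < a by apply: prodr_gt0 => i _; exact: exprn_gt0.
apply: (@le_trans _ _ (expect (fun f => a^-1 * \prod_e phi e (f e)))).
  rewrite prob_expect; apply: expect_le => f.
  have -> : \prod_e phi e (f e) = (\prod_(e in M) (Q e (f e))%:R) * \prod_i x i ^+ cnt (Ki i) (st i) f.
    rewrite big_split /= -big_mkcond exchange_big /=; congr (_ * _).
    by apply: eq_bigr => i _; rewrite pow_cnt.
  case: andP => [[/forallP HM /forallP HC]|_]; last first.
    by rewrite !mulr_ge0 ?invr_ge0 ?(ltW a0) ?prodr_ge0 // => i _; rewrite exprn_ge0 // ltW.
  rewrite (eq_bigr (fun=> 1)); last by move=> e eM; have := HM e; rewrite eM /= => ->.
  rewrite big1_eq mul1r mulrC ler_pdivlMr // mul1r.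
  apply: ler_prod => i _; rewrite exprn_ge0 ?(ltW (x0 i)) //=.
  case/orP: (HC i) => /andP[x1 le]; last exact: ler_weXn2l.
  by apply: ler_wiXn2l => //; exact: ltW.
rewrite expect_scale expect_prod.
have EeE e : edge_expect (phi e) = (if e \in M then edge_expect (fun o => (Q e o)%:R) else 1) *
    \prod_i (if e \in st i then 1 + p * #|Ki i|%:R / c%:R * (x i - 1) else 1).
  rewrite /phi; case: ifPn => eM.
    rewrite [X in _ = _ * X]big1 ?mulr1; last by move=> i _; case: ifP => // /dM; rewrite eM.
    apply: eq_bigr => o _; rewrite big1 ?mulr1 // => i _.
    by case: ifP => // /andP[/dM]; rewrite eM.
  rewrite mul1r; have [i ei|nst] := pickP (fun i => e \in st i); last first.
    rewrite big1; last by move=> i _; rewrite nst.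
    by rewrite -[RHS]edge_expect1; apply: eq_bigr => o _; rewrite mul1r big1 // => i _; rewrite nst.
  rewrite (bigD1 i) //= ei big1 ?mulr1; last first.
    by move=> j ji; case: ifP => // ej; rewrite (dst _ _ _ ei ej) eqxx in ji.
  rewrite -edge_expect_col; apply: eq_bigr => o _; rewrite mul1r (bigD1 i) //= ei /= big1 ?mulr1 //.
  by move=> j ji; case: ifP => // /andP[ej _]; rewrite (dst _ _ _ ei ej) eqxx in ji.
rewrite (eq_bigr _ (fun e _ => EeE e)) big_split /= -big_mkcond /= mulrCA.
apply: ler_wpM2l; first by apply: prodr_ge0 => e _; apply: edge_expect_ge0 => o.
rewrite exchange_big /= /a -prodfV -big_split /=; apply: ler_prod => i _.
rewrite -big_mkcond prodr_const; apply/andP; split.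
  rewrite mulr_ge0 ?invr_ge0 ?exprn_ge0 ?(ltW (x0 i)) // -edge_expect_col; apply: edge_expect_ge0 => o.
  by case: ifP => _ //; exact: ltW.
rewrite mulrC ler_wpM2r ?invr_ge0 ?exprn_ge0 ?(ltW (x0 i)) //.
rewrite expRM_natr lerXn2r ?nnegrE ?expR_ge0 ?expR_ge1Dx //.
by rewrite -edge_expect_col; apply: edge_expect_ge0 => o; case: ifP => _ //; exact: ltW.
Qed.

End Prob.

(** * Monotonicity and masking *)

Section Monotone.
Variables (R : realType) (n c : nat).
Hypothesis c0 : (0 < c)%N.

(** Coupling by thinning: keeping each edge, with its colour, with probability [p' / p] turns an
    outcome for [p] into one for [p']. The transition probabilities of a single edge form [K]. *)
Lemma prob_monotone (p p' : R) (A : pred (outcome n c)) : 0 <= p' -> p' <= p -> p <= 1 ->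
  (forall f g, subout f g -> A f -> A g) -> Gc_prob p' A <= Gc_prob p A.
Proof.
move=> p'0 p'p p1 incA; have p0 : 0 <= p := le_trans p'0 p'p.
have p01 : 0 <= p <= 1 by rewrite p0.
have cn : c%:R != 0 :> R by rewrite pnatr_eq0 -lt0n.
have [pz|pn0] := eqVneq p 0.
  by have -> : p' = p by apply/le_anti; rewrite p'p pz p'0.
have pgt : 0 < p by rewrite lt0r pn0.
pose r := p' / p; have r0 : 0 <= r by rewrite divr_ge0.
have r1 : r <= 1 by rewrite ler_pdivrMr // mul1r.
pose K (o o' : option 'I_c) : R := match o, o' with
  | None, None => 1 | None, Some _ => 0 | Some _, None => 1 - r
  | Some k, Some k' => r * (k == k')%:R end.
have K0 o o' : 0 <= K o o'.
  by case: o => [k|]; case: o' => [k'|]; rewrite /K ?subr_ge0 //; apply: mulr_ge0.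
have EK o' : edge_expect p (fun o => K o o') = edge_weight p' o'.
  rewrite edge_expect_split /K; case: o' => [k|] /=.
    rewrite mulr0 add0r (bigD1 k) //= eqxx big1 ?addr0 ?mulr1 => [|j /negPf->]; rewrite ?mulr0 //.
    by rewrite /r; field; rewrite pn0 cn.
  rewrite sumr_const card_ord mulr1 -mulr_natr /r; field; by rewrite pn0 cn.
have SK o : \sum_o' K o o' = 1.
  rewrite /K (bigD1 None) //= (reindex_omap Some (fun o => o)) /=; last by case.
  rewrite (eq_bigl predT) => [|k]; last by rewrite eqxx.
  case: o => [k|] /=; last by rewrite big1 ?addr0.
  rewrite (bigD1 k) //= eqxx big1 => [|j]; first by rewrite mulr1 addr0 subrK.
  by rewrite eq_sym => /negPf ->; rewrite mulr0.
rewrite [leLHS]/Gc_prob (eq_bigr (fun f' : outcome n c => \sum_f Gc_weight p f * \prod_e K (f e) (f' e))); last first.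
  move=> f' _; rewrite -/(expect p (fun f => \prod_e K (f e) (f' e))).
  rewrite (expect_prod p (fun e o => K o (f' e))); apply: eq_bigr => e _; rewrite EK.
  by case: (f' e).
rewrite exchange_big /= /Gc_prob [leRHS]big_mkcond; apply: ler_sum => f _ /=.
rewrite -mulr_sumr; case: ifPn => [Af|nAf].
  rewrite -[leRHS]mulr1 ler_wpM2l ?weight_ge0 //.
  apply: (@le_trans _ _ (\sum_(f' : outcome n c) \prod_e K (f e) (f' e))).
    rewrite [leRHS](bigID A) /= lerDl; apply: sumr_ge0 => f' _.
    by apply: prodr_ge0 => e _.
  rewrite -(bigA_distr_bigA (fun e o => K (f e) o)) /= big1 //.
rewrite big1 ?mulr0 // => f' Af'; apply/eqP/negPn/negP => nz; case/negP: nAf.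
apply: incA Af' => e fe; move/prodf_neq0: nz => /(_ e isT).
case: (f' e) fe (f e) => //= k _ [k'|]; rewrite ?eqxx //= mulf_eq0 negb_or pnatr_eq0 => /andP[_].
by case: (k' =P k) => [->|].
Qed.

End Monotone.

Lemma mask_arith1 (R : realFieldType) (p q : R) : p <= 2^-1 -> q <= p -> 0 <= 1 - q / 2.
Proof. lra. Qed.

Lemma mask_arith2 (R : realFieldType) (p q y : R) : p <= 2^-1 -> 0 <= q -> 0 <= y ->
  y <= (1 - p + q) * (2 * y).
Proof. nra. Qed.

(** Let [q] and [b] be the probabilities of a colour in [Cb] and of a forbidden colour. A hidden
    candidate is absent or has a forbidden colour with conditional probability
    [(1 - p + b) / (1 - p + q)]. As at least half of [Cb] is fresh, this is at most [1 - q / 2]. *)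
Lemma mask_arith3 (R : realFieldType) (p q b : R) : 0 <= p -> p <= 2^-1 -> 0 <= q -> q <= p -> b <= q / 2 ->
  1 - p + b <= (1 - p + q) * (1 - q / 2).
Proof. nra. Qed.

Section Mask.
Variables (R : realType) (n c : nat) (p : R).
Hypotheses (p0 : 0 <= p) (p1 : p <= 2^-1) (c0 : (0 < c)%N).
Notation out := (outcome n c).
Notation P := (@Gc_prob R n c p).
Variables (Cb : {set 'I_c}) (hd : out -> {set edge n}).

Notation strip := (@strip n c Cb).
Notation masked := (@masked n c Cb hd).
Hypothesis hd_stripE : forall f, hd f = hd (strip f).

Lemma strip_mask f : strip (masked f) = strip f.
Proof.
by apply/ffunP => e; rewrite !ffunE; case E: (coloured_in Cb (f e)); case: (e \in hd f); rewrite /= ?E.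
Qed.

Lemma hd_mask f : hd (masked f) = hd f.
Proof. by rewrite hd_stripE strip_mask -hd_stripE. Qed.

Lemma maskK f : masked (masked f) = masked f.
Proof.
apply/ffunP => e; rewrite [LHS]ffunE hd_mask !ffunE.
by case E: (coloured_in Cb (f e) && (e \in hd f)); rewrite ?E.
Qed.

(** The states of [e] compatible with the revealed outcome [g]. Compatibility is tested edge by
    edge, so fixing [masked f = g] leaves the edges independent. *)
Definition allowed (g : out) e (o : option 'I_c) :=
  if (e \in hd g) && (g e == None) then (o == None) || coloured_in Cb o else o == g e.

Lemma maskP f g : masked g = g -> (masked f == g) = [forall e, allowed g e (f e)].
Proof.
move=> mg; apply/eqP/forallP => [<- e|H].
  rewrite /allowed hd_mask ffunE; case: (coloured_in Cb (f e)); case: (e \in hd f); rewrite /= ?orbT ?eqxx //.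
  by case: (f e == None).
have Es : strip f = strip g.
  apply/ffunP => e; rewrite !ffunE; have := H e; rewrite /allowed; case: ifP => [/andP[_ /eqP->]|_ /eqP-> //].
  by case/orP => [/eqP->|->].
have Eh : hd f = hd g by rewrite hd_stripE Es -hd_stripE.
apply/ffunP => e; rewrite ffunE Eh -[in RHS]mg ffunE; have := H e; rewrite /allowed.
case: (e \in hd g) => /=; last by rewrite !andbF => /eqP.
by rewrite !andbT; case: eqP => [->|_ /eqP-> //]; case/orP => [/eqP->|->].
Qed.

Notation mask_event := (@mask_event n c Cb hd).
Let p01 : 0 <= p <= 1. Proof. by rewrite p0 (le_trans p1) // invf_le1 // ler1n. Qed.

(* Given [masked f], the hidden edges are still independent, each absent or coloured from [Cb]; hence both
   the coloured edges of [h] and the absence of a usable booster keep their price. *)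
Lemma mask_bound (A : out -> out -> {set edge n}) (forb : out -> out -> {set 'I_c}) (N0 : nat) (h : out) :
  (forall g e, e \in A g h -> [/\ e \in hd g, g e = None & h e = None]) ->
  (forall g, forb g h \subset Cb) -> (forall g, (2 * #|forb g h| <= #|Cb|)%N) ->
  P (mask_event A forb N0 h) <=
  (2 * p / c%:R) ^+ #|supp h| * expR (- (p * #|Cb|%:R / c%:R / 2 * N0%:R)).
Proof.
move=> HA Hf1 Hf2.
have cp : 0 < c%:R :> R by rewrite ltr0n.
have q0 : 0 <= p * #|Cb|%:R / c%:R by rewrite !mulr_ge0 // invr_ge0 ltW.
set q := p * #|Cb|%:R / c%:R in q0 *.
have q1 : q <= p.
  rewrite /q -mulrA -[leRHS]mulr1 ler_wpM2l // ler_pdivrMr // mul1r ler_nat.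
  by rewrite -[X in (_ <= X)%N]card_ord max_card.
pose W g e := edge_expect p (fun o => (allowed g e o)%:R : R).
(* The fixed points of [masked] are the possible revealed outcomes, and the product of the [W g e]
   is the probability of revealing [g]. *)
have sumW : \sum_(g : out | masked g == g) \prod_e W g e = 1.
  rewrite -[RHS](prob_total n p c0) /Gc_prob [RHS](partition_big masked (fun g => masked g == g)) /=; last by move=> f _; rewrite maskK eqxx.
  apply: eq_bigr => g /eqP mg; rewrite /W -expect_prod // /expect [RHS]big_mkcond.
  apply: eq_bigr => f _; rewrite maskP //; case: forallP => [H|nH].
    by rewrite big1 ?mulr1 // => e _; rewrite H.
  case/forallP/forallPn: nH => e ne.
  by rewrite (bigD1 e) //= (negPf ne) mul0r mulr0.
have cn : c%:R != 0 :> R by rewrite lt0r_neq0.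
have allE g e : e \in hd g -> g e = None -> W g e = 1 - p + q.
  move=> eh ge; rewrite /W edge_expect_split /allowed eh ge /= mulr1; congr (_ + _).
  by rewrite card_ind /q; field.
apply: (@le_trans _ _ (\sum_(g : out | masked g == g) (\prod_e W g e) *
   ((2 * p / c%:R) ^+ #|supp h| * expR (- (q / 2 * N0%:R))))); last by rewrite -mulr_suml sumW mul1r.
rewrite /Gc_prob [leLHS](partition_big masked (fun g => masked g == g)) /=; last by move=> f _; rewrite maskK eqxx.
apply: ler_sum => g /eqP mg.
have W0 e : 0 <= W g e by apply: edge_expect_ge0.
have rhs0 : 0 <= \prod_e W g e * ((2 * p / c%:R) ^+ #|supp h| * expR (- (q / 2 * N0%:R))).
  rewrite !mulr_ge0 ?expR_ge0 ?exprn_ge0 ?prodr_ge0 // !mulr_ge0 // invr_ge0 ltW //.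
have [/andP[ok1 ok2]|] := boolP ([forall (e | e \in supp h), [&& coloured_in Cb (h e), e \in hd g & g e == None]]
     && (N0 <= #|A g h|)%N); last first.
  move=> bad; rewrite big1 // => f /andP[/and3P[/forallP H1 H2 _] /eqP Ef]; case/negP: bad.
  rewrite -Ef H2 andbT; apply/forallP => e; apply/implyP => es; have := H1 e; rewrite es /=.
  by case/and3P => /eqP E1 h1 h2; rewrite h1 hd_mask h2 ffunE E1 h1 h2.
pose psi e (o : option 'I_c) := [&& allowed g e o, (e \in supp h) ==> (o == h e) &
  (e \in A g h) ==> ~~ coloured_in (Cb :\: forb g h)%SET o].
apply: (@le_trans _ _ (expect p (fun f => \prod_e (psi e (f e))%:R))).
  rewrite /expect big_mkcond; apply: ler_sum => f _; case: ifP => [|_]; last first.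
    by rewrite mulr_ge0 ?weight_ge0 // prodr_ge0.
  case/andP => /and3P[/forallP H1 _ /forallP H3] Ef; rewrite big1 ?mulr1 // => e _.
  move: Ef (Ef); rewrite {1}maskP // => /forallP H /eqP Ef; rewrite Ef in H3.
  rewrite /psi H; have := H1 e; have := H3 e; case: (e \in supp h); case: (e \in A g h) => //= h1; try by move=> /and3P[-> _ _]; rewrite ?h1.
  by rewrite h1.
rewrite (expect_prod p (fun e o => (psi e o)%:R)).
pose r e : R := (if e \in supp h then 2 * p / c%:R else 1) * (if e \in A g h then 1 - q / 2 else 1).
have rle : \prod_e r e <= (2 * p / c%:R) ^+ #|supp h| * expR (- (q / 2 * N0%:R)).
  rewrite big_split /= -!big_mkcond /= !prodr_const.
  apply: ler_wpM2l; first by rewrite exprn_ge0 // !mulr_ge0 // invr_ge0 ltW.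
  apply: (@le_trans _ _ (expR (- (q / 2)) ^+ #|A g h|)).
    have h1 : 0 <= 1 - q / 2 := mask_arith1 p1 q1.
    by rewrite lerXn2r ?nnegrE ?expR_ge0 //; exact: expR_ge1Dx.
  apply: (@le_trans _ _ (expR (- (q / 2)) ^+ N0)).
    apply: ler_wiXn2l => //; try exact: expR_ge0.
    by rewrite -[leRHS]expR0 ler_expR oppr_le0 divr_ge0.
  by rewrite -expRM_natr mulNr.
apply: (@le_trans _ _ (\prod_e (W g e * r e))); last first.
  by rewrite big_split /=; apply: ler_wpM2l => //; apply: prodr_ge0.
apply: ler_prod => e _; rewrite edge_expect_ge0 //=; rewrite /r.
case es: (e \in supp h) => /=.
  have eA : e \in A g h = false.
    by apply/negP => /HA[_ _ he]; move: es; rewrite inE he.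
  have := forallP ok1 e; rewrite es /= => /and3P[hC eh /eqP ge].
  rewrite eA mulr1 (allE _ _ eh ge); move: (es) hC; rewrite inE; case E: (h e) => [k|] //= _ kC.
  apply: (@le_trans _ _ (edge_expect p (fun o => (o == Some k)%:R))).
    apply: ler_sum => o _; apply: ler_wpM2l; first exact: wt_ge0.
    case ps: (psi e o) => //; move: ps; rewrite /psi es E /= => /and3P[_ /eqP-> _].
    by rewrite eqxx.
  have pc : 0 <= p / c%:R by rewrite divr_ge0.
  by rewrite edge_expect_some -[2 * p / c%:R]mulrA; exact: mask_arith2.
rewrite mul1r; case eA: (e \in A g h); last first.
  rewrite mulr1; apply: ler_sum => o _; apply: ler_wpM2l; first exact: wt_ge0.
  by rewrite ler_nat /psi; case: (allowed g e o) => //; rewrite leq_b1.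
case: (HA _ _ eA) => eh ge he; rewrite (allE _ _ eh ge).
have -> : edge_expect p (fun o => (psi e o)%:R) = 1 - p + p * #|forb g h|%:R / c%:R.
  rewrite edge_expect_split /psi es eA /allowed eh ge /= mulr1; congr (_ + _).
  rewrite (eq_bigr (fun k => (k \in forb g h)%:R)) ?card_ind; first by field.
  move=> k _; rewrite finset.in_setD negb_and negbK; have := fintype.subsetP (Hf1 g) k.
  by case: (k \in forb g h) => [->|_]; case: (k \in Cb).
have hb : p * #|forb g h|%:R / c%:R <= q / 2.
  rewrite /q [p * _ / _]mulrAC [p * #|Cb|%:R / _]mulrAC -[leRHS]mulrA ler_wpM2l ?divr_ge0 //.
  by rewrite ler_pdivlMr // -natrM ler_nat mulnC.
exact: mask_arith3.
Qed.

End Mask.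

(** * Union bounds *)

(** With weights [y ^+ #|S|] all sets together weigh [(1 + y) ^+ #|T|], and each counted set at
    least [y ^+ m]. The choice [y = m / #|T|] gives the usual bound [(e #|T| / m) ^ m]. *)
Lemma card_subsets_le (R : realType) (T : finType) (m : nat) (y : R) : 0 < y -> y <= 1 ->
  #|[set S : {set T} | (#|S| <= m)%N]|%:R <= expR (y * #|T|%:R) / y ^+ m.
Proof.
move=> y0 y1.
have sumE : \sum_(S : {set T}) y ^+ #|S| = (1 + y) ^+ #|T|.
  have -> : (1 + y) ^+ #|T| = \prod_(i : T) (y + 1) by rewrite prodr_const addrC.
  rewrite bigA_distr; apply: eq_bigr => S _.
  by rewrite -big_mkcond /= prodr_const.
apply: (@le_trans _ _ ((1 + y) ^+ #|T| / y ^+ m)).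
  rewrite ler_pdivlMr ?exprn_gt0 // -sumE -sum1_card natr_sum mulr_suml.
  rewrite big_mkcond /=; apply: ler_sum => S _.
  rewrite inE; case: ifP => [le|_]; last by rewrite exprn_ge0 // ltW.
  by rewrite mul1r ler_wiXn2l // ltW.
rewrite ler_wpM2r ?invr_ge0 ?exprn_ge0 ?(ltW y0) // expRM_natr lerXn2r ?nnegrE ?expR_ge0 ?addr_ge0 ?(ltW y0) //.
exact: expR_ge1Dx.
Qed.

(** * Chernoff bounds *)

Section Tails.
Variables (R : realType) (n c : nat) (p : R).
Hypotheses (p01 : 0 <= p <= 1) (c0 : (0 < c)%N).
Notation out := (outcome n c).
Notation P := (@Gc_prob R n c p).

Lemma tail_ge (K : {set 'I_c}) (M : {set edge n}) m (x : R) : 1 <= x ->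
  P (fun f => (m <= cnt K M f)%N) <= expR (p * #|K|%:R / c%:R * x * #|M|%:R) / x ^+ m.
Proof.
move=> x1; have x0 : 0 < x by apply: lt_le_trans x1.
have := @moment_bound R n c p p01 c0 unit finset.set0 (fun _ _ => true) (fun=> M) (fun=> K) (fun=> m) (fun=> x).
move=> /(_ (fun=> x0)) H.
apply: le_trans (le_trans _ (H _ _)) _; last 3 first.
- by move=> i e; rewrite inE.
- by move=> [] [].
- rewrite big1 => [|e]; last by rewrite inE.
  rewrite mul1r (big_pred1 tt) => [|[]] //; rewrite ler_wpM2r ?invr_ge0 ?exprn_ge0 ?(ltW x0) // ler_expR.
  rewrite ler_wpM2r // ler_wpM2l ?lerBlDr ?lerDl // divr_ge0 // mulr_ge0 //.
  by case/andP: p01.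
apply: prob_le => // f le; apply/andP; split; first by apply/forallP => e; rewrite inE.
by apply/forallP => i; rewrite x1 le orbT.
Qed.

Lemma tail_le (K : {set 'I_c}) (M : {set edge n}) m (x : R) : 0 < x -> x <= 1 ->
  P (fun f => (cnt K M f <= m)%N) <= expR (- (p * #|K|%:R / c%:R * (1 - x) * #|M|%:R)) / x ^+ m.
Proof.
move=> x0 x1.
have := @moment_bound R n c p p01 c0 unit finset.set0 (fun _ _ => true) (fun=> M) (fun=> K) (fun=> m) (fun=> x).
move=> /(_ (fun=> x0)) H.
apply: le_trans (le_trans _ (H _ _)) _; last 3 first.
- by move=> i e; rewrite inE.
- by move=> [] [].
- rewrite big1 => [|e]; last by rewrite inE.
  rewrite mul1r (big_pred1 tt) => [|[]] //; by rewrite -mulNr -mulrN opprB.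
apply: prob_le => // f le; apply/andP; split; first by apply/forallP => e; rewrite inE.
by apply/forallP => i; rewrite x1 le.
Qed.

(* Bad vertices [Rb] and small vertices [Sm] of [W] are witnessed by edges leaving [W], hence
   independently of each other and of what happens inside [W]. *)
Lemma local_moment_bound (W Rb Sm Y0 : {set 'I_n}) (Ce : {set 'I_c}) (d0 th0 : nat) (M : {set edge n})
    (Q : edge n -> pred (option 'I_c)) (x1 x2 rho pi_ : R) :
  Rb \subset W -> Sm \subset W -> [disjoint Rb & Sm] -> M \subset inside W ->
  0 < x1 <= 1 -> 0 < x2 <= 1 ->
  expR (- (p * #|Ce|%:R / c%:R * (1 - x1) * #|Y0 :\: W|%:R)) / x1 ^+ d0 <= rho ->
  expR (- (p * (1 - x2) * #|~: W|%:R)) / x2 ^+ th0 <= pi_ ->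
  P (fun f => [&& [forall (e | e \in M), Q e (f e)], Rb \subset poor_set Y0 Ce d0 f & Sm \subset small_set th0 f]) <=
  (\prod_(e in M) edge_expect p (fun o => (Q e o)%:R)) * rho ^+ #|Rb| * pi_ ^+ #|Sm|.
Proof.
move=> RW SW dRS MW /andP[x10 x11] /andP[x20 x21] hr hp.
pose st (v : 'I_n) := if v \in Rb then star v (Y0 :\: W) else if v \in Sm then star v (~: W) else finset.set0.
pose K (v : 'I_n) := if v \in Rb then Ce else finset.setT.
pose m (v : 'I_n) := if v \in Rb then d0 else if v \in Sm then th0 else 0%N.
pose x (v : 'I_n) : R := if v \in Rb then x1 else x2.
have stP v e : e \in st v -> v \in W /\ exists2 y, y \notin W & eset e = [set v; y]%SET.
  rewrite /st; case: ifP => [vR|_].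
    case/starP => y; rewrite finset.in_setD => /andP[yW _] E; split; first exact: (fintype.subsetP RW).
    by exists y.
  case: ifP => [vS|_]; last by rewrite inE.
  case/starP => y; rewrite finset.in_setC => yW E; split; first exact: (fintype.subsetP SW).
  by exists y.
have := @moment_bound R n c p p01 c0 'I_n M Q st K m x.
move=> H; apply: le_trans (le_trans _ (H _ _ _)) _; last 4 first.
- by move=> v; rewrite /x; case: ifP.
- move=> v e /stP[vW [y yW E]]; apply/negP => /(fintype.subsetP MW); rewrite inE E finset.subUset !finset.sub1set.
  by rewrite (negPf yW) andbF.
- move=> v w e /stP[vW [y yW E]] /stP[wW [y' yW' E']].
  have : v \in [set w; y']%SET by rewrite -E' E !inE eqxx.
  by rewrite !inE => /orP[/eqP//|/eqP vy]; rewrite vy (negPf yW') in vW.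
- rewrite -mulrA ler_wpM2l //; first by apply: prodr_ge0 => e _; apply: edge_expect_ge0.
  have -> : rho ^+ #|Rb| * pi_ ^+ #|Sm| = \prod_(v : 'I_n) (if v \in Rb then rho else if v \in Sm then pi_ else 1).
    rewrite -!prodr_const [X in X * _]big_mkcond [X in _ * X]big_mkcond -big_split /=.
    apply: eq_bigr => v _; case vR: (v \in Rb); last by rewrite mul1r.
    by have /pred0P/(_ v) := dRS; rewrite /= vR /= => ->; rewrite mulr1.
  apply: ler_prod => v _; apply/andP; split.
    by rewrite mulr_ge0 ?expR_ge0 // invr_ge0 exprn_ge0 // /x; case: ifP => _; exact: ltW.
  rewrite /K /m /x /st; case: ifP => vR.
    have vW : v \notin Y0 :\: W by rewrite finset.in_setD (fintype.subsetP RW).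
    by apply: le_trans hr; rewrite (card_star vW) -mulNr -mulrN opprB.
  have cn : c%:R != 0 :> R by rewrite pnatr_eq0 -lt0n.
  case: ifP => vS; last by rewrite cards0 mulr0 expR0 expr0 divr1.
  have vW : v \notin ~: W by rewrite finset.in_setC negbK (fintype.subsetP SW).
  by apply: le_trans hp; rewrite (card_star vW) cardsT card_ord mulfK // -mulNr -mulrN opprB.
apply: prob_le => // f /and3P[HM /fintype.subsetP HR /fintype.subsetP HS]; rewrite HM /=; apply/forallP => v.
have cm K1 (E1 E2 : {set edge n}) : E1 \subset E2 -> (cnt K1 E1 f <= cnt K1 E2 f)%N.
  move=> /fintype.subsetP sub; apply: subset_leq_card; apply/fintype.subsetP => e; rewrite !inE => /andP[/sub-> ->] //.
apply/orP; left; rewrite /x /K /m /st; case: ifP => vR.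
  rewrite x11 /=; have := HR _ vR; rewrite inE => /ltnW; apply: leq_trans; apply: cm.
  apply/fintype.subsetP => e /starP[y]; rewrite finset.in_setD => /andP[_ yY] E.
  by apply/starP; exists y.
rewrite x21 /=; case: ifP => vS; last first.
  by rewrite /cnt (_ : [set e in _ | _]%SET = finset.set0) ?cards0 //; apply/setP => e; rewrite !inE.
have := HS _ vS; rewrite inE => /ltnW; apply: leq_trans; apply: cm.
by apply/fintype.subsetP => e /starP[y _ E]; apply/starP; exists y => //; rewrite inE.
Qed.

End Tails.

Lemma geometric_le (R : realType) (r : R) n : 0 <= r -> r <= 2^-1 ->
  \sum_(i < n) r ^+ i.+1 <= 2 * r.
Proof.
move=> r0 r1.
have H : \sum_(i < n) r ^+ i.+1 <= 2 * r * (1 - r ^+ n).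
  elim: n => [|n IH]; first by rewrite big_ord0 expr0 subrr mulr0.
  rewrite big_ord_recr /= exprS; have h := exprn_ge0 n r0.
  move: IH; set s := \sum_(i < n) _; move: s (r ^+ n) h r0 r1 => s z h r0 r1 IH.
  have : r * z * r <= r * z * 2^-1 by rewrite ler_wpM2l // mulr_ge0.
  by move: IH; clear; lra.
apply: le_trans H _; rewrite -[leRHS]mulr1 ler_wpM2l ?mulr_ge0 // lerBlDr lerDl exprn_ge0 //.
Qed.

(** * Union bounds over booster choices and over colour-dense sets *)

Section ColourDense.
Variables (R : realType) (n c : nat) (p : R).
Hypotheses (p0 : 0 <= p) (p1 : p <= 2^-1) (c0 : (0 < c)%N).
Notation out := (outcome n c).
Notation P := (@Gc_prob R n c p).

Let p01 : 0 <= p <= 1. Proof. by rewrite p0 (le_trans p1) // invf_le1 // ler1n. Qed.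

(** Weighting each [h] by [y ^+ #|supp h|] makes the sum a product over edges. At one edge, the sum
    over the [c] colours cancels the factor [1 / c], so the choice of colours does not enlarge the
    union bound. *)
Lemma mask_union (Cb : {set 'I_c}) (hd : out -> {set edge n}) (A : out -> out -> {set edge n})
    (forb : out -> out -> {set 'I_c}) (N0 t : nat) (y : R) :
  (forall f, hd f = hd (strip Cb f)) ->
  (forall g h e, e \in A g h -> [/\ e \in hd g, g e = None & h e = None]) ->
  (forall g h, forb g h \subset Cb) ->
  (forall g h, (#|supp h| <= t)%N -> (2 * #|forb g h| <= #|Cb|)%N) ->
  0 < y -> y <= 1 ->
  P (fun f => [exists h : out, (#|supp h| <= t)%N && mask_event Cb hd A forb N0 h f]) <=
  expR (2 * p * y * (n ^ 2)%:R) / y ^+ t * expR (- (p * #|Cb|%:R / c%:R / 2 * N0%:R)).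
Proof.
move=> Hhd HA Hf1 Hf2 y0 y1.
have cn : c%:R != 0 :> R by rewrite pnatr_eq0 -lt0n.
have q0 : 0 <= 2 * p / c%:R by rewrite !mulr_ge0 // invr_ge0.
apply: (le_trans (@prob_union _ _ _ _ p01 out (fun h => (#|supp h| <= t)%N) _ (mask_event Cb hd A forb N0) _)).
  by move=> f /existsP[h /andP[h1 h2]]; exists h.
set b := expR (- _).
apply: (@le_trans _ _ (\sum_(h : out | (#|supp h| <= t)%N) (2 * p / c%:R) ^+ #|supp h| * b)).
  apply: ler_sum => h ht; apply: mask_bound => // [g e|g]; [exact: HA|exact: Hf2].
rewrite -mulr_suml ler_wpM2r ?expR_ge0 //.
have S1 : \sum_(h : out) (y * (2 * p / c%:R)) ^+ #|supp h| <= expR (2 * p * y * (n ^ 2)%:R).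
  have -> : \sum_(h : out) (y * (2 * p / c%:R)) ^+ #|supp h| =
      \prod_(e : edge n) \sum_(o : option 'I_c) (if o != None then y * (2 * p / c%:R) else 1).
    rewrite bigA_distr_bigA; apply: eq_bigr => h _.
    rewrite -big_mkcond /= prodr_const; congr (_ ^+ _); apply: eq_card => e; rewrite !inE //.
  have -> : \sum_(o : option 'I_c) (if o != None then y * (2 * p / c%:R) else 1) = 1 + 2 * p * y.
    rewrite (bigD1 None) //= (reindex_omap Some (fun o => o)) /=; last by case.
    rewrite (eq_bigl predT) => [|k]; last by rewrite eqxx.
    by rewrite sumr_const card_ord; congr (_ + _); rewrite -mulr_natr; field.
  rewrite prodr_const; have y2 : 0 <= 2 * p * y by rewrite !mulr_ge0 // ltW.
  apply: (@le_trans _ _ (expR (2 * p * y) ^+ #|{: edge n}|)).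
    by rewrite lerXn2r ?nnegrE ?expR_ge0 ?addr_ge0 // expR_ge1Dx.
  rewrite -expRM_natr ler_expR ler_wpM2l // ler_nat; exact: card_edge.
rewrite ler_pdivlMr ?exprn_gt0 //; apply: le_trans S1; rewrite mulr_suml.
rewrite [leLHS]big_mkcond; apply: ler_sum => h _; case: ifP => [ht|_]; last by rewrite exprn_ge0 // mulr_ge0 // ltW.
by rewrite [leRHS]exprMn [leLHS]mulrC ler_wpM2r ?exprn_ge0 // ler_wiXn2l // ltW.
Qed.

Lemma prob_sum_sizes (A : nat -> pred out) (N : nat) (r : R) (B : pred out) :
  (forall f, B f -> exists2 s, (0 < s <= N)%N & A s f) ->
  0 <= r -> r <= 2^-1 -> (forall s, (0 < s <= N)%N -> P (A s) <= r ^+ s) -> P B <= 2 * r.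
Proof.
move=> H r0 r1 HA; apply: le_trans (geometric_le N r0 r1).
apply: le_trans (_ : \sum_(i < N) P (A i.+1) <= _).
  apply: (@prob_union _ _ _ _ p01 _ predT) => f /H[[//|s] /= lt As].
  by exists (Ordinal lt).
by apply: ler_sum => i _; apply: HA => /=.
Qed.

(** For [#|S| = s] put [t = j * s / c]. The choices of [S] and [K] number at most
    [exp(2 * j * s) / t ^ ((j + 1) * s)], and Chernoff's bound at [x = 1 / (a * t)] gives
    [(e * a * t) ^ (mu * s)]. Per vertex of [S], [j + 1] of the [mu] factors cancel the powers of
    [t], and each of the others is at most [exp(-1)]. *)
Lemma colour_dense_le (Yh : {set 'I_n}) (j mu smax : nat) (a kap l : R) :
  (n <= c)%N -> (0 < j)%N -> (j < mu)%N -> 1 <= a -> p * #|Yh|%:R <= a * mu%:R ->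
  expR 2 * a * (j * smax)%:R <= c%:R -> expR 1 * a <= expR kap -> 1 <= l -> 0 <= kap ->
  j.+1%:R * kap + (2 * j)%:R + l <= (mu - j.+1)%:R ->
  P (colour_dense Yh j mu smax) <= 2 * expR (- l).
Proof.
move=> nc j0 jmu a1 Ha Hs Hk l1 kap0 Hm.
have cp : 0 < c%:R :> R by rewrite ltr0n.
have a0 : 0 < a by apply: lt_le_trans a1.
have e0 : 0 < expR 1 :> R := expR_gt0 _.
pose A (s : nat) : pred out := fun f => [exists SK : {set 'I_n} * {set 'I_c},
   ((#|SK.1| == s) && (#|SK.2| <= j * s)%N) && (mu * s <= cnt SK.2 (between SK.1 Yh) f)%N].
apply: (@prob_sum_sizes A smax).
- move=> f /existsP[S /existsP[K /and3P[h1 h2 h3]]]; exists #|S| => //.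
  by apply/existsP; exists (S, K); rewrite /= eqxx h2.
- exact: expR_ge0.
- rewrite expRN lef_pV2 ?posrE ?expR_gt0 //; apply: le_trans (expR_ge1Dx _) => //; lra.
move=> s /andP[s0 sm].
have s0R : 0 < s%:R :> R by rewrite ltr0n.
pose t : R := (j * s)%:R / c%:R.
have t0 : 0 < t by rewrite divr_gt0 // ltr0n muln_gt0 j0.
have zt : expR 1 * (a * t) <= expR (-1).
  rewrite expRN -[leRHS]mul1r ler_pdivlMr //.
  have E2 : expR 2 = expR 1 * expR 1 :> R by rewrite -expRD.
  have -> : expR 1 * (a * t) * expR 1 = expR 2 * a * (j * s)%:R / c%:R by rewrite E2 /t; ring.
  rewrite ler_pdivrMr // mul1r; apply: le_trans Hs.
  by rewrite ler_wpM2l ?mulr_ge0 ?expR_ge0 ?(ltW a0) // ler_nat leq_mul2l sm orbT.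
have at1 : a * t <= 1.
  have h : expR (-1) <= expR 1 :> R by rewrite ler_expR; lra.
  by have := le_trans zt h; rewrite -[leRHS]mulr1 ler_pM2l.
have t1 : t <= 1.
  have js : (j * s <= c)%N.
    rewrite -(ler_nat R); apply: le_trans Hs; apply: (@le_trans _ _ ((j * smax)%:R)).
      by rewrite ler_nat leq_mul2l sm orbT.
    apply: ler_peMl => //; apply: mulr_ege1 => //; rewrite -[leLHS]expR0 ler_expR //.
  by rewrite ler_pdivrMr // mul1r ler_nat.
pose card1 : R := expR (t * n%:R) / t ^+ s; pose card2 : R := expR (t * c%:R) / t ^+ (j * s).
pose x := (a * t)^-1; have x1 : 1 <= x by rewrite invf_ge1 // mulr_gt0.
have x0 : 0 < x by apply: lt_le_trans x1.
pose b : R := expR ((mu * s)%:R) / x ^+ (mu * s).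
apply: (@le_trans _ _ ((card1 * card2) * b)).
  apply: le_trans (@prob_union_le _ _ _ _ p01 _ (fun SK : {set 'I_n} * {set 'I_c} => (#|SK.1| == s) && (#|SK.2| <= j * s)%N)
     _ (fun SK f => (mu * s <= cnt SK.2 (between SK.1 Yh) f)%N) b _ _) _.
  - by move=> f /existsP[SK /andP[h1 h2]]; exists SK.
  - move=> [S K] /= /andP[/eqP cS cK]; apply: le_trans (tail_ge p01 c0 K _ _ x1) _.
    rewrite /b ler_wpM2r ?invr_ge0 ?exprn_ge0 ?(le_trans _ x1) // ler_expR.
    have cB : #|between S Yh|%:R <= s%:R * #|Yh|%:R :> R by rewrite -natrM ler_nat -cS card_between.
    apply: (@le_trans _ _ (p * t * x * (s%:R * #|Yh|%:R))).
      have h1 : p * #|K|%:R / c%:R <= p * t.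
        by rewrite -mulrA ler_wpM2l // /t ler_wpM2r ?invr_ge0 ?(ltW cp) // ler_nat.
      apply: ler_pM => //; last by rewrite ler_wpM2r ?(ltW x0).
      by apply: mulr_ge0; [rewrite !mulr_ge0 ?invr_ge0 ?(ltW cp)|exact: ltW].
    rewrite /x natrM (_ : _ * _ = s%:R * (p * #|Yh|%:R / a)); last by field; rewrite !lt0r_neq0.
    by rewrite [leRHS]mulrC ler_wpM2l // ler_pdivrMr // [leRHS]mulrC.
  - rewrite ler_wpM2r ?mulr_ge0 ?expR_ge0 ?invr_ge0 ?exprn_ge0 ?(le_trans _ x1) //.
    apply: (@le_trans _ _ (#|[set S : {set 'I_n} | (#|S| <= s)%N]|%:R * #|[set K : {set 'I_c} | (#|K| <= j * s)%N]|%:R)).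
      rewrite -natrM ler_nat -cardsX; apply: subset_leq_card; apply/fintype.subsetP => -[S K].
      by rewrite !inE unfold_in /= => /andP[/eqP-> ->]; rewrite leqnn.
    have := @card_subsets_le R 'I_n s t t0 t1; have := @card_subsets_le R 'I_c (j * s) t t0 t1.
    rewrite !card_ord => h2 h1; exact: ler_pM.
have tc : t * c%:R = (j * s)%:R by rewrite /t divfK // lt0r_neq0.
have tn : t * n%:R <= (j * s)%:R by rewrite -tc ler_pM2l // ler_nat.
have E1 : (card1 * card2) * b <= (expR ((2 * j)%:R) / t ^+ j.+1 * (expR 1 * (a * t)) ^+ mu) ^+ s.
  have A1 : expR ((2 * j)%:R) ^+ s = expR ((j * s)%:R) * expR ((j * s)%:R) :> R.
    by rewrite -expRM_natr -expRD; congr expR; rewrite !natrM; ring.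
  have A2 : expR 1 ^+ (mu * s) = expR ((mu * s)%:R) :> R by rewrite -expRM_natr mul1r.
  have -> : b = expR ((mu * s)%:R) * (a * t) ^+ (mu * s) by rewrite /b /x exprVn invrK.
  rewrite [leRHS]exprMn [X in _ <= X * _]exprMn exprVn -!exprM A1 [(expR 1 * _) ^+ _]exprMn A2.
  apply: ler_wpM2r; first by rewrite mulr_ge0 ?expR_ge0 ?exprn_ge0 // mulr_ge0 // ltW.
  rewrite /card1 /card2 mulrACA -invfM -exprD -mulSn tc ler_wpM2r ?invr_ge0 ?exprn_ge0 ?(ltW t0) //.
  by rewrite ler_wpM2r ?expR_ge0 // ler_expR.
set z := expR 1 * (a * t) in zt E1.
have z0 : 0 < z by apply: mulr_gt0 => //; exact: mulr_gt0.
have E3 : expR (2 * j)%:R / t ^+ j.+1 * z ^+ mu = expR (2 * j)%:R * (expR 1 * a) ^+ j.+1 * z ^+ (mu - j.+1).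
  have hz : z ^+ j.+1 = (expR 1 * a) ^+ j.+1 * t ^+ j.+1 by rewrite /z mulrA exprMn.
  rewrite -{1}(subnKC jmu) exprD hz; move: (z ^+ _) ((expR 1 * a) ^+ _) (expR _) => u v w.
  have : t ^+ j.+1 != 0 by rewrite expf_neq0 // lt0r_neq0.
  move: (t ^+ _) => T T0; field => //.
have fin : expR (2 * j)%:R / t ^+ j.+1 * z ^+ mu <= expR (- l).
  rewrite E3; apply: (@le_trans _ _ (expR (2 * j)%:R * expR (kap * j.+1%:R) * expR (-1 * (mu - j.+1)%:R))).
    apply: ler_pM; rewrite ?mulr_ge0 ?expR_ge0 ?exprn_ge0 ?mulr_ge0 ?expR_ge0 ?(ltW a0) ?(ltW z0) //.
      rewrite ler_wpM2l ?expR_ge0 // expRM_natr lerXn2r ?nnegrE ?expR_ge0 ?mulr_ge0 ?expR_ge0 ?(ltW a0) //.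
    by rewrite expRM_natr lerXn2r ?nnegrE ?expR_ge0 ?(ltW z0).
  rewrite -!expRD ler_expR; move: Hm; rewrite [kap * _]mulrC; lra.
apply: le_trans E1 _; rewrite lerXn2r ?nnegrE ?expR_ge0 //.
by rewrite !mulr_ge0 ?expR_ge0 ?invr_ge0 ?exprn_ge0 // ltW.
Qed.

End ColourDense.

(** * Crowded sets, unlinked sets, many edges, many poor vertices *)

Section Events2.
Variables (R : realType) (n c : nat) (p : R).
Hypotheses (p0 : 0 < p) (p1 : p <= 2^-1) (c0 : (0 < c)%N).
Notation out := (outcome n c).
Notation P := (@Gc_prob R n c p).

Let p01 : 0 <= p <= 1. Proof. by rewrite (ltW p0) (le_trans p1) // invf_le1 // ler1n. Qed.

Lemma card_sets_le (T : finType) : #|{set T}|%:R <= expR (#|T|%:R) :> R.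
Proof.
have := @card_subsets_le R T #|T| 1 ltr01 (lexx _); rewrite mul1r expr1n divr1; apply: le_trans.
by rewrite ler_nat; apply: subset_leq_card; apply/fintype.subsetP => S _; rewrite inE max_card.
Qed.

Lemma colT_frac : p * #|[set: 'I_c]|%:R / c%:R = p.
Proof. by rewrite cardsT card_ord mulfK // pnatr_eq0 -lt0n. Qed.

Lemma crowded_size (u m : nat) (x : R) : (0 < u <= n)%N -> 1 <= x ->
  P (fun f => [exists U : {set 'I_n}, (#|U| == u) && (m <= cnt finset.setT (inside U) f)%N]) <=
  expR u%:R / (u%:R / n%:R) ^+ u * (expR (p * x * (u ^ 2)%:R) / x ^+ m).
Proof.
move=> /andP[u0 un] x1; have x0 : 0 < x by apply: lt_le_trans x1.
have n0 : 0 < n%:R :> R by rewrite ltr0n (leq_trans u0).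
have uR : 0 < u%:R :> R by rewrite ltr0n.
have y0 : 0 < u%:R / n%:R :> R by rewrite divr_gt0.
have y1 : u%:R / n%:R <= 1 :> R by rewrite ler_pdivrMr // mul1r ler_nat.
apply: le_trans (@prob_union_le _ _ _ _ p01 _ (fun U : {set 'I_n} => #|U| == u) _
   (fun U f => (m <= cnt finset.setT (inside U) f)%N) (expR (p * x * (u ^ 2)%:R) / x ^+ m) _ _) _.
- by move=> f /existsP[U /andP[h1 h2]]; exists U.
- move=> U /eqP cU; apply: le_trans (tail_ge p01 c0 _ _ _ x1) _.
  rewrite colT_frac ler_wpM2r ?invr_ge0 ?exprn_ge0 ?(ltW x0) // ler_expR.
  by rewrite ler_wpM2l ?mulr_ge0 ?(ltW p0) ?(ltW x0) // ler_nat -cU card_inside.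
- rewrite ler_wpM2r ?mulr_ge0 ?expR_ge0 ?invr_ge0 ?exprn_ge0 ?(ltW x0) //.
  have := @card_subsets_le R 'I_n u _ y0 y1; rewrite card_ord divfK ?lt0r_neq0 //; apply: le_trans.
  by rewrite ler_nat; apply: subset_leq_card; apply/fintype.subsetP => U; rewrite inE unfold_in => /eqP->.
Qed.

(** Chernoff's bound for sets of size [u] is taken at [x = Dd / (p * u)]. Per vertex it gives [Dd]
    factors [e * p * u / Dd]: one of them turns the number [e * n / u] of choices into a multiple of
    [n * p], the others are at most [exp(-1)]. *)
Lemma crowded_le (Dd umax : nat) (kap l : R) :
  (0 < Dd)%N -> (umax <= n)%N -> expR 2 * p * umax%:R <= Dd%:R -> n%:R * p <= expR kap ->
  2 + kap + l <= Dd.-1%:R -> 1 <= l ->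
  P (crowded (fun u => Dd * u)%N umax) <= 2 * expR (- l).
Proof.
move=> D0 un Hu Hk Hl l1.
have DR : 0 < Dd%:R :> R by rewrite ltr0n.
have e0 : 0 < expR 1 :> R := expR_gt0 _.
apply: (@prob_sum_sizes R n c p (ltW p0) p1 (fun u f => [exists U : {set 'I_n}, (#|U| == u) && (Dd * u <= cnt finset.setT (inside U) f)%N]) umax).
- by move=> f /existsP[U /andP[h1 h2]]; exists #|U| => //; apply/existsP; exists U; rewrite eqxx.
- exact: expR_ge0.
- rewrite expRN lef_pV2 ?posrE ?expR_gt0 //; apply: le_trans (expR_ge1Dx _) => //; lra.
move=> u /andP[u0 um]; have uR : 0 < u%:R :> R by rewrite ltr0n.
have n0 : 0 < n%:R :> R by rewrite ltr0n (leq_trans u0) // (leq_trans um).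
pose w : R := p * u%:R / Dd%:R; have w0 : 0 < w by rewrite divr_gt0 // mulr_gt0.
have E2 : expR 2 = expR 1 * expR 1 :> R by rewrite -expRD.
have zw : expR 1 * w <= expR (-1).
  rewrite expRN -[leRHS]mul1r ler_pdivlMr // (_ : _ * w * _ = expR 2 * p * u%:R / Dd%:R); last by rewrite E2 /w; ring.
  rewrite ler_pdivrMr // mul1r; apply: le_trans Hu.
  by rewrite ler_wpM2l ?mulr_ge0 ?expR_ge0 ?(ltW p0) // ler_nat.
have w1 : w <= 1.
  have h : expR (-1) <= expR 1 :> R by rewrite ler_expR; lra.
  by have := le_trans zw h; rewrite -[leRHS]mulr1 ler_pM2l.
have x1 : 1 <= w^-1 by rewrite invf_ge1.
apply: le_trans (@crowded_size u _ _ _ x1) _; first by rewrite u0 (leq_trans um).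
have -> : expR (p * w^-1 * (u ^ 2)%:R) = expR 1 ^+ (Dd * u) :> R.
  rewrite -expRM_natr mul1r; congr expR; rewrite /w natrM natrX; field.
  by rewrite !lt0r_neq0 // mulr_gt0.
have -> : expR u%:R = expR 1 ^+ u :> R by rewrite -expRM_natr mul1r.
rewrite exprVn invrK -exprMn exprM -exprVn -!exprMn invf_div.
rewrite lerXn2r ?nnegrE ?expR_ge0 ?mulr_ge0 ?divr_ge0 ?exprn_ge0 ?mulr_ge0 ?expR_ge0 ?(ltW w0) ?(ltW n0) ?(ltW uR) ?(ltW e0) ?(ltW p0) //.
set z := expR 1 * w in zw *; have z0 : 0 < z by apply: mulr_gt0.
have -> : expR 1 * (n%:R / u%:R) * z ^+ Dd = expR 2 * (n%:R * p) / Dd%:R * z ^+ Dd.-1.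
  rewrite -{1}(prednK D0) exprS {1}/z /w E2; field; rewrite !lt0r_neq0 //.
apply: (@le_trans _ _ (expR 2 * expR kap * expR (-1 * Dd.-1%:R))).
  apply: ler_pM; rewrite ?exprn_ge0 ?(ltW z0) ?mulr_ge0 ?expR_ge0 ?(ltW n0) ?(ltW p0) ?invr_ge0 ?(ltW DR) //.
    apply: le_trans (_ : expR 2 * (n%:R * p) <= _).
      rewrite ler_piMr ?mulr_ge0 ?expR_ge0 ?(ltW n0) ?(ltW p0) // invf_le1 // ler1n //.
    by rewrite ler_wpM2l ?expR_ge0.
  by rewrite expRM_natr lerXn2r ?nnegrE ?expR_ge0 ?(ltW z0).
by rewrite -!expRD ler_expR; lra.
Qed.

(** With one edge more than vertices, the expected number of such sets of size [u] is about [p * u]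
    times a power [(C * n * p) ^ u]; the single surplus factor [p] has to outweigh that power. *)
Lemma crowded_small_le (u0 : nat) (kap : R) :
  (u0 <= n)%N -> p * u0%:R <= 1 -> n%:R * p <= expR kap -> 0 <= kap ->
  P (crowded S u0) <= (u0 ^ 2)%:R * p * expR ((2 + kap) * u0%:R).
Proof.
move=> un pu Hk k0.
pose A (i : 'I_u0) : pred out := fun f => [exists U : {set 'I_n}, (#|U| == i.+1) && (i.+2 <= cnt finset.setT (inside U) f)%N].
apply: le_trans (@prob_union_le _ _ _ _ p01 'I_u0 predT _ A (u0%:R * p * expR ((2 + kap) * u0%:R)) _ _) _; last first.
- by rewrite card_ord !mulrA -natrM mulnn.
- move=> i _; have ui : (0 < i.+1 <= n)%N by rewrite /= (leq_trans (ltn_ord i)).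
  have iR : 0 < i.+1%:R :> R by rewrite ltr0n.
  have n0 : 0 < n%:R :> R by rewrite ltr0n (leq_trans _ (proj2 (andP ui))).
  have w0 : 0 < p * i.+1%:R by rewrite mulr_gt0.
  have iu : i.+1%:R <= u0%:R :> R by rewrite ler_nat ltn_ord.
  have w1 : p * i.+1%:R <= 1 by apply: le_trans pu; rewrite ler_wpM2l // ltW.
  have x1 : 1 <= (p * i.+1%:R)^-1 by rewrite invf_ge1.
  apply: le_trans (crowded_size i.+2 ui x1) _.
  have -> : p * (p * i.+1%:R)^-1 * (i.+1 ^ 2)%:R = i.+1%:R :> R by rewrite natrX; field; rewrite !lt0r_neq0.
  rewrite exprVn invrK -exprVn invf_div.
  have -> : expR i.+1%:R * (n%:R / i.+1%:R) ^+ i.+1 * (expR i.+1%:R * (p * i.+1%:R) ^+ i.+2) =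
      p * i.+1%:R * (expR 2 * (n%:R * p)) ^+ i.+1 :> R.
    have E2 : expR 2 = expR 1 * expR 1 :> R by rewrite -expRD.
    have -> : expR i.+1%:R = expR 1 ^+ i.+1 :> R by rewrite -expRM_natr mul1r.
    rewrite E2 [(p * i.+1%:R) ^+ i.+2]exprS mulrA [_ * (p * i.+1%:R * _)]mulrCA mulrA -!mulrA; congr (_ * (_ * _)).
    rewrite -!exprMn; congr (_ ^+ _); field; rewrite lt0r_neq0 //.
  rewrite [u0%:R * p]mulrC; apply: ler_pM; rewrite ?(ltW w0) ?exprn_ge0 ?mulr_ge0 ?expR_ge0 ?(ltW n0) ?(ltW p0) //.
    by rewrite ler_wpM2l // ltW.
  apply: (@le_trans _ _ (expR (2 + kap) ^+ i.+1)).
    rewrite lerXn2r ?nnegrE ?expR_ge0 ?mulr_ge0 ?expR_ge0 ?(ltW n0) ?(ltW p0) //.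
    by rewrite [leRHS]expRD ler_wpM2l ?expR_ge0.
  by rewrite -expRM_natr ler_expR ler_wpM2l // addr_ge0.
- move=> f /existsP[U /andP[/andP[h1 h2] h3]].
  have lt : (#|U|.-1 < u0)%N by rewrite prednK.
  by exists (Ordinal lt) => //; apply/existsP; exists U; rewrite /= prednK // eqxx.
Qed.

Lemma unlinked_le (m q : nat) :
  P (unlinked m q) <= expR ((2 * n + c)%:R - p * q%:R / c%:R / 2 * (m ^ 2)%:R).
Proof.
have cp : 0 < c%:R :> R by rewrite ltr0n.
set b := p * q%:R / c%:R / 2 * (m ^ 2)%:R.
apply: le_trans (@prob_union_le _ _ _ _ p01 ({set 'I_n} * {set 'I_n} * {set 'I_c})%type
  (fun t => [&& (m <= #|t.1.1|)%N, (m <= #|t.1.2|)%N, [disjoint t.1.1 & t.1.2] & (q <= #|t.2|)%N]) _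
  (fun t f => (cnt t.2 (between t.1.1 t.1.2) f <= 0)%N) (expR (- b)) _ _) _.
- move=> f /existsP[A1 /existsP[A2 /existsP[K /and5P[h1 h2 h3 h4 h5]]]].
  by exists (A1, A2, K); rewrite /= ?h1 ?h2 ?h3 // (eqP h5).
- move=> [[A1 A2] K] /= /and4P[h1 h2 h3 h4].
  apply: le_trans (@tail_le _ _ _ _ p01 c0 K _ 0 2^-1 _ _) _; first by rewrite invr_gt0.
    by rewrite invf_le1 // ler1n.
  rewrite expr0 divr1 ler_expR lerN2 /b (_ : 1 - 2^-1 = 2^-1); last by lra.
  apply: ler_pM; rewrite ?mulr_ge0 ?invr_ge0 ?(ltW p0) ?(ltW cp) //.
    by rewrite !ler_wpM2r ?invr_ge0 ?(ltW cp) // ler_wpM2l ?(ltW p0) // ler_nat.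
  by rewrite ler_nat -mulnn; apply: leq_trans (card_between_disj h3); rewrite leq_mul.
- rewrite expRD ler_wpM2r ?expR_ge0 //.
  apply: (@le_trans _ _ (#|{: {set 'I_n} * {set 'I_n} * {set 'I_c}}|%:R)); first by rewrite ler_nat max_card.
  rewrite !card_prod !natrM (_ : (2 * n + c)%:R = n%:R + n%:R + c%:R); last by rewrite natrD mulSn mul1n natrD.
  have h1 := @card_sets_le 'I_n; have h2 := @card_sets_le 'I_c; rewrite !card_ord in h1 h2.
  by rewrite !expRD; do 2 (apply: ler_pM; rewrite ?mulr_ge0 //).
Qed.

Lemma many_edges_le (ee : nat) :
  P (fun f => (ee <= cnt finset.setT finset.setT f)%N) <= expR (p * 2 * (n ^ 2)%:R) / 2 ^+ ee.
Proof.
apply: le_trans (@tail_ge _ _ _ _ p01 c0 _ _ ee 2 _) _; first by rewrite ler1n.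
rewrite colT_frac ler_wpM2r ?invr_ge0 ?exprn_ge0 // ler_expR ler_wpM2l ?mulr_ge0 ?(ltW p0) //.
by rewrite ler_nat cardsT card_edge.
Qed.

Lemma many_bad_le (Y0 : {set 'I_n}) (Ce : {set 'I_c}) (d0 bb : nat) (rho : R) : (0 < bb)%N ->
  (forall v, P (fun f => v \in poor_set Y0 Ce d0 f) <= rho) ->
  P (fun f => (bb < #|poor_set Y0 Ce d0 f|)%N) <= n%:R * rho / bb%:R.
Proof.
move=> b0 H; rewrite ler_pdivlMr ?ltr0n // mulrC.
apply: (@le_trans _ _ (\sum_(v : 'I_n) P (fun f => v \in poor_set Y0 Ce d0 f))); last first.
  by apply: le_trans (ler_sum _ (fun v _ => H v)) _; rewrite sumr_const card_ord mulr_natl.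
under eq_bigr do rewrite prob_expect.
rewrite prob_expect -expect_scale exchange_big /=; apply: ler_sum => f _; rewrite -mulr_sumr ler_wpM2l ?weight_ge0 //.
have -> : \sum_(v : 'I_n) (v \in poor_set Y0 Ce d0 f)%:R = #|poor_set Y0 Ce d0 f|%:R :> R.
  by rewrite -[in RHS]sum1_card natr_sum [RHS]big_mkcond; apply: eq_bigr => v _; case: (v \in _).
by case: ltnP => lt; rewrite ?mulr0 // mulr1 ler_nat ltnW.
Qed.

End Events2.

(** * The probability of a pattern *)

Section Pat.
Variables (R : realType) (n c : nat) (p : R).
Hypotheses (p01 : 0 <= p <= 1) (c0 : (0 < c)%N).
Notation P := (@Gc_prob R n c p).
Variables (Y0 : {set 'I_n}) (Ce : {set 'I_c}) (d0 th0 wm : nat) (x1 x2 rho pi_ : R).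
Hypotheses (hx1 : 0 < x1 <= 1) (hx2 : 0 < x2 <= 1).
Hypothesis hrho : expR (- (p * #|Ce|%:R / c%:R * (1 - x1) * (#|Y0|%:R - wm%:R))) / x1 ^+ d0 <= rho.
Hypothesis hpi : expR (- (p * (1 - x2) * (n%:R - wm%:R))) / x2 ^+ th0 <= pi_.

(** Poverty and smallness are tested on edges leaving the pattern only, which costs at most [wm]
    potential neighbours and makes them independent of the edges inside. *)
Lemma pattern_le (T : finType) (pt : T -> pattern n c) mm r s (q0 : R) : 0 <= q0 ->
  (forall t, (#|pW (pt t)| <= wm)%N) ->
  (forall t e, edge_expect p (fun o => (pQ (pt t) e o)%:R) <= q0) ->
  P (pattern_event Y0 Ce d0 th0 pt mm r s) <= #|T|%:R * (q0 ^+ mm * rho ^+ r * pi_ ^+ s).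
Proof.
move=> q00 hW hQ; have [p0 p1] := andP p01; have [x10 x11] := andP hx1; have [x20 x21] := andP hx2.
have rho0 : 0 <= rho by apply: le_trans hrho; rewrite divr_ge0 ?expR_ge0 // exprn_ge0 // ltW.
have pi0 : 0 <= pi_ by apply: le_trans hpi; rewrite divr_ge0 ?expR_ge0 // exprn_ge0 // ltW.
apply: le_trans (@prob_union_le R n c p p01 T (fun t => pattern_ok mm r s (pt t)) _
  (fun t f => pattern_in Y0 Ce d0 th0 f (pt t)) (q0 ^+ mm * rho ^+ r * pi_ ^+ s) _ _) _.
- by move=> f /existsP[t /andP[h1 h2]]; exists t.
- move=> t /and5P[RW SW dRS MW /and3P[/eqP Mm /eqP Rr /eqP Ss]].
  have L := @local_moment_bound R n c p p01 c0 _ _ _ Y0 Ce d0 th0 _ (pQ (pt t)) x1 x2 rho pi_ RW SW dRS MW hx1 hx2.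
  apply: le_trans (L _ _) _.
  + apply: le_trans hrho; rewrite ler_wpM2r ?invr_ge0 ?exprn_ge0 ?(ltW x10) // ler_expR lerN2 ler_wpM2l //.
      by rewrite mulr_ge0 ?subr_ge0 // divr_ge0 // mulr_ge0.
    rewrite lerBlDr -natrD ler_nat; apply: leq_trans (leq_add (leqnn _) (hW t)).
    rewrite -(cardsID (pW (pt t)) Y0) addnC leq_add2l; apply: subset_leq_card; exact: finset.subsetIr.
  + apply: le_trans hpi; rewrite ler_wpM2r ?invr_ge0 ?exprn_ge0 ?(ltW x20) // ler_expR lerN2 ler_wpM2l //.
      by rewrite mulr_ge0 ?subr_ge0.
    rewrite lerBlDr -natrD ler_nat; apply: leq_trans (leq_add (leqnn _) (hW t)).
    by rewrite -[X in (X <= _)%N](card_ord n) -(cardsC (pW (pt t))) addnC.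
  rewrite Rr Ss ler_wpM2r ?exprn_ge0 // ler_wpM2r ?exprn_ge0 //.
  rewrite -Mm -prodr_const; apply: ler_prod => e _; rewrite hQ andbT.
  by apply: edge_expect_ge0.
rewrite ler_wpM2r //; last by rewrite ler_nat max_card.
by rewrite !mulr_ge0 ?exprn_ge0.
Qed.

End Pat.

(** * The probability of the bad events *)

Section Final.
Variables (R : realType) (l n c c5 : nat) (p : R).
Notation L := (l%:R : R).
Notation N := (n%:R : R).
Notation a := (N * p).
Hypotheses (L3 : 1000 <= L) (nlo : expR (L ^+ 60) <= N) (nhi : N <= expR (2 * L ^+ 60)).
Hypotheses (plo : L ^+ 60 <= a) (phi : a <= 4 * L ^+ 60) (psm : N * expR (- a) <= 1).
Hypotheses (hc1 : (n + 4 * c5 <= c)%N) (hc2 : (c <= l * c5)%N) (hc3 : (c <= l * n)%N).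

(* All sizes are powers of [l] or fractions [n / l ^ i]. [lpow] is locked because the conversion test would
   otherwise unfold [l ^ 31] and the like into nested products. *)
Definition lpow i := locked (l ^ i)%N.
Lemma natr_lpow i : (lpow i)%:R = L ^+ i. Proof. by rewrite /lpow -lock natrX. Qed.
Definition frac i := (n %/ lpow i)%N.

Lemma N_ge i : (i <= 1000)%N -> L ^+ i <= N.
Proof.
move=> i1; apply: le_trans nlo; apply: le_trans (Lp_exp L3 i) _; rewrite ler_expR.
apply: le_trans (Lp_lt L3 (isT : (1 < 60)%N)); rewrite expr1 ler_wpM2r ?(ltW (L_gt0 L3)) //.
by rewrite ler_nat.
Qed.

Lemma N0 : 0 < N. Proof. exact: lt_le_trans (expR_gt0 _) nlo. Qed.

Lemma lpow_gt0 i : (0 < lpow i)%N. Proof. by rewrite -(@ltr0n R) natr_lpow Lp_gt0. Qed.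
Lemma p0 : 0 < p.
Proof. by rewrite -(pmulr_rgt0 _ N0); apply: lt_le_trans plo; exact: Lp_gt0. Qed.

Lemma frac_le i : (frac i)%:R * L ^+ i <= N.
Proof. by rewrite -natr_lpow -natrM ler_nat leq_trunc_div. Qed.

Lemma frac_gt0 i : (i <= 1000)%N -> (0 < frac i)%N.
Proof. by move=> i1; rewrite /frac divn_gt0 ?lpow_gt0 // -(@ler_nat R) natr_lpow N_ge. Qed.

Lemma frac_ge i : (i <= 1000)%N -> N <= 2 * (frac i)%:R * L ^+ i.
Proof.
move=> /frac_gt0 f0; rewrite -natr_lpow -!natrM ler_nat; apply: ltnW.
apply: leq_trans (ltn_ceil n (lpow_gt0 i)) _.
by rewrite leq_mul2r -/(frac i); apply/orP; right; move: f0; clear; lia.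
Qed.

Lemma p_half : p <= 2^-1.
Proof.
have h : 1000 * L ^+ 60 <= N.
  by apply: le_trans (Lp_lt L3 (isT : (60 < 61)%N)) (N_ge _).
rewrite -(ler_pM2l N0); apply: le_trans phi _.
by move: h (Lp_gt0 L3 60); lra.
Qed.

Lemma c0 : (0 < c)%N.
Proof. by apply: leq_trans hc1; rewrite addn_gt0 -(@ltr0n R) N0. Qed.
Lemma cN : N <= c%:R. Proof. by rewrite ler_nat; apply: leq_trans hc1; exact: leq_addr. Qed.
Lemma cR : 0 < c%:R :> R. Proof. by rewrite ltr0n c0. Qed.

Lemma c5_frac : 1 <= c5%:R / c%:R * L.
Proof. by rewrite mulrAC ler_pdivlMr ?cR // mul1r -natrM ler_nat mulnC. Qed.

Lemma a_exp : a <= expR (61%:R * L).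
Proof.
apply: le_trans phi _; apply: le_trans (Lp_exp L3 61).
by apply: le_trans (Lp_lt L3 (isT : (60 < 61)%N)); rewrite ler_wpM2r ?(ltW (Lp_gt0 L3 _)) //; lra.
Qed.

Lemma a_ge1 : 1 <= a. Proof. by apply: le_trans plo; exact: Lp_ge1. Qed.

Lemma card_init k m : (m <= k)%N -> #|[set v : 'I_k | (v < m)%N]%SET| = m.
Proof.
move=> mk; have wi : injective (widen_ord mk) by move=> x y /(congr1 val) xy; apply: val_inj.
rewrite -[RHS]card_ord -(card_imset _ wi).
apply: eq_card => v; rewrite inE; apply/idP/imsetP => [vm|[w _ ->]]; last by rewrite /= ltn_ord.
by exists (Ordinal vm) => //; apply: val_inj.
Qed.

Lemma card_range k m1 m2 : (m1 <= m2 <= k)%N -> #|[set v : 'I_k | (m1 <= v < m2)%N]%SET| = (m2 - m1)%N.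
Proof.
move=> /andP[m12 m2k].
have -> : [set v : 'I_k | (m1 <= v < m2)%N]%SET =
  ([set v : 'I_k | (v < m2)%N] :\: [set v : 'I_k | (v < m1)%N])%SET.
  by apply/setP => v; rewrite !inE -leqNgt.
rewrite cardsD card_init //; congr (_ - _)%N; rewrite -[RHS](card_init (leq_trans m12 m2k)); apply: eq_card => v.
by rewrite !inE; case vm: (v < m1)%N; rewrite ?andbF // andbT; apply: leq_trans vm m12.
Qed.

Definition Y0 := [set v : 'I_n | (0 <= v < frac 27)%N]%SET.
Definition Cb := [set k : 'I_c | (0 <= k < c5)%N]%SET.
Definition Ce := [set k : 'I_c | (c5 <= k < 2 * c5)%N]%SET.
Definition Cm := [set k : 'I_c | (2 * c5 <= k < c)%N]%SET.

Lemma card_Y0 : #|Y0| = frac 27.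
Proof. by rewrite card_range ?subn0 // leq_div. Qed.
Lemma card_Cb : #|Cb| = c5.
Proof. by rewrite card_range ?subn0 //; move: hc1; clear; lia. Qed.
Lemma card_Ce : #|Ce| = c5.
Proof. by rewrite card_range; move: hc1; clear; lia. Qed.
Lemma card_Cm : #|Cm| = (c - 2 * c5)%N.
Proof. by rewrite card_range; move: hc1; clear; lia. Qed.

(** A vertex expects at least about [L ^+ 32] edges coloured from [Ce] into [Y0], far more than
    [d0]. The value of [th0] is [L ^+ 29 + 2 * k], and [wm] bounds the number of vertices of every
    pattern. *)
Notation d0 := (lpow 31)%N.
Notation k := (3 * lpow 29)%N.
Notation th0 := (7 * lpow 29)%N.
Notation wm := (2 * k + 7)%N.
Definition rho : R := expR (- L ^+ 31).
(** Chernoff's bound for degree at most [th0], taken at [x = 1 / a]; the factor [expR 2] covers what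
    is lost in the exponent. *)
Definition pi_ : R := expR 2 * expR (- a) * a ^+ th0.

Lemma wm_le : wm%:R <= L ^+ 30.
Proof.
rewrite natrD natrM natrM natr_lpow; have := Lp_lt L3 (isT : (29 < 30)%N); have := Lp_ge1 L3 29; lra.
Qed.

Lemma pY0 : L ^+ 33 <= 2 * (p * (frac 27)%:R).
Proof.
have := frac_ge (isT : (27 <= 1000)%N); rewrite -(ler_pM2r p0) => h.
have := le_trans plo h; rewrite (_ : 60 = 33 + 27)%N // exprD => {}h.
rewrite -(ler_pM2r (Lp_gt0 L3 27)); apply: le_trans h _; lra.
Qed.

Lemma rho_tail : expR (- (p * #|Ce|%:R / c%:R * (1 - 2^-1) * (#|Y0|%:R - wm%:R))) / 2^-1 ^+ d0 <= rho.
Proof.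
rewrite card_Ce card_Y0 -exprVn invrK.
have h2 : 2 ^+ d0 <= expR (L ^+ 31).
  have -> : L ^+ 31 = 1 * (lpow 31)%:R by rewrite mul1r natr_lpow.
  rewrite expRM_natr lerXn2r ?nnegrE ?expR_ge0 //.
  by apply: le_trans (expR_ge1Dx 1); lra.
apply: le_trans (ler_wpM2l (expR_ge0 _) h2) _; rewrite -expRD ler_expR.
pose q : R := c5%:R / c%:R; have qL := c5_frac; rewrite -/q in qL.
have q0 : 0 <= q by rewrite divr_ge0.
have y1 : wm%:R <= (frac 27)%:R / 2 :> R.
  apply: le_trans wm_le _; rewrite ler_pdivlMr // -(ler_pM2r (Lp_gt0 L3 27)) -mulrA mulrCA -exprD.
  have := frac_ge (isT : (27 <= 1000)%N); have := N_ge (isT : (58 <= 1000)%N).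
  have := Lp_lt L3 (isT : (57 < 58)%N); have := Lp_gt0 L3 57; lra.
rewrite -[p * _ / _]mulrA -/q.
have h3 : L ^+ 33 <= 4 * (p * ((frac 27)%:R - wm%:R)).
  apply: le_trans pY0 _; rewrite -[4]/(2 * 2)%:R natrM -mulrA ler_pM2l // mulrCA ler_pM2l ?p0 //.
  by move: y1; lra.
have h4 : L ^+ 32 <= q * L ^+ 33 by rewrite [L ^+ 33]exprS mulrA ler_peMl // ltW // Lp_gt0.
have h5 := ler_wpM2l q0 h3.
have h6 := Lp_lt L3 (isT : (31 < 32)%N); have h7 := Lp_gt0 L3 31.
have h8 := le_trans h4 h5.
set z := q * (4 * _) in h8.
have -> : p * q * (1 - 2^-1) * ((frac 27)%:R - wm%:R) = z / 8 by rewrite /z; field.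
move: h6 h7 h8; lra.
Qed.

Lemma degree_exponent : a - 2 <= p * (1 - a^-1) * (N - wm%:R).
Proof.
have a0 : 0 < a by apply: lt_le_trans a_ge1.
have h : p * wm%:R <= 1.
  rewrite -(ler_pM2l N0) mulr1 mulrA.
  apply: le_trans (ler_wpM2l (ltW a0) wm_le) _; apply: le_trans (ler_wpM2r (ltW (Lp_gt0 L3 _)) phi) _.
  rewrite -mulrA -exprD; have := N_ge (isT : (91 <= 1000)%N); have := Lp_lt L3 (isT : (90 < 91)%N).
  have := Lp_gt0 L3 90; lra.
have h2 : a^-1 * a = 1 by rewrite mulVf // gt_eqF.
have h3 : 0 <= a^-1 * (p * wm%:R) by rewrite mulr_ge0 ?invr_ge0 ?(ltW a0) // mulr_ge0 ?(ltW p0).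
have -> : p * (1 - a^-1) * (N - wm%:R) = a - p * wm%:R - a^-1 * a + a^-1 * (p * wm%:R) by ring.
rewrite h2; move: h h3; lra.
Qed.

Lemma pi_tail : expR (- (p * (1 - a^-1) * (N - wm%:R))) / a^-1 ^+ th0 <= pi_.
Proof.
have a0 : 0 < a by apply: lt_le_trans a_ge1.
rewrite -exprVn invrK /pi_ -expRD ler_wpM2r ?exprn_ge0 ?(ltW a0) // ler_expR.
by have := degree_exponent; lra.
Qed.

Lemma a0 : 0 < a. Proof. exact: lt_le_trans a_ge1. Qed.
Lemma rho_ge0 : 0 <= rho. Proof. exact: expR_ge0. Qed.
Lemma pi_ge0 : 0 <= pi_. Proof. by rewrite !mulr_ge0 ?expR_ge0 // exprn_ge0 // ltW // a0. Qed.

Lemma a_pow_le m : a ^+ m <= expR (61%:R * L * m%:R).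
Proof. by rewrite expRM_natr lerXn2r ?nnegrE ?expR_ge0 ?(ltW a0) // a_exp. Qed.

(** As [N * expR (- a) <= 1], only the polynomial factor [a ^+ th0] remains of the expected number
    of small vertices. *)
Lemma N_pi_le : N * pi_ <= expR (500 * L ^+ 30).
Proof.
rewrite /pi_ mulrA mulrCA.
apply: (@le_trans _ _ (expR 2 * 1 * expR (61%:R * L * th0%:R))).
  apply: ler_pM; rewrite ?mulr_ge0 ?expR_ge0 ?exprn_ge0 ?(ltW a0) ?(ltW N0) //; last exact: a_pow_le.
  by rewrite ler_wpM2l ?expR_ge0.
rewrite mulr1 -expRD ler_expR natrM natr_lpow.
have -> : 61 * L * (7 * L ^+ 29) = 427 * L ^+ 30 by rewrite [L ^+ 30]exprS; ring.
have := Lp_ge1 L3 30; lra.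
Qed.

(** The [3] in [k] against the [2] in [nhi] decides; the powers of [a] contribute only
    [expR (366 * L ^+ 30)]. *)
Lemma spider_estimate : N * a ^+ (2 * k) * rho ^+ k <= expR (- L).
Proof.
apply: (@le_trans _ _ (expR (2 * L ^+ 60) * expR (61%:R * L * (2 * k)%:R) * rho ^+ k)).
  rewrite ler_wpM2r ?exprn_ge0 ?expR_ge0 // ler_pM ?(ltW N0) ?exprn_ge0 ?(ltW a0) //.
  exact: a_pow_le.
rewrite /rho -expRM_natr -!expRD ler_expR natrM natrM natr_lpow.
have -> : 61 * L * (2 * (3 * L ^+ 29)) = 366 * L ^+ 30 by rewrite [L ^+ 30]exprS; ring.
have -> : - L ^+ 31 * (3 * L ^+ 29) = - (3 * L ^+ 60) by rewrite (_ : 60 = 31 + 29)%N // exprD; ring.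
have := Lp_lt L3 (isT : (30 < 60)%N); have := Lp_lt L3 (isT : (1 < 60)%N); have := Lp_ge1 L3 60.
rewrite expr1; lra.
Qed.

(** A single poor vertex, at the price [expR (- L ^+ 31)], already outweighs the bound
    [expR (500 * L ^+ 30)] on the number of small vertices. *)
Lemma small_poor_estimate : a ^+ 2 * rho * (N * pi_) <= expR (- L).
Proof.
apply: (@le_trans _ _ (expR (61%:R * L * 2%:R) * rho * expR (500 * L ^+ 30))).
  apply: ler_pM; rewrite ?mulr_ge0 ?expR_ge0 ?exprn_ge0 ?(ltW a0) ?(ltW N0) ?(ltW p0) ?pi_ge0 ?rho_ge0 ?N_pi_le //.
  by rewrite ler_wpM2r ?rho_ge0 // a_pow_le.
rewrite /rho -!expRD ler_expR.
have := Lp_lt L3 (isT : (30 < 31)%N); have := Lp_lt L3 (isT : (1 < 31)%N); have := Lp_ge1 L3 31.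
rewrite expr1; lra.
Qed.

Lemma repeat_estimate : a ^+ 4 * expR (500 * L ^+ 30) ^+ 2 <= N * expR (- L).
Proof.
rewrite -expRM_natr; apply: (@le_trans _ _ (expR (61%:R * L * 4%:R) * expR (500 * L ^+ 30 * 2%:R))).
  by rewrite ler_wpM2r ?expR_ge0 // a_pow_le.
apply: le_trans (ler_wpM2r (expR_ge0 _) nlo); rewrite -!expRD ler_expR.
have := Lp_lt L3 (isT : (30 < 60)%N); have := Lp_lt L3 (isT : (1 < 60)%N); have := Lp_lt L3 (isT : (31 < 60)%N).
have := Lp_lt L3 (isT : (30 < 31)%N).
have := Lp_ge1 L3 60.
rewrite expr1; lra.
Qed.

Let p01 : 0 <= p <= 1.
Proof. by rewrite (ltW p0) (le_trans p_half) //; lra. Qed.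
Let x1P : 0 < (2^-1 : R) <= 1. Proof. by lra. Qed.
Let x2P : 0 < a^-1 <= 1. Proof. by rewrite invr_gt0 a0 invf_le1 ?a0 // a_ge1. Qed.
Notation P := (@Gc_prob R n c p).
Notation pev := (pattern_event Y0 Ce d0 th0).

Lemma local_pattern_le (T : finType) (pt : T -> pattern n c) mm r s (q0 : R) : 0 <= q0 ->
  (forall t, (#|pW (pt t)| <= wm)%N) ->
  (forall t e, edge_expect p (fun o => (pQ (pt t) e o)%:R) <= q0) ->
  P (pev pt mm r s) <= #|T|%:R * (q0 ^+ mm * rho ^+ r * pi_ ^+ s).
Proof. by move=> h1 h2 h3; apply: (pattern_le p01 c0 x1P x2P rho_tail pi_tail). Qed.

Lemma cardU1_le (T : finType) (A : {set T}) x m : (#|A| <= m)%N -> (#|A :|: [set x]%SET| <= m.+1)%N.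
Proof. by move=> h; apply: leq_trans (finset.leq_card_setU _ _).1 _; rewrite cards1 addn1. Qed.

Lemma card_ffun_image_le (b : {ffun 'I_k -> 'I_n}) : (#|ffun_image b| <= k)%N.
Proof. by apply: leq_trans (leq_imset_card _ _) _; rewrite card_ord. Qed.

Lemma star_pattern_le : P (pev (@star_pattern n c k) k k 0) <= expR (- L).
Proof.
apply: le_trans (local_pattern_le (q0 := p) _ _ _ _ _ _) _; first exact: ltW p0.
- move=> [z b] /=; apply: leq_trans (finset.leq_card_setU _ _).1 _; rewrite cards1.
  have := card_ffun_image_le b; clear; lia.
- by move=> t e; rewrite (edge_expect_present p c0).
rewrite card_prod card_ffun !card_ord natrM natrX expr0 mulr1 !mulrA -(mulrA N) -exprMn.
apply: le_trans spider_estimate; rewrite ler_wpM2r ?exprn_ge0 ?rho_ge0 // ler_wpM2l ?(ltW N0) //.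
by rewrite ler_weXn2l ?a_ge1 // leq_pmull.
Qed.

Lemma spider_pattern_le : P (pev (@spider_pattern n c k) (2 * k) k 0) <= expR (- L).
Proof.
apply: le_trans (local_pattern_le (q0 := p) _ _ _ _ _ _) _; first exact: ltW p0.
- move=> [[z x] b] /=; apply: leq_trans (finset.leq_card_setU _ _).1 _; rewrite cards1.
  have h := (finset.leq_card_setU (ffun_image x) (ffun_image b)).1.
  have := card_ffun_image_le x; have := card_ffun_image_le b; move: h; clear; lia.
- by move=> t e; rewrite (edge_expect_present p c0).
rewrite !card_prod !card_ffun !card_ord !natrM !natrX expr0 mulr1 !mulrA -(mulrA N) -exprD addnn -mul2n -(mulrA N) -exprMn.
exact: spider_estimate.
Qed.

Lemma small_poor_edge_le : P (pev (@small_poor_edge n c) 1 1 1) <= expR (- L).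
Proof.
apply: le_trans (local_pattern_le (q0 := p) _ _ _ _ _ _) _; first exact: ltW p0.
- by move=> [z b] /=; apply: (@leq_trans 2); [do !apply: cardU1_le; rewrite cards1|clear; lia].
- by move=> t e; rewrite (edge_expect_present p c0).
rewrite !card_prod !card_ord natrM !expr1; apply: le_trans small_poor_estimate.
have -> : N * N * (p * rho * pi_) = a * (rho * (N * pi_)) by ring.
rewrite -[leRHS]mulrA; apply: ler_wpM2r; last by rewrite expr2 ler_peMl ?(ltW a0) // a_ge1.
exact: mulr_ge0 rho_ge0 (mulr_ge0 (ltW N0) pi_ge0).
Qed.

Lemma small_poor_path_le : P (pev (@small_poor_path n c) 2 1 1) <= expR (- L).
Proof.
apply: le_trans (local_pattern_le (q0 := p) _ _ _ _ _ _) _; first exact: ltW p0.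
- by move=> [[z x] b] /=; apply: (@leq_trans 3); [do !apply: cardU1_le; rewrite cards1|clear; lia].
- by move=> t e; rewrite (edge_expect_present p c0).
rewrite !card_prod !card_ord !natrM !expr1; apply: le_trans small_poor_estimate.
by have -> : N * N * N * (p ^+ 2 * rho * pi_) = a ^+ 2 * rho * (N * pi_) by ring.
Qed.

(** After summing over all vertices and colours, repeated colours still cost a factor [w] of order
    [1 / N], against which degrees and the expected number of small vertices are negligible. *)
Lemma repeat_estimate_le i j (w : R) : (i <= 4)%N -> (j <= 2)%N -> 0 <= w -> w <= N^-1 ->
  a ^+ i * (N * pi_) ^+ j * w <= expR (- L).
Proof.
move=> i4 j2 w0 wN; have Np0 : 0 <= N * pi_ := mulr_ge0 (ltW N0) pi_ge0.
have PI1 : 1 <= expR (500 * L ^+ 30).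
  by apply: le_trans (expR_ge1Dx _); have := Lp_gt0 L3 30; lra.
apply: (@le_trans _ _ (a ^+ 4 * expR (500 * L ^+ 30) ^+ 2 * N^-1)); last first.
  by rewrite ler_pdivrMr ?N0 // [leRHS]mulrC; exact: repeat_estimate.
apply: ler_pM => //; first by rewrite mulr_ge0 ?exprn_ge0 // ltW // a0.
apply: ler_pM; rewrite ?exprn_ge0 // ?(ltW a0) //; first by rewrite ler_weXn2l // a_ge1.
apply: le_trans (_ : expR (500 * L ^+ 30) ^+ j <= _); last by rewrite ler_weXn2l.
by rewrite lerXn2r ?nnegrE ?expR_ge0 // N_pi_le.
Qed.

Lemma Ncc : N / c%:R ^+ 2 <= N^-1.
Proof.
rewrite ler_pdivrMr ?exprn_gt0 ?cR // ler_pdivlMl ?N0 // -expr2.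
by rewrite lerXn2r ?nnegrE ?(ltW N0) ?(ltW cR) ?cN.
Qed.

Let cne : c%:R != 0 :> R. Proof. by rewrite gt_eqF // cR. Qed.
Let q0 : 0 <= p / c%:R. Proof. by rewrite divr_ge0 // ltW // ?p0 ?cR. Qed.

Lemma repeat_at_one_le : P (pev (@repeat_at_one n c) 2 0 1) <= expR (- L).
Proof.
apply: le_trans (local_pattern_le _ _ _ q0 _ _) _.
- by move=> [[[v x1] x2] k0] /=; apply: (@leq_trans 3); [do !apply: cardU1_le; rewrite cards1|clear; lia].
- by move=> [[[v x1] x2] k0] e; rewrite /= /col edge_expect_some.
rewrite !card_prod !card_ord !natrM.
have -> : N * N * N * c%:R * ((p / c%:R) ^+ 2 * rho ^+ 0 * pi_ ^+ 1) = a ^+ 2 * (N * pi_) ^+ 1 * c%:R^-1.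
  by field.
by apply: repeat_estimate_le; rewrite ?invr_ge0 ?(ltW cR) // lef_pV2 ?posrE ?N0 ?cR // cN.
Qed.

Lemma repeat_at_two_le : P (pev (@repeat_at_two n c) 2 0 2) <= expR (- L).
Proof.
apply: le_trans (local_pattern_le _ _ _ q0 _ _) _.
- by move=> [[[[v x1] v2] x2] k0] /=; apply: (@leq_trans 4); [do !apply: cardU1_le; rewrite cards1|clear; lia].
- by move=> [[[[v x1] v2] x2] k0] e; rewrite /= /col edge_expect_some.
rewrite !card_prod !card_ord !natrM.
have -> : N * N * N * N * c%:R * ((p / c%:R) ^+ 2 * rho ^+ 0 * pi_ ^+ 2) = a ^+ 2 * (N * pi_) ^+ 2 * c%:R^-1.
  by field.
by apply: repeat_estimate_le; rewrite ?invr_ge0 ?(ltW cR) // lef_pV2 ?posrE ?N0 ?cR // cN.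
Qed.

Lemma share_at_one_le : P (pev (@share_at_one n c) 4 0 1) <= expR (- L).
Proof.
apply: le_trans (local_pattern_le _ _ _ q0 _ _) _.
- by move=> [[[[[[[z x1] x2] v1] w1] w2] k1] k2] /=; apply: (@leq_trans 7); [do !apply: cardU1_le; rewrite cards1|clear; lia].
- by move=> [[[[[[[z x1] x2] v1] w1] w2] k1] k2] e; rewrite /= /col; case: ifP => _; rewrite edge_expect_some.
rewrite !card_prod !card_ord !natrM.
have -> : N * N * N * N * N * N * c%:R * c%:R * ((p / c%:R) ^+ 4 * rho ^+ 0 * pi_ ^+ 1) =
  a ^+ 4 * (N * pi_) ^+ 1 * (N / c%:R ^+ 2) by field.
by apply: repeat_estimate_le Ncc => //; rewrite divr_ge0 ?exprn_ge0 ?(ltW N0) ?(ltW cR).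
Qed.

Lemma share_at_two_le : P (pev (@share_at_two n c) 4 0 2) <= expR (- L).
Proof.
apply: le_trans (local_pattern_le _ _ _ q0 _ _) _.
- by move=> [[[[[[[[z x1] x2] v1] w1] v2] w2] k1] k2] /=; apply: (@leq_trans 7); [do !apply: cardU1_le; rewrite cards1|clear; lia].
- by move=> [[[[[[[[z x1] x2] v1] w1] v2] w2] k1] k2] e; rewrite /= /col; case: ifP => _; rewrite edge_expect_some.
rewrite !card_prod !card_ord !natrM.
have -> : N * N * N * N * N * N * N * c%:R * c%:R * ((p / c%:R) ^+ 4 * rho ^+ 0 * pi_ ^+ 2) =
  a ^+ 4 * (N * pi_) ^+ 2 * (N / c%:R ^+ 2) by field.
by apply: repeat_estimate_le Ncc => //; rewrite divr_ge0 ?exprn_ge0 ?(ltW N0) ?(ltW cR).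
Qed.

Lemma prob_poor v : P (fun f => v \in poor_set Y0 Ce d0 f) <= rho.
Proof.
pose pt (_ : unit) : pattern n c := Pattern [set v]%SET [set v]%SET finset.set0 finset.set0 (fun _ _ => true).
have := @local_pattern_le _ pt 0 1 0 1 ler01; rewrite card_unit mul1r !expr0 expr1 mul1r mulr1 => H.
apply: le_trans (le_trans _ (H _ _)) _; last first.
- exact: lexx.
- by move=> t e; have := edge_expect1 p c0 => ->.
- by move=> t /=; rewrite cards1 addnS.
apply: prob_le => // f vB; apply/existsP; exists tt; apply/andP; split.
  rewrite /pattern_ok /= !finset.sub0set fintype.subxx !cards0 cards1 !eqxx !andbT.
  by rewrite -finset.setI_eq0 finset.setI0 eqxx.
rewrite /pattern_in /= finset.sub1set vB finset.sub0set !andbT.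
by apply/forallP => e; rewrite finset.in_set0.
Qed.

Notation bb := (frac 70).

Lemma many_bad_bound : P (fun f => (bb < #|poor_set Y0 Ce d0 f|)%N) <= expR (- L).
Proof.
apply: le_trans (many_bad_le p0 p_half (frac_gt0 (isT : (70 <= 1000)%N)) prob_poor) _.
have b0 : 0 < bb%:R :> R by rewrite ltr0n frac_gt0.
rewrite ler_pdivrMr //; apply: le_trans (ler_wpM2r rho_ge0 (frac_ge (isT : (70 <= 1000)%N))) _.
rewrite (_ : 2 * _ * _ * _ = 2 * L ^+ 70 * rho * bb%:R); last by ring.
rewrite ler_pM2r //.
apply: (@le_trans _ _ (expR (1 * L) * expR (70%:R * L) * rho)).
  rewrite ler_wpM2r ?rho_ge0 // ler_pM ?(ltW (Lp_gt0 L3 _)) //; last exact: Lp_exp.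
  by rewrite mul1r; apply: le_trans (expR_ge1Dx _); move: L3; lra.
rewrite /rho -!expRD ler_expR; have := Lp_lt L3 (isT : (1 < 31)%N); have := Lp_gt0 L3 31; rewrite expr1; lra.
Qed.

Lemma expR2_le16 : expR 2 <= 16 :> R.
Proof.
have -> : expR 2 = expR 1 * expR 1 :> R by rewrite -expRD.
by apply: (@le_trans _ _ (4 * 4)); [apply: ler_pM; rewrite ?expR_ge0 // expR1_le4|lra].
Qed.

(* The only bound that is not exponentially small in [L]: it is where the term [ln (ln n)] of [p] is needed. *)
Lemma low_degree_bound : P (@low_degree n c) <= 16 * (N * a * expR (- a)).
Proof.
apply: le_trans (@prob_union_le R n c p p01 'I_n predT _
  (fun v f => (cnt finset.setT (star v finset.setT) f <= 1)%N) (16 * (a * expR (- a))) _ _) _.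
- by move=> f /existsP[v h]; exists v.
- move=> v _; have [x20 x21] := andP x2P.
  apply: le_trans (@tail_le R n c p p01 c0 finset.setT (star v finset.setT) 1 a^-1 x20 x21) _.
  rewrite expr1 invrK cardsT card_ord mulfK //.
  rewrite [leLHS]mulrC [leRHS]mulrCA ler_pM2l ?a0 //.
  apply: le_trans (_ : expR (2 + - a) <= _); last by rewrite expRD ler_wpM2r ?expR_ge0 ?expR2_le16.
  rewrite ler_expR; have h := degree_exponent.
  suff h2 : p * (1 - a^-1) * (N - wm%:R) <= p * (1 - a^-1) * #|star v finset.setT|%:R.
    by move: (le_trans h h2); lra.
  rewrite ler_wpM2l ?mulr_ge0 ?(ltW p0) ?subr_ge0 // lerBlDr -natrD ler_nat.
  have h1 : (#|star v (~: [set v]%SET)| <= #|star v finset.setT|)%N.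
    apply: subset_leq_card; apply/fintype.subsetP => e /starP[y _ E].
    by apply/starP; exists y; rewrite ?finset.in_setT.
  move: h1; rewrite card_star ?finset.in_setC ?finset.in_set1 ?eqxx //.
  have hn : n = (1 + #|~: [set v]%SET|)%N by rewrite -(cards1 v) cardsC card_ord.
  move: hn; move: #|star _ _| #|~: _| => x y; clear; lia.
by rewrite card_ord !mulrA [N * 16]mulrC.
Qed.

Lemma nat_le_n (x : nat) i : (i <= 1000)%N -> x%:R <= L ^+ i -> (x <= n)%N.
Proof. by move=> i1 h; rewrite -(ler_nat R); apply: le_trans h (N_ge i1). Qed.

Lemma crowded_small_bound : P (crowded S (2 * k + 3)%N) <= expR (- L).
Proof.
have u1 : (2 * k + 3)%:R <= 7 * L ^+ 29.
  by rewrite natrD natrM natrM natr_lpow; have := Lp_lt L3 (isT : (0 < 29)%N); rewrite expr0; lra.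
have u2 : (2 * k + 3)%:R <= L ^+ 30.
  by apply: le_trans u1 _; have := Lp_lt L3 (isT : (29 < 30)%N); have := Lp_gt0 L3 29; lra.
have pu : p * (2 * k + 3)%:R <= 1.
  rewrite -(ler_pM2l N0) mulr1 mulrA; apply: le_trans (ler_wpM2l (ltW a0) u2) _.
  apply: le_trans (ler_wpM2r (ltW (Lp_gt0 L3 _)) phi) _.
  rewrite -mulrA -exprD; have := N_ge (isT : (91 <= 1000)%N); have := Lp_lt L3 (isT : (90 < 91)%N).
  have := Lp_gt0 L3 90; lra.
apply: le_trans (crowded_small_le p0 p_half c0 (nat_le_n (isT : (30 <= 1000)%N) u2) pu a_exp _) _.
  by rewrite mulr_ge0 // ltW // (L_gt0 L3).
rewrite -(ler_pM2l N0).
have -> : N * (((2 * k + 3) ^ 2)%:R * p * expR ((2 + 61 * L) * (2 * k + 3)%:R)) =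
  a * ((2 * k + 3) ^ 2)%:R * expR ((2 + 61 * L) * (2 * k + 3)%:R) by ring.
apply: (@le_trans _ _ (expR (61%:R * L) * expR (60%:R * L) * expR ((2 + 61 * L) * (7 * L ^+ 29)))).
  apply: ler_pM; rewrite ?mulr_ge0 ?expR_ge0 ?(ltW N0) ?(ltW p0) //.
    apply: ler_pM; rewrite ?(ltW a0) ?a_exp //.
    apply: le_trans (Lp_exp L3 60); rewrite natrX (_ : 60 = 30 * 2)%N // exprM.
    by rewrite lerXn2r ?nnegrE // ltW // Lp_gt0.
  by rewrite ler_expR ler_wpM2l //; have := L_gt0 L3; lra.
apply: le_trans (ler_wpM2r (expR_ge0 _) nlo); rewrite -!expRD ler_expR.
have -> : (2 + 61 * L) * (7 * L ^+ 29) = 14 * L ^+ 29 + 427 * L ^+ 30 by rewrite [L ^+ 30]exprS; ring.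
have := Lp_lt L3 (isT : (29 < 60)%N); have := Lp_lt L3 (isT : (30 < 60)%N).
have := Lp_lt L3 (isT : (1 < 60)%N); have := Lp_gt0 L3 60; have := Lp_gt0 L3 29; have := Lp_gt0 L3 30; rewrite expr1; lra.
Qed.

Lemma p_frac_le i j : (60 = i + j)%N -> p * (frac i)%:R <= 4 * L ^+ j.
Proof.
move=> ij; rewrite -(ler_pM2r (Lp_gt0 L3 i)) -!mulrA -exprD (addnC j) -ij.
apply: le_trans phi; rewrite mulrC; rewrite ler_pM2r ?p0 //; exact: frac_le.
Qed.

Lemma exp_poly (x : R) i : x <= 4 * L ^+ i -> (i <= 60)%N -> expR 1 * x <= expR (64 * L).
Proof.
move=> xi i60; apply: (@le_trans _ _ (4 * (4 * L ^+ 60))).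
  apply: (@le_trans _ _ (4 * (4 * L ^+ i))); last by rewrite !ler_pM2l // ler_weXn2l // (L_ge1 L3).
  apply: (@le_trans _ _ (expR 1 * (4 * L ^+ i))); first by rewrite ler_pM2l ?expR_gt0.
  by rewrite ler_pM2r ?expR1_le4 // mulr_gt0 // Lp_gt0.
apply: le_trans (le_trans (_ : _ <= L ^+ 61) (Lp_exp L3 61)) _.
  by have := Lp_lt L3 (isT : (60 < 61)%N); have := Lp_gt0 L3 60; lra.
by rewrite ler_expR; have := L_gt0 L3; lra.
Qed.

Lemma nc : (n <= c)%N. Proof. by move: hc1; clear; lia. Qed.

Lemma natr_lt (x y : nat) : (x%:R : R) < y%:R -> (x < y)%N. Proof. by rewrite ltr_nat. Qed.

(** The parameter [4 * L ^+ 32] is the bound [4 * L ^+ 60] on [N * p] divided by [L ^+ 28]; sets of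
    at most [n / L ^+ 70] vertices leave ample room for it. *)
Lemma colour_dense_all_bound : P (colour_dense finset.setT 5 (lpow 28) (frac 70)) <= 2 * expR (- L).
Proof.
have l1 := Lp_lt L3 (isT : (1 < 28)%N); have l0 := Lp_lt L3 (isT : (0 < 1)%N); rewrite expr0 expr1 in l0 l1.
have mu5 : (5 < lpow 28)%N by apply: natr_lt; rewrite natr_lpow; lra.
apply: (@colour_dense_le R n c p (ltW p0) p_half c0 finset.setT 5 (lpow 28) (frac 70) (4 * L ^+ 32) (64 * L) L nc isT mu5).
- by have := Lp_ge1 L3 32; lra.
- by rewrite cardsT card_ord mulrC natr_lpow -mulrA -exprD.
- apply: le_trans cN; apply: le_trans (frac_le 70); rewrite natrM [leRHS]mulrC mulrA ler_wpM2r //.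
  apply: (@le_trans _ _ (16 * (4 * L ^+ 32) * 5)).
    by rewrite ler_wpM2r // ler_wpM2r ?expR2_le16 // mulr_ge0 // ltW // Lp_gt0.
  by have := Lp_lt L3 (isT : (32 < 70)%N); have := Lp_gt0 L3 32; lra.
- exact: exp_poly (lexx _) _.
- exact: L_ge1 L3.
- by have := L_gt0 L3; lra.
- by rewrite natrB // natr_lpow; lra.
Qed.

(** Here [p * #|Y0|] is at most [4 * L ^+ 33], that is [4 * L ^+ 3] times [L ^+ 30]. A violating set
    of ports uses up to order [L ^+ 22 * n / L ^+ 27] colours, and [L ^+ 3] times this number must
    stay below [c], which holds since [25 < 27]. *)
Lemma colour_dense_Y0_bound : P (colour_dense Y0 (6 * lpow 22 + 1) (lpow 30) (2 * frac 27)) <= 2 * expR (- L).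
Proof.
have l1 := Lp_lt L3 (isT : (22 < 30)%N); have l0 := Lp_lt L3 (isT : (0 < 22)%N); rewrite expr0 in l0.
have l2 := Lp_lt L3 (isT : (1 < 30)%N); have l3 := Lp_lt L3 (isT : (23 < 30)%N); rewrite expr1 in l2.
have mu7 : (6 * lpow 22 + 1 < lpow 30)%N by apply: natr_lt; rewrite natrD natrM !natr_lpow; lra.
have j0 : (0 < 6 * lpow 22 + 1)%N by rewrite addn1.
apply: (@colour_dense_le R n c p (ltW p0) p_half c0 Y0 (6 * lpow 22 + 1) (lpow 30) (2 * frac 27) (4 * L ^+ 3) (64 * L) L nc j0 mu7).
- by have := Lp_ge1 L3 3; lra.
- by rewrite card_Y0 natr_lpow -mulrA -exprD; exact: p_frac_le.
- apply: le_trans cN; apply: le_trans (frac_le 27); rewrite !natrM natrD natrM natr_lpow.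
  rewrite (_ : expR 2 * _ * _ = expR 2 * (4 * L ^+ 3 * (6 * L ^+ 22 + 1) * 2) * (frac 27)%:R); last by ring.
  rewrite [leRHS]mulrC ler_wpM2r //.
  have h3 := Lp_gt0 L3 3; have h22 := Lp_gt0 L3 22.
  apply: (@le_trans _ _ (16 * (4 * L ^+ 3 * (6 * L ^+ 22 + 1) * 2))).
    by rewrite ler_wpM2r ?expR2_le16 // !mulr_ge0 // ?addr_ge0 ?mulr_ge0 // ltW.
  apply: (@le_trans _ _ (16 * (4 * L ^+ 3 * (7 * L ^+ 22) * 2))).
    have h : L ^+ 3 * (6 * L ^+ 22 + 1) <= L ^+ 3 * (7 * L ^+ 22) by apply: ler_wpM2l; [exact: ltW|move: l0; lra].
    by move: h; lra.
  rewrite (_ : 16 * _ = 896 * L ^+ 25); last by rewrite (_ : 25 = 3 + 22)%N // exprD; ring.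
  by have := Lp_lt L3 (isT : (25 < 27)%N); have := Lp_gt0 L3 25; lra.
- exact: exp_poly (lexx _) _.
- exact: L_ge1 L3.
- by have := L_gt0 L3; lra.
- rewrite natrB //; set u := L ^+ 22 in l1 l0.
  have -> : (6 * lpow 22 + 1).+1%:R = 6 * u + 2 by rewrite -addn1 -addnA natrD natrM natr_lpow.
  have -> : (2 * (6 * lpow 22 + 1))%:R = 12 * u + 2 by rewrite natrM natrD natrM natr_lpow; rewrite -/u; ring.
  rewrite natr_lpow (_ : (6 * u + 2) * (64 * L) = 384 * L ^+ 23 + 128 * L); last by rewrite /u [L ^+ 23]exprS; ring.
  move: l0 l1 l2 l3 (Lp_gt0 L3 23) (L_gt0 L3); lra.
Qed.

(** In sets of [3 * n / L ^+ 40] vertices the expected degrees are of order at most [L ^+ 20], well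
    below [L ^+ 22]. *)
Lemma crowded_bound : P (crowded (fun u => lpow 22 * u)%N (3 * frac 40)) <= 2 * expR (- L).
Proof.
have l0 := Lp_lt L3 (isT : (1 < 22)%N); rewrite expr1 in l0.
apply: (@crowded_le R n c p p0 p_half c0 (lpow 22) (3 * frac 40) (61 * L) L).
- exact: lpow_gt0.
- rewrite -(ler_nat R) natrM; apply: le_trans (frac_le 40); rewrite mulrC ler_wpM2l //.
  by have := Lp_lt L3 (isT : (0 < 40)%N); rewrite expr0; lra.
- rewrite natrM mulrA [_ * p * 3]mulrAC -[_ * 3 * p * _]mulrA natr_lpow.
  have h := p_frac_le (erefl : 60 = (40 + 20)%N).
  apply: (@le_trans _ _ (expR 2 * 3 * (4 * L ^+ 20))); first by rewrite ler_wpM2l ?mulr_ge0 ?expR_ge0.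
  apply: (@le_trans _ _ (16 * 3 * (4 * L ^+ 20))).
    by rewrite !ler_wpM2r ?expR2_le16 // mulr_ge0 // ltW // Lp_gt0.
  by have := Lp_lt L3 (isT : (20 < 22)%N); have := Lp_gt0 L3 20; lra.
- exact: a_exp.
- have := lpow_gt0 22; case: (lpow 22) (natr_lpow 22) => // x E _ /=.
  by move: E; rewrite -addn1 natrD; move: l0 L3; lra.
- exact: L_ge1 L3.
Qed.

Let q : R := c5%:R / c%:R.

Lemma p_frac_ge i j : (60 = i + j)%N -> L ^+ j <= 2 * (p * (frac i)%:R).
Proof.
move=> ij; have i1 : (i <= 1000)%N by move: ij; clear; lia.
have := frac_ge i1; rewrite -(ler_pM2r p0) => h.
have := le_trans plo h; rewrite ij addnC exprD => {}h.
rewrite -(ler_pM2r (Lp_gt0 L3 i)); apply: le_trans h _; lra.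
Qed.

Lemma p_frac_sqr_ge i j : (60 = i + j)%N -> L ^+ j * N <= 4 * L ^+ i * (L * (p * q * (frac i)%:R ^+ 2)).
Proof.
move=> ij; have i1 : (i <= 1000)%N by move: ij; clear; lia.
have h1 := p_frac_ge ij; have h2 := frac_ge i1; have h3 := c5_frac; rewrite -/q in h3.
apply: (@le_trans _ _ ((2 * (p * (frac i)%:R)) * (2 * (frac i)%:R * L ^+ i))).
  by apply: ler_pM; rewrite ?(ltW N0) // ltW // Lp_gt0.
rewrite [leLHS](_ : _ = (4 * L ^+ i * (p * (frac i)%:R ^+ 2)) * 1); last by ring.
rewrite [leRHS](_ : _ = (4 * L ^+ i * (p * (frac i)%:R ^+ 2)) * (q * L)); last by ring.
by rewrite ler_wpM2l // !mulr_ge0 ?exprn_ge0 ?(ltW p0) ?(ltW (L_gt0 L3)).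
Qed.

(** Since [60 - 1 - 2 * 28 = 3], the exponent gained is at least of order [L ^+ 3 * N], whereas the
    union bound costs [2 * n + c] with [c <= L * N]. *)
Lemma unlinked_bound : P (unlinked (frac 28) c5) <= expR (- L).
Proof.
apply: le_trans (unlinked_le n p0 p_half c0 _ _) _; rewrite ler_expR.
have := p_frac_sqr_ge (erefl : 60 = (28 + 32)%N); rewrite (_ : p * q = p * c5%:R / c%:R); last by rewrite mulrA.
rewrite natrX; set T := p * _ / _ * _ ^+ 2 => h.
have h1 : L ^+ 3 * N <= 4 * T.
  rewrite -(ler_pM2l (Lp_gt0 L3 29)) mulrA -exprD; apply: le_trans h _.
  by rewrite [L ^+ 29]exprS; lra.
rewrite natrD natrM [X in _ - X](_ : _ = T / 2); last by rewrite /T; ring.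
have h2 : (c%:R : R) <= L * N by rewrite -natrM ler_nat.
have h3 : L <= N by have := N_ge (isT : (1 <= 1000)%N); rewrite expr1.
have h4 : 1000 * (L * N) <= L ^+ 3 * N.
  by rewrite mulrA ler_wpM2r ?(ltW N0) //; have := Lp_lt L3 (isT : (1 < 3)%N); rewrite expr1.
have h5 : 1000 * N <= L * N by rewrite ler_wpM2r // ltW // N0.
move: h1 h2 h3 h4 h5 (L_gt0 L3) N0; lra.
Qed.

Lemma many_edges_bound : P (fun f => (n * lpow 61 <= cnt finset.setT finset.setT f)%N) <= expR (- L).
Proof.
apply: le_trans (many_edges_le n p0 p_half c0 _) _.
have h2 : (2 ^+ (n * lpow 61))^-1 <= expR (- (N * L ^+ 61 / 2)) :> R.
  rewrite expRN lef_pV2 ?posrE ?exprn_gt0 ?expR_gt0 //.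
  rewrite (_ : N * L ^+ 61 / 2 = 2^-1 * (n * lpow 61)%:R); last by rewrite natrM natr_lpow mulrC.
  by rewrite expRM_natr lerXn2r ?nnegrE ?expR_ge0 // expRhalf_le2.
apply: le_trans (ler_wpM2l (expR_ge0 _) h2) _; rewrite -expRD ler_expR natrX.
rewrite (_ : p * 2 * N ^+ 2 = 2 * a * N); last by ring.
have h3 : 2 * a * N <= 2 * (4 * L ^+ 60) * N by rewrite ler_wpM2r ?(ltW N0) // ler_wpM2l.
have h4 : 1000 * L ^+ 60 * N <= L ^+ 61 * N by rewrite ler_wpM2r ?(ltW N0) // Lp_lt.
have h5 : 1 * N <= L ^+ 60 * N by rewrite ler_wpM2r ?(ltW N0) // Lp_ge1.
have h6 : L <= N by have := N_ge (isT : (1 <= 1000)%N); rewrite expr1.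
move: h3 h4 h5 h6 (L_gt0 L3); lra.
Qed.

Lemma frac_pow_le i j : (j < i)%N -> 1000 * (L ^+ j * (frac i)%:R) <= N.
Proof.
by move=> ji; apply: le_trans (frac_le i); rewrite mulrA mulrC ler_wpM2l // Lp_lt.
Qed.

Lemma dis_me : [disjoint Cm & Ce].
Proof. by apply/disjP => k0; rewrite !inE => /andP[h _]; rewrite negb_and -!leqNgt h orbT. Qed.
Lemma dis_mb : [disjoint Cm & Cb].
Proof. by apply/disjP => k0; rewrite !inE /= -leqNgt; clear; lia. Qed.
Lemma dis_eb : [disjoint Ce & Cb].
Proof. by apply/disjP => k0; rewrite !inE /= -leqNgt => /andP[]. Qed.

Notation sg := (frac 40).
Notation s7 := (2 * frac 27)%N.
Notation ff := (lpow 29 * frac 70)%N.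

Lemma LN_c5 : N <= L * c5%:R.
Proof. by apply: le_trans cN _; rewrite -natrM ler_nat. Qed.

Lemma LL_N : 1000 * (1000 * L) <= N.
Proof.
apply: le_trans (N_ge (isT : (3 <= 1000)%N)).
have h1 := Lp_lt L3 (isT : (1 < 2)%N); have h2 := Lp_lt L3 (isT : (2 < 3)%N); rewrite expr1 in h1.
by move: h1 h2; lra.
Qed.

(** There are at least [N / L] colours in [Cb]; the base spends at most [L ^+ 29 * n / L ^+ 70] of
    them, and each recorded booster one more. *)
Lemma forb_small g h : (#|supp h| <= s7.+1)%N ->
  (2 * #|forb_col Y0 Ce Cb d0 sg s7 ff g h| <= #|Cb|)%N.
Proof.
move=> sh.
have h1 : (#|forb_col Y0 Ce Cb d0 sg s7 ff g h| <= ff + s7.+1)%N.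
  set bs := base_of Y0 Ce Cb d0 sg s7 ff g.
  have f1 : (#|[set k0 in Cb | [exists e in bE bs, g e == Some k0]]%SET| <= ff)%N.
    rewrite /bs /base_of; case: pselect => [e|_]; first by case: (projT2 (cid e)).
    rewrite (_ : [set _ in _ | _]%SET = finset.set0) ?cards0 //; apply/setP => k0; rewrite !inE /=.
    by apply/negP => /andP[_ /existsP[e]]; rewrite inE.
  have f2 : (#|[set k0 : 'I_c | [exists e, h e == Some k0]]%SET| <= #|supp h|)%N.
    have Si : injective (@Some 'I_c) by move=> x y [].
    rewrite -(card_imset _ Si); apply: leq_trans (leq_imset_card h _).
    apply: subset_leq_card; apply/fintype.subsetP => o /imsetP[k0]; rewrite inE => /existsP[e /eqP he] ->.
    by apply/imsetP; exists e => //; rewrite inE he.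
  apply: leq_trans (leq_add f1 (leq_trans f2 sh)).
  apply: leq_trans (finset.leq_card_setU _ _).1; apply: subset_leq_card; apply/fintype.subsetP => k0.
  by rewrite !inE => /andP[-> /=].
apply: leq_trans (leq_mul (leqnn 2) h1) _; rewrite card_Cb -(ler_nat R) -(ler_pM2l (L_gt0 L3)).
apply: le_trans LN_c5; rewrite natrM natrD natrM natr_lpow -[s7.+1]addn1 natrD natrM.
have h2 := frac_pow_le (isT : (30 < 70)%N); have h3 := frac_pow_le (isT : (1 < 27)%N); rewrite exprS in h2; rewrite expr1 in h3.
have h4 := LL_N; move: h2 h3 h4 L3 N0; lra.
Qed.

(* There are about [expR (90 * L * s7)] partial choices of boosters, at most [expR (N / L ^+ 25)], whereas
   each of them fails with probability at most [expR (- 4 * N / L ^+ 25)]. *)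
Lemma unboosted_bound :
  P (@unboosted n c Y0 Ce Cb d0 (lpow 29) sg s7 (frac 70) (sg ^ 2 %/ 4)) <= expR (- L).
Proof.
(* The weight [L ^- 90] makes the number of potential edges harmless, as [2 * p * n ^ 2 / L ^+ 90]
   is below [N / L ^+ 25], and costs only a factor [L ^+ 90] per booster. *)
have y0 : 0 < (L ^+ 90)^-1 by rewrite invr_gt0 Lp_gt0.
have y1 : (L ^+ 90)^-1 <= 1 by rewrite invf_le1 ?Lp_gt0 // Lp_ge1.
apply: le_trans (mask_union (ltW p0) p_half c0 _ (away_edges_strip Y0 d0 dis_eb) _ _ forb_small y0 y1) _.
- by move=> g h e; rewrite inE => /and4P[h1 /eqP h2 /eqP h3 _].
- by move=> g h; apply/fintype.subsetP => k0; rewrite inE => /andP[].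
have [w [wE wL]] : exists w, N = w * L ^+ 25 /\ L <= w.
  exists (N / L ^+ 25); rewrite divfK ?gt_eqF ?Lp_gt0 //; split=> //.
  by rewrite ler_pdivlMr ?Lp_gt0 // -exprS N_ge.
have w0 : 0 < w by apply: lt_le_trans wL; exact: L_gt0.
have e1 : 2 * p * (L ^+ 90)^-1 * (n ^ 2)%:R <= w.
  rewrite natrX (_ : _ * _ * _ * _ = 2 * a * N / L ^+ 90); last by ring.
  rewrite ler_pdivrMr ?Lp_gt0 //; apply: (@le_trans _ _ (2 * (4 * L ^+ 60) * N)).
    by rewrite ler_wpM2r ?(ltW N0) // ler_wpM2l.
  rewrite wE (_ : 2 * _ * _ = 8 * L ^+ 85 * w); last by rewrite (_ : 85 = 60 + 25)%N // exprD; ring.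
  rewrite [leRHS]mulrC ler_wpM2r ?(ltW w0) //.
  by have := Lp_lt L3 (isT : (85 < 90)%N); have := Lp_gt0 L3 85; lra.
have e2 : ((L ^+ 90)^-1 ^+ s7.+1)^-1 <= expR w.
  rewrite exprVn invrK -exprM; apply: le_trans (Lp_exp L3 _) _; rewrite ler_expR.
  have h1 : L ^+ 2 * (frac 27)%:R <= w.
    rewrite -(ler_pM2r (Lp_gt0 L3 25)) -wE mulrAC -exprD mulrC; exact: frac_le.
  have h2 : 1000 * (L * (frac 27)%:R) <= w.
    apply: le_trans h1; rewrite mulrA expr2 ler_wpM2r // ler_wpM2r ?(ltW (L_gt0 L3)) //.
  have h3 : 1000 * (1000 * L) <= w.
    rewrite -(ler_pM2r (Lp_gt0 L3 25)) -wE; apply: le_trans (N_ge (isT : (28 <= 1000)%N)).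
    have g1 := Lp_lt L3 (isT : (26 < 27)%N); have g2 := Lp_lt L3 (isT : (27 < 28)%N).
    by rewrite [L ^+ 26]exprS in g1; move: g1 g2; lra.
  rewrite natrM -[s7.+1]addn1 natrD natrM; move: h2 h3 (L_gt0 L3) w0; lra.
apply: (@le_trans _ _ (expR w * expR w * expR (- (4 * w)))); last first.
  by rewrite -!expRD ler_expR; move: wL; lra.
rewrite card_Cb; apply: ler_pM; rewrite ?mulr_ge0 ?expR_ge0 ?invr_ge0 ?exprn_ge0 ?(ltW y0) //.
  by apply: ler_pM; rewrite ?expR_ge0 ?ler_expR ?invr_ge0 ?exprn_ge0 ?(ltW y0).
rewrite ler_expR lerN2.
have := p_frac_sqr_ge (erefl : 60 = (40 + 20)%N); rewrite (_ : p * q = p * c5%:R / c%:R); last by rewrite mulrA.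
set u := p * c5%:R / c%:R => h.
have u0 : 0 <= u by rewrite !mulr_ge0 ?(ltW p0) // invr_ge0 ltW // cR.
have n4 : (sg%:R : R) ^+ 2 <= 8 * (sg ^ 2 %/ 4)%:R.
  have sg3 : (8 <= sg ^ 2)%N.
    rewrite -(ler_nat R) natrX; have := frac_pow_le (isT : (39 < 40)%N) => _.
    have h8 : 8 <= sg%:R :> R.
      have := frac_ge (isT : (40 <= 1000)%N) => h9; have := le_trans (N_ge (isT : (41 <= 1000)%N)) h9.
      rewrite exprS ler_pM2r ?Lp_gt0 //; move: L3; lra.
    by rewrite expr2; nra.
  rewrite -natrX -natrM ler_nat; move: sg3; move: (sg ^ 2)%N => x; clear; lia.
have h5 : w * L ^+ 45 <= 32 * L ^+ 41 * (u * (sg ^ 2 %/ 4)%:R).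
  apply: le_trans (_ : L ^+ 20 * N <= _); first by rewrite wE [leRHS]mulrCA -exprD.
  apply: le_trans h _; rewrite [L ^+ 41]exprS.
  rewrite [leLHS](_ : _ = 4 * (L * L ^+ 40) * (u * sg%:R ^+ 2)); last by ring.
  rewrite [leRHS](_ : _ = 4 * (L * L ^+ 40) * (u * (8 * (sg ^ 2 %/ 4)%:R))); last by ring.
  rewrite ler_wpM2l ?mulr_ge0 ?(ltW (Lp_gt0 L3 _)) ?(ltW (L_gt0 L3)) // ler_wpM2l //.
rewrite -(ler_pM2r (Lp_gt0 L3 41)).
have h6 : 1000 * L ^+ 41 * w <= L ^+ 45 * w by rewrite ler_wpM2r ?(ltW w0) // Lp_lt.
have h7 := mulr_gt0 w0 (Lp_gt0 L3 41).
move: h5 h6 h7; move: (L ^+ 41) (L ^+ 45) (sg ^ 2 %/ 4)%:R => X Y Z; lra.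
Qed.

Lemma prob_has (s : seq (pred (outcome n c))) :
  P (fun f => has (fun A : pred (outcome n c) => A f) s) <= \sum_(A <- s) P A.
Proof.
elim: s => [|A s IH] /=; first by rewrite big_nil /Gc_prob big1.
by rewrite big_cons; apply: le_trans (prob_or p01 _ _) _; rewrite lerD2l.
Qed.

Notation events := (@bad_events n c Y0 Ce Cb d0 k th0 (lpow 29) (lpow 22) (frac 28) c5 sg (frac 70) s7 (lpow 28) (lpow 30)
  (frac 70) (sg ^ 2 %/ 4) (n * lpow 61)).

Lemma sum_events : \sum_(A <- events) P A <= 20 * expR (- L) + 16 * (N * a * expR (- a)).
Proof.
rewrite /bad_events !big_cons big_nil.
have := many_bad_bound; have := star_pattern_le; have := spider_pattern_le; have := crowded_small_bound.
have := small_poor_edge_le; have := small_poor_path_le; have := low_degree_bound; have := repeat_at_one_le; have := repeat_at_two_le.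
have := share_at_one_le; have := share_at_two_le; have := colour_dense_all_bound; have := colour_dense_Y0_bound; have := crowded_bound.
have := unlinked_bound; have := many_edges_bound; have := unboosted_bound.
do 17 (move: (P _) => ?).
have := expR_ge0 (- L); move: (expR (- L)) (N * a * expR (- a)) => *; lra.
Qed.

Lemma lpow_ltn i j : (i < j)%N -> (1000 * lpow i <= lpow j)%N.
Proof. by move=> ij; rewrite -(ler_nat R) natrM !natr_lpow; exact: Lp_lt. Qed.

Lemma likely_rainbow_ham : 1 - (20 * expR (- L) + 16 * (N * a * expR (- a))) <= P (@has_rainbow_ham n c).
Proof.
have h1 : P (fun f => ~~ has (fun A : pred (outcome n c) => A f) events) <= P (@has_rainbow_ham n c).
  apply: (prob_le p01) => f; apply: (good_rainbow_ham (Cm := Cm)).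
  - by rewrite -(ler_nat R); apply: le_trans (N_ge (isT : (1 <= 1000)%N)); rewrite expr1; move: L3; lra.
  - exact: dis_me.
  - exact: dis_mb.
  - exact: dis_eb.
  - have := lpow_ltn (isT : (29 < 31)%N); clear; lia.
  - clear; lia.
  - rewrite -(ler_nat R) natr_lpow; have := Lp_lt L3 (isT : (0 < 29)%N); rewrite expr0; lra.
  - have := lpow_ltn (isT : (28 < 29)%N); clear; lia.
  - by [].
  - have := lpow_ltn (isT : (29 < 31)%N); have := lpow_ltn (isT : (30 < 31)%N); clear; lia.
  (* At least [n + 2 * c5] colours lie in [Cm]: [n] for merging, [c5] for [q], and [c5] to cover
     those withdrawn for the poor vertices. *)
  - rewrite card_Cm.
    suff : (ff <= c5)%N by move: hc1; clear; lia.
    rewrite -(ler_nat R) -(ler_pM2l (L_gt0 L3)); apply: le_trans LN_c5.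
    rewrite natrM natr_lpow mulrA -exprS; have := frac_pow_le (isT : (30 < 70)%N); have := N0; lra.
  - rewrite card_Y0 -(ler_nat R) -(ler_pM2r (Lp_gt0 L3 27)).
    have h0 := frac_ge (isT : (27 <= 1000)%N).
    rewrite !natrD !natrM natr_lpow.
    have h2 := frac_pow_le (isT : (56 < 70)%N); have h3 := frac_pow_le (isT : (27 < 28)%N).
    rewrite (_ : L ^+ 56 = L ^+ 29 * L ^+ 27) in h2; last by rewrite -exprD.
    move: h0 h2 h3 N0; set u := L ^+ 29; set v := L ^+ 27; lra.
  - exact: frac_gt0.
  - rewrite -(ler_nat R) natrM !natrD natrX natrM natr_lpow.
    have q4 : (4 * (sg ^ 2 %/ 4)%:R : R) <= sg%:R ^+ 2 by rewrite -natrX -natrM ler_nat mulnC leq_trunc_div.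
    have h0 := frac_ge (isT : (40 <= 1000)%N).
    have h2 : L ^+ 62 * N <= 4 * sg%:R ^+ 2.
      rewrite -(ler_pM2l (Lp_gt0 L3 80)) mulrA -exprD.
      apply: (@le_trans _ _ (N * N)); first by rewrite ler_wpM2r ?(ltW N0) // N_ge.
      apply: (@le_trans _ _ (2 * sg%:R * L ^+ 40 * (2 * sg%:R * L ^+ 40))).
        by apply: ler_pM; rewrite ?(ltW N0).
      by rewrite (_ : 80 = 40 + 40)%N // exprD; lra.
    have h3 : 1000 * L ^+ 61 * N <= L ^+ 62 * N by rewrite ler_wpM2r ?(ltW N0) // Lp_lt.
    have h4 : 1 * N <= L ^+ 61 * N by rewrite ler_wpM2r ?(ltW N0) // Lp_ge1.
    have h5 := frac_pow_le (isT : (0 < 27)%N); rewrite expr0 in h5.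
    have h6 : 1 <= N by apply: le_trans (N_ge (isT : (0 <= 1000)%N)); rewrite expr0.
    rewrite -[s7.+1]addn1 natrD natrM.
    move: q4 h2 h3 h4 h5 h6; move: (L ^+ 61) (L ^+ 62) (sg%:R ^+ 2) (sg ^ 2 %/ 4)%:R => x y z t; lra.
apply: le_trans h1; rewrite (@prob_compl R n c p c0) lerD2l lerN2.
by apply: le_trans (prob_has _) _; exact: sum_events.
Qed.

End Final.

(** * The limit *)

Lemma ecol_subout n c (f g : outcome n c) u v : subout f g -> ecol f u v != None -> ecol g u v = ecol f u v.
Proof. by move=> fg h; have [e E] := ecol_ex h; rewrite !(ecol_edge _ E) in h *; exact: fg. Qed.

Lemma has_rainbow_ham_subout n c (f g : outcome n c) : subout f g -> has_rainbow_ham f -> has_rainbow_ham g.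
Proof.
move=> fg /andP[n3 /existsP[s /andP[/forallP h1 /injectiveP h2]]]; rewrite /has_rainbow_ham n3 /=.
have E i : ecol g (s i) (s (ordS i)) = ecol f (s i) (s (ordS i)) by apply: ecol_subout fg (h1 i).
apply/existsP; exists s; apply/andP; split; first by apply/forallP => i; rewrite E.
by apply/injectiveP => i j; rewrite !E => /h2.
Qed.

(** * An explicit error bound for fixed [n] *)

Section PerN.
Variables (R : realType) (eps w p : R) (n : nat).
Notation N := (n%:R : R).
Notation x := (ln N).
Notation y := (ln (ln N)).
Hypotheses (eps0 : 0 < eps) (p01 : 0 <= p <= 1) (pE : N * p = x + y + w) (w0 : 0 <= w).
Hypotheses (y1 : 1000 <= y / 60) (y2 : 8 * (1 + eps) / eps <= y / 60) (y3 : 1 + eps <= y / 60)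
  (n1 : 16 / eps <= N).

Lemma x_gt0 : 0 < x.
Proof.
rewrite ltNge; apply/negP => x0; have := ln0 x0; move: y1 => /[swap] ->.
by rewrite mul0r; lra.
Qed.

Lemma N_gt0 : 0 < N. Proof. by apply: lt_le_trans n1; rewrite divr_gt0. Qed.
Lemma exp_y : expR y = x. Proof. by rewrite lnK // posrE x_gt0. Qed.
Lemma exp_x : expR x = N. Proof. by rewrite lnK // posrE N_gt0. Qed.

(** The integer part of [expR (y / 60)], the 60th root of [ln n]. Rounding costs at most
    [(1 + 1 / l) ^ 60 <= expR (60 / l) <= 2], since [l >= 1000]. *)
Lemma root60 : exists l : nat, [/\ y / 60 <= l%:R, l%:R ^+ 60 <= x & x <= 2 * l%:R ^+ 60 :> R].
Proof.
pose l := Num.trunc (expR (y / 60)); exists l.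
have /andP[l1 l2] : l%:R <= expR (y / 60) < l.+1%:R by apply: truncn_itv; exact: expR_ge0.
have yl : y / 60 <= l%:R.
  by have := expR_ge1Dx (y / 60); move: l2; rewrite -addn1 natrD; lra.
have L_gt0 : 0 < l%:R :> R by move: y1 yl; lra.
have xE : x = expR (y / 60) ^+ 60 by rewrite -expRM_natr divfK ?exp_y.
split => //; first by rewrite xE lerXn2r ?nnegrE ?expR_ge0.
apply: (@le_trans _ _ (l.+1%:R ^+ 60)).
  by rewrite xE lerXn2r ?nnegrE ?expR_ge0 // ltW.
rewrite (_ : l.+1%:R = (1 + l%:R^-1) * l%:R); last by rewrite mulrDl mul1r mulVf ?gt_eqF // -addn1 natrD addrC.
rewrite exprMn ler_wpM2r ?exprn_ge0 ?(ltW L_gt0) //.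
apply: (@le_trans _ _ (expR (l%:R^-1) ^+ 60)).
  rewrite lerXn2r ?nnegrE ?expR_ge0 ?expR_ge1Dx // addr_ge0 // invr_ge0 ltW //.
rewrite -expRM_natr; apply: le_trans (expRhalf_le2 R); rewrite ler_expR.
rewrite mulrC ler_pdivrMr //; move: y1 yl; lra.
Qed.

Lemma ncolors_bounds : (1 + eps) * N - 1 <= (ncolors eps n)%:R <= (1 + eps) * N.
Proof.
have h0 : 0 <= (1 + eps) * N by rewrite mulr_ge0 // addr_ge0 // ltW.
rewrite /ncolors; set z := Num.floor _.
have z0 : 0 <= z by rewrite floor_ge0.
have -> : (absz z)%:R = z%:~R :> R by rewrite pmulrn gez0_abs.
by have := floor_itv ((1 + eps) * N); rewrite -/z intrD => /andP[-> h]; move: h; lra.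
Qed.

(** A quarter of [c - n], rounded down, is at least [eps * n / 8]; the assumptions on [l] make it
    exceed the constants by which [c] may be larger than [c5] and than [n]. *)
Lemma colour_params (l c : nat) : 8 * (1 + eps) / eps <= l%:R -> 1 + eps <= l%:R -> (1 + eps) * N - 1 <= c%:R <= (1 + eps) * N ->
  exists c5 : nat, [/\ (n + 4 * c5 <= c)%N, (c <= l * c5)%N & (c <= l * n)%N].
Proof.
rewrite ler_pdivrMr // => hl hl' /andP[c1 c2]; have N0 := N_gt0.
have n16 : 16 <= N * eps by rewrite -ler_pdivrMr.
have nc : (n <= c)%N by rewrite -(ler_nat R); move: c1 n16; lra.
exists ((c - n) %/ 4)%N; split.
- by have := leq_trunc_div (c - n) 4; move: nc; clear; lia.
- have h1 : (8 * ((c - n) %/ 4)%:R : R) >= N * eps.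
    have : ((c - n) < ((c - n) %/ 4).+1 * 4)%N by rewrite ltn_ceil.
    rewrite -(ltr_nat R) natrM -addn1 natrD natrB //; move: c1 n16; lra.
  rewrite -(ler_nat R) natrM -(ler_pM2r eps0); apply: le_trans (ler_wpM2r (ltW eps0) c2) _.
  apply: (@le_trans _ _ (l%:R * (N * eps) * eps / 8)).
    rewrite (_ : l%:R * _ * _ / 8 = (l%:R * eps) * (N * eps) / 8); last by ring.
    have := ler_wpM2r (ltW (mulr_gt0 N0 eps0)) hl; lra.
  have l0 : 0 <= l%:R * eps by rewrite mulr_ge0 // ltW.
  have := ler_wpM2l l0 h1; lra.
- rewrite -(ler_nat R) natrM; apply: le_trans c2 _; rewrite ler_wpM2r ?(ltW N0) //.
Qed.

Lemma rainbow_ham_bound :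
  1 - (20 * expR (- (y / 60)) + 64 * (expR (- w) + expR (- y))) <= Gc_prob p (@has_rainbow_ham n (ncolors eps n)).
Proof.
have [l [yl lx xl]] := root60; have N0 := N_gt0; have x0 := x_gt0; have [p0 p1] := andP p01.
have [c5 [hc1 hc2 hc3]] := colour_params (le_trans y2 yl) (le_trans y3 yl) ncolors_bounds.
have L3 : 1000 <= l%:R :> R := le_trans y1 yl.
have y0 : 0 <= y by move: y1; lra.
(* By monotonicity the excess [w] may be cut off at [ln (ln n)], which keeps the density below [2 ln n / n]. *)
pose v := Num.min w y; have v0 : 0 <= v by rewrite le_min w0.
have vw : v <= w by rewrite ge_min lexx.
have vy : v <= y by rewrite ge_min lexx orbT.
pose p' := (x + y + v) / N.
have pN : N * p' = x + y + v by rewrite /p' mulrC divfK // gt_eqF.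
have p'0 : 0 <= p' by rewrite divr_ge0 ?(ltW N0) // !addr_ge0 // ltW.
have p'p : p' <= p by rewrite -(ler_pM2l N0) pN pE lerD2l.
have c0 : (0 < ncolors eps n)%N.
  by apply: leq_trans hc1; rewrite addn_gt0 -(ltr0n R) N0.
apply: le_trans (prob_monotone c0 p'0 p'p p1 (@has_rainbow_ham_subout n (ncolors eps n))).
(* With [e = expR (y / 2)]: [x = e ^ 2 >= 4 * e - 4 >= 2 * y]. *)
have y2x : 2 * y <= x.
  have := expR_ge1Dx (y / 2); have e0 := expR_gt0 (y / 2).
  have : x = expR (y / 2) * expR (y / 2) by rewrite -expRD -[LHS]exp_y; congr expR; field.
  have := sqr_ge0 (expR (y / 2) - 2); rewrite expr2; move: (expR (y / 2)) e0 => e _ h1 h2 h3; rewrite [leRHS]h2; move: h1 h3; lra.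
have a2 : x + y + v <= 2 * x by move: y2x vy; lra.
have ax : x <= x + y + v by rewrite -addrA lerDl addr_ge0.
have Nx : N * expR (- x) = 1 by rewrite expRN exp_x mulfV // gt_eqF.
have nlo : expR (l%:R ^+ 60) <= N by rewrite -exp_x ler_expR.
have nhi : N <= expR (2 * l%:R ^+ 60) by rewrite -exp_x ler_expR.
have plo : l%:R ^+ 60 <= N * p' by rewrite pN; apply: le_trans lx ax.
have phi : N * p' <= 4 * l%:R ^+ 60 by rewrite pN; move: a2 xl; lra.
have psm : N * expR (- (N * p')) <= 1 by rewrite pN -[leRHS]Nx ler_pM2l // ler_expR lerN2.
apply: le_trans (likely_rainbow_ham L3 nlo nhi plo phi psm hc1 hc2 hc3).
rewrite lerD2l lerN2; apply: lerD; first by rewrite ler_wpM2l // ler_expR lerN2.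
rewrite pN !opprD !expRD.
(* The factor [expR (- y)] is [1 / ln n] and cancels the density [x + y + v <= 2 * ln n]; only
   [expR (- v)] is left, which tends to [0] with the excess. *)
rewrite (_ : N * _ * _ = (N * expR (- x)) * ((x + y + v) * expR (- y)) * expR (- v)); last by ring.
rewrite Nx mul1r.
have h1 : (x + y + v) * expR (- y) <= 2.
  rewrite expRN exp_y ler_pdivrMr //.
have h2 : expR (- v) <= expR (- w) + expR (- y).
  by rewrite /v; case: (leP w y) => _; rewrite ?lerDl ?lerDr expR_ge0.
have h3 := ler_wpM2r (expR_ge0 (- v)) h1.
have h4 := expR_ge0 (- v).
move: h2 h3 h4; move: ((x + y + v) * expR (- y) * expR (- v)) (expR (- v)) (expR (- w)) (expR (- y)) => T V W Y; lra.
Qed.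

End PerN.

Local Open Scope classical_set_scope.
Local Open Scope ring_scope.

Lemma cvg_expN (R : realType) (u : nat -> R) : u @ \oo --> +oo -> (fun n => expR (- u n)) @ \oo --> (0 : R).
Proof. by move=> uy; apply: cvg_comp uy (@cvgr_expR R). Qed.

Lemma cvg_lny (R : realType) (u : nat -> R) : u @ \oo --> +oo -> (fun n => ln (u n)) @ \oo --> +oo.
Proof.
move=> /cvgryPge uy; apply/cvgryPge => A; near=> n.
have h : expR A <= u n by near: n; exact: uy.
by rewrite -ler_expR lnK // posrE; apply: lt_le_trans h; exact: expR_gt0.
Unshelve. all: by end_near. Qed.

Theorem theorem1 (R : realType) (eps : R) (heps : 0 < eps) (p : nat -> R)
  (hp : forall n, 0 <= p n <= 1)
  (homega : (fun n : nat => n%:R * p n - ln (n%:R : R) - ln (ln (n%:R : R)))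
              @ \oo --> +oo) :
  Gc_prob (p n) (@has_rainbow_ham n (ncolors eps n)) @[n --> \oo] --> (1 : R).
Proof.
pose w n := n%:R * p n - ln (n%:R : R) - ln (ln (n%:R : R)).
pose y n := ln (ln (n%:R : R)).
have yy : y @ \oo --> +oo by apply: cvg_lny; apply: cvg_lny; exact: cvgr_idn.
have y60 : (fun n => y n / 60) @ \oo --> +oo.
  move/cvgryPge: yy => yy; apply/cvgryPge => A.
  by apply: filterS (yy (A * 60)) => n; rewrite ler_pdivlMr.
pose lb n : R := 1 - (20 * expR (- (y n / 60)) + 64 * (expR (- w n) + expR (- y n))).
have lb1 : lb @ \oo --> (1 : R).
  rewrite -[X in _ --> X]subr0; apply: cvgB; first exact: cvg_cst.
  rewrite -[X in _ --> X]addr0; apply: cvgD.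
    by rewrite -[X in _ --> X](mulr0 20); apply: cvgM; [exact: cvg_cst|exact: cvg_expN].
  rewrite -[X in _ --> X](mulr0 64); apply: cvgM; first exact: cvg_cst.
  by rewrite -[X in _ --> X]addr0; apply: cvgD; exact: cvg_expN.
apply: (@squeeze_cvgr _ _ _ _ lb (fun=> 1)); [|exact: lb1|exact: cvg_cst].
near=> n; apply/andP; split.
  apply: rainbow_ham_bound => //.
  - by rewrite /w; ring.
  - by near: n; move/cvgryPge: homega; exact.
  - by near: n; move/cvgryPge: y60; exact.
  - by near: n; move/cvgryPge: y60; exact.
  - by near: n; move/cvgryPge: y60; exact.
  - by near: n; move/cvgryPge: (@cvgr_idn R); exact.
have c0 : (0 < ncolors eps n)%N.
  have N2 : 2 <= n%:R :> R by near: n; move/cvgryPge: (@cvgr_idn R); exact.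
  have /andP[h _] := @ncolors_bounds R eps n heps.
  rewrite -(@ltr0n R); apply: lt_le_trans h; have := mulr_gt0 heps (lt_le_trans (ltr0Sn R 1) N2); lra.
by rewrite -(@prob_total R n (ncolors eps n) (p n) c0); apply: (prob_le (hp n)).
Unshelve. all: by end_near. Qed.
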